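(* Let $\Omega$ be a domain in $\mathbb R^d$ of finite measure, let $\Lambda_1\le\Lambda_2\le\cdots$ be the eigenvalues of the biharmonic Dirichlet problem on $\Omega$ and $U_j$ corresponding eigenfunctions forming an orthonormal basis of $L^2(\Omega)$. Then for any $\phi\in H^2_0(\Omega)\cap L^\infty(\Omega)$, $\phi\not\equiv0$, and any $z>0$, $$\sum_j(z-\Lambda_j)_+\|\phi U_j\|_2^2\ge\frac4{d+4}(2\pi)^{-d}B_d\|\phi\|_2^2\left(z-\frac{\|\Delta\phi\|_2^2}{\|\phi\|_2^2}\right)_+^{\frac d4+1}-2(2\pi)^{-d}B_d\|\nabla\phi\|_2^2\left(z-\frac{\|\Delta\phi\|_2^2}{\|\phi\|_2^2}\right)_+^{\frac d4+\frac12}.$$ Moreover, for all positive integers $k$, $$\frac1k\sum_{j=1}^k\Lambda_j\le\frac d{d+4}C_d^2\left(\frac k{|\Omega|}\right)^{\frac4d}\rho(\phi)^{-\frac4d}+2\frac{\|\nabla\phi\|_2^2}{\|\phi\|_2^2}C_d\left(\frac k{|\Omega|}\right)^{\frac2d}\rho(\phi)^{-\frac2d}+\frac{\|\Delta\phi\|_2^2}{\|\phi\|_2^2},$$ for $\rho(\phi)<1$, where $$\rho(\phi)=\frac{\|\phi\|_2^2}{|\Omega|\cdot\|\phi\|_\infty^2}.$$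
   Context: $B_d=\pi^{d/2}/\Gamma(1+d/2)$ is the volume of the unit ball of $\mathbb R^d$ and $C_d=(2\pi)^2B_d^{-2/d}$. $\|\cdot\|_2,\|\cdot\|_\infty$ are the $L^2(\Omega)$ and $L^\infty(\Omega)$ norms; $x_+=\max\{x,0\}$; $|\Omega|$ is Lebesgue measure. The biharmonic Dirichlet problem is $\Delta^2u=\Lambda u$ in $\Omega$, $u=\frac{\partial u}{\partial\nu}=0$ on $\partial\Omega$, understood weakly through the form $\int_\Omega\Delta u\,\Delta v$ on $H^2_0(\Omega)$; for $\Omega$ of finite measure its spectrum is a sequence of positive eigenvalues tending to infinity, listed with multiplicity. *)

(* Defs.v *)
From HB Require Import structures.
From mathcomp Require Import all_boot all_order all_algebra.
From mathcomp Require Import all_classical all_reals all_analysis.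

Set Implicit Arguments.
Unset Strict Implicit.
Unset Printing Implicit Defensive.
Import Order.TTheory GRing.Theory Num.Theory.
Import numFieldNormedType.Exports.
Local Open Scope classical_set_scope.
Local Open Scope ring_scope.

(* The Borel sets of R^n are generated by the coordinate maps. *)
Definition measure_rV_display : measure_display. Proof. exact. Qed.

Section measurable_rV.
Context {R : realType}.
Variable n : nat.

Let coord (i : 'I_n) (x : 'rV[R]_n) : measurableTypeR R := x ord0 i.

Let rV_set0 : g_sigma_preimage coord set0.
Proof. exact: sigma_algebra0. Qed.

Let rV_setC A : g_sigma_preimage coord A -> g_sigma_preimage coord (~` A).
Proof. exact: sigma_algebraC. Qed.

Let rV_bigcup (F : (set 'rV[R]_n)^nat) :
  (forall i, g_sigma_preimage coord (F i)) ->
  g_sigma_preimage coord (\bigcup_i (F i)).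
Proof. exact: sigma_algebra_bigcup. Qed.

HB.instance Definition _ := @isMeasurable.Build measure_rV_display
  'rV[R]_n (g_sigma_preimage coord) rV_set0 rV_setC rV_bigcup.

End measurable_rV.

(* Lebesgue measure on R^n: the n-fold product of the one-dimensional Lebesgue
   measure, built by recursion along R^(n+1) = R x R^n; it is characterized by
   its values on boxes in [lebesgue_rV_box]. *)
Section lebesgue_rV.
Context {R : realType}.

Definition cons_rV n (p : measurableTypeR R * 'rV[R]_n) : 'rV[R]_n.+1 :=
  \row_i (if unlift ord0 i is Some j then p.2 ord0 j else p.1).

Definition uncons_rV n (x : 'rV[R]_n.+1) : measurableTypeR R * 'rV[R]_n :=
  (x ord0 ord0, \row_j x ord0 (lift ord0 j)).

Lemma cons_rVK n : cancel (@cons_rV n) (@uncons_rV n).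
Proof.
move=> [a v]; rewrite /uncons_rV mxE unlift_none; congr pair.
by apply/rowP => j; rewrite !mxE liftK.
Qed.

Lemma measurable_coord_rV n (i : 'I_n) :
  measurable_fun [set: 'rV[R]_n] (fun x => x ord0 i : measurableTypeR R).
Proof.
move=> _ Y mY; rewrite setTI; apply: sub_sigma_algebra => /=.
rewrite -bigcup_seq/=; exists i => /=; first by rewrite mem_index_enum.
by exists Y => //; rewrite setTI.
Qed.

Lemma measurable_fun_rVP d (T : measurableType d) n (f : T -> 'rV[R]_n) :
  (forall i, measurable_fun [set: T] (fun t => f t ord0 i : measurableTypeR R)) ->
  measurable_fun [set: T] f.
Proof.
move=> mf.
have sub : g_sigma_preimage
    (fun i (x : T) => f x ord0 i : measurableTypeR R) `<=` measurable.
  apply: smallest_sub; first exact: sigma_algebra_measurable.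
  case: n => [|n] in f mf *; first by rewrite big_ord0.
  rewrite -bigcup_mkord_ord; apply: bigcup_sub => i Ii.
  by move=> A [B mB <-]; exact: mf.
move=> _ A mA; apply: sub.
pose c (i : 'I_n) (x : 'rV[R]_n) : measurableTypeR R := x ord0 i.
by rewrite (g_sigma_preimage_comp c f); exists A.
Qed.

Lemma measurable_cons_rV n : measurable_fun setT (@cons_rV n).
Proof.
apply: measurable_fun_rVP => i; rewrite /cons_rV.
under eq_fun do rewrite mxE.
case: unliftP => [j _|_]; last exact: measurable_fst.
by apply: (measurableT_comp (measurable_coord_rV j)); exact: measurable_snd.
Qed.

Lemma measurable_uncons_rV n : measurable_fun setT (@uncons_rV n).
Proof.
apply/measurable_fun_pairP; split; first exact: measurable_coord_rV.
apply: measurable_fun_rVP => i; rewrite /uncons_rV.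
by under eq_fun do rewrite /= mxE; exact: measurable_coord_rV.
Qed.

Section step.
Variables (n : nat) (m : {sigma_finite_measure set 'rV[R]_n -> \bar R}).

Definition lebesgue_step : set 'rV[R]_n.+1 -> \bar R :=
  pushforward (lebesgue_measure \x m)%E (@cons_rV n).

Let step0 : lebesgue_step set0 = 0%E.
Proof. by rewrite /lebesgue_step /pushforward preimage_set0 measure0. Qed.

Let step_ge0 A : (0 <= lebesgue_step A)%E.
Proof. exact: (measure_ge0 (lebesgue_measure \x m)%E). Qed.

Let step_sigma_additive : semi_sigma_additive lebesgue_step.
Proof.
have mf := @measurable_cons_rV n.
move=> F mF tF mUF; rewrite /lebesgue_step /pushforward preimage_bigcup.
apply: measure_semi_sigma_additive.
- by move=> k; rewrite -[X in measurable X]setTI; exact: mf.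
- apply/trivIsetP => /= i j _ _ ij; rewrite -preimage_setI.
  by move/trivIsetP : tF => /(_ _ _ _ _ ij) ->//; rewrite preimage_set0.
- by rewrite -preimage_bigcup -[X in measurable X]setTI; exact: mf.
Qed.

HB.instance Definition _ := isMeasure.Build _ _ _ lebesgue_step
  step0 step_ge0 step_sigma_additive.

Let step_sigma_finite : sigma_finite setT lebesgue_step.
Proof.
have /sigma_finiteP[F [TF ndF Foo]] := sigma_finiteT (@lebesgue_measure R).
have /sigma_finiteP[G [TG ndG Goo]] := sigma_finiteT m.
exists (fun k => @uncons_rV n @^-1` (F k `*` G k)).
  apply/seteqP; split=> // x _.
  have [i _ Fi] : (\bigcup_i F i) (uncons_rV x).1 by rewrite -TF.
  have [j _ Gj] : (\bigcup_i G i) (uncons_rV x).2 by rewrite -TG.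
  exists (maxn i j) => //; split.
    by move: Fi; exact/subsetPset/ndF/leq_maxl.
  by move: Gj; exact/subsetPset/ndG/leq_maxr.
move=> k; have [mF Fk] := Foo k; have [mG Gk] := Goo k; split.
  rewrite -[X in measurable X]setTI; apply: measurable_uncons_rV => //.
  exact: measurableX.
rewrite /lebesgue_step /pushforward -comp_preimage.
have -> : @uncons_rV n \o @cons_rV n = id.
  by apply/funext => p /=; rewrite cons_rVK.
rewrite preimage_id product_measure1E// lte_mul_pinfty// ge0_fin_numE//.
Qed.

HB.instance Definition _ := Measure_isSigmaFinite.Build _ _ _ lebesgue_step
  step_sigma_finite.

End step.

Fixpoint lebesgue_rV n : {sigma_finite_measure set 'rV[R]_n -> \bar R} :=
  if n is n'.+1 then lebesgue_step (lebesgue_rV n') else \d_ (0 : 'rV[R]_0).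

Lemma lebesgue_rV_box n (A : 'I_n -> set (measurableTypeR R)) :
  (forall i, measurable (A i)) ->
  lebesgue_rV n [set x | forall i, A i (x ord0 i)] =
  (\prod_(i < n) lebesgue_measure (A i))%E.
Proof.
elim: n A => [|n IH] A mA.
  rewrite big_ord0 /= diracE mem_set//= => -[].
  by [].
rewrite big_ord_recl -IH// /= /lebesgue_step /pushforward.
rewrite -product_measure1E//; last first.
  rewrite [X in measurable X](_ : _ = \bigcap_(i in [set: 'I_n])
      ((fun x : 'rV[R]_n => x ord0 i : measurableTypeR R)
        @^-1` (A (lift ord0 i)))).
    apply: fin_bigcap_measurable => // i _.
    by rewrite -[X in measurable X]setTI; exact: measurable_coord_rV.
  by apply/seteqP; split=> x /= xA i; [move=> _|]; exact: xA.
congr (_ _); apply/seteqP; split=> -[a v] /=.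
  move=> vA; split; first by have := vA ord0; rewrite mxE unlift_none.
  by move=> i; have := vA (lift ord0 i); rewrite mxE liftK.
move=> [aA vA] i; rewrite mxE.
by case: unliftP => [j ->|->] //; exact: vA.
Qed.

End lebesgue_rV.

(* Functions on Omega are real-valued and represented by total functions on R^d
   whose values outside Omega are irrelevant: norms, scalar products and
   integrability conditions only involve the restriction to Omega. *)
Section function_spaces.
Context {R : realType} {d : nat}.
Implicit Types (Omega : set 'rV[R]_d) (u v g psi : 'rV[R]_d -> R).

Definition in_Lp (p : \bar R) Omega u : Prop :=
  u \_ Omega \in Lfun (lebesgue_rV d) p.

Definition normLp (p : \bar R) Omega u : R :=
  fine ('N[lebesgue_rV d]_p[EFin \o (u \_ Omega)])%E.

Definition dotL2 Omega u v : R :=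
  \int[lebesgue_rV d]_(x in Omega) (u x * v x).

Definition ae_zero Omega u : Prop :=
  {ae lebesgue_rV d, forall x, Omega x -> u x = 0}.

Definition partial (i : 'I_d) u : 'rV[R]_d -> R :=
  fun x => 'D_(delta_mx 0 i) u x.

(* Multi-indices are encoded as lists of directions of differentiation. *)
Definition partials (s : seq 'I_d) u : 'rV[R]_d -> R := foldr partial u s.

Definition smooth u : Prop :=
  forall s : seq 'I_d, continuous (partials s u) /\
    forall i x, derivable (partials s u) x (delta_mx 0 i).

Definition test_function Omega psi : Prop :=
  let supp := closure [set x | psi x != 0] in
  [/\ smooth psi, compact supp & supp `<=` Omega].

Definition is_weak_partial Omega (s : seq 'I_d) u g : Prop :=
  in_Lp 2%:E Omega g /\
  forall psi, test_function Omega psi ->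
    dotL2 Omega u (partials s psi) = (-1) ^+ size s * dotL2 Omega g psi.

(* A chosen representative of the weak derivative in L^2(Omega), which is unique
   up to a null set; 0 when there is none. *)
Definition weak_partial Omega (s : seq 'I_d) u : 'rV[R]_d -> R :=
  xget (fun=> 0) [set g | is_weak_partial Omega s u g].

Definition weak_laplacian Omega u : 'rV[R]_d -> R :=
  fun x => \sum_(i < d) weak_partial Omega [:: i; i] u x.

Definition norm_grad Omega u : R :=
  Num.sqrt (\sum_(i < d) normLp 2%:E Omega (weak_partial Omega [:: i] u) ^+ 2).

Definition H2 Omega u : Prop :=
  in_Lp 2%:E Omega u /\
  forall s : seq 'I_d, (size s <= 2)%N -> exists g, is_weak_partial Omega s u g.

Definition normH2 Omega u : R :=
  Num.sqrt (normLp 2%:E Omega u ^+ 2 + norm_grad Omega u ^+ 2 +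
    \sum_(i < d) \sum_(j < d)
      normLp 2%:E Omega (weak_partial Omega [:: i; j] u) ^+ 2).

(* H^2_0(Omega) is the closure of C_c^oo(Omega) in H^2(Omega). *)
Definition H20 Omega u : Prop :=
  H2 Omega u /\
  forall e : R, 0 < e ->
    exists2 psi, test_function Omega psi & normH2 Omega (u \- psi) < e.

Definition biharmonic_eigenfunction Omega (l : R) u : Prop :=
  [/\ H20 Omega u, ~ ae_zero Omega u &
   forall v, H20 Omega v ->
     dotL2 Omega (weak_laplacian Omega u) (weak_laplacian Omega v) =
     l * dotL2 Omega u v].

Definition orthonormal_basis_L2 Omega (U : nat -> 'rV[R]_d -> R) : Prop :=
  [/\ forall j, in_Lp 2%:E Omega (U j),
      forall i j, dotL2 Omega (U i) (U j) = (i == j)%:R &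
      forall f, in_Lp 2%:E Omega f ->
        normLp 2%:E Omega
          (fun x => f x - \sum_(j < n) dotL2 Omega f (U j) * U j x)
          @[n --> \oo] --> 0].

(* Indices start at 0: [Lambda 0] is the first eigenvalue. As the [U j] form an
   orthonormal basis of L^2(Omega), the nondecreasing sequence [Lambda] lists
   all the eigenvalues, each repeated according to its multiplicity. *)
Definition biharmonic_spectrum Omega (Lambda : nat -> R)
    (U : nat -> 'rV[R]_d -> R) : Prop :=
  [/\ forall j, Lambda j <= Lambda j.+1,
      forall j, biharmonic_eigenfunction Omega (Lambda j) (U j) &
      orthonormal_basis_L2 Omega U].

Definition volume Omega : R := fine (lebesgue_rV d Omega).

Definition rho Omega u : R :=
  normLp 2%:E Omega u ^+ 2 / (volume Omega * normLp +oo%E Omega u ^+ 2).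

End function_spaces.

Section constants.
Variable R : realType.

Definition Gamma (x : R) : R :=
  \int[lebesgue_measure]_(t in `]0, +oo[) (t `^ (x - 1) * expR (- t)).

Definition ball_volume (d : nat) : R :=
  pi `^ (d%:R / 2) / Gamma (1 + d%:R / 2).

Definition weyl_constant (d : nat) : R :=
  (2 * pi) ^+ 2 * ball_volume d `^ (- (2 / d%:R)).

End constants.

(* Main.v *)
(* Apply the variational inequality
     z |u|^2 - |Delta u|^2 <= \sum_j (z - Lambda_j)_+ <u, U_j>^2   (u in H^2_0)
   to u = phi cos(xi.x) and u = phi sin(xi.x), add, and integrate over the ball
   |xi| <= r. On the left the integrand is an explicit polynomial in xi; on the
   right <u, U_j> is the Fourier transform of phi U_j, so Bessel's inequality
   gives (2 pi)^d \sum_j (z - Lambda_j)_+ |phi U_j|^2. The choice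
   r^4 = (z - |Delta phi|^2 / |phi|^2)_+ yields the lower bound. For the upper
   bound take for z the (k+1)-st eigenvalue, bound |phi U_j| by the essential
   supremum of phi and optimize r. *)
Require Import Defs.
From HB Require Import structures.
From mathcomp Require Import all_boot all_order all_algebra.
From mathcomp Require Import all_classical all_reals all_analysis.
From mathcomp Require Import fingroup perm measurable_realfun ess_sup_inf.
From mathcomp Require Import ring lra.
Import Order.TTheory GRing.Theory Num.Theory.
Import numFieldNormedType.Exports.
Set Implicit Arguments.
Unset Strict Implicit.
Unset Printing Implicit Defensive.
Local Open Scope classical_set_scope.
Local Open Scope ring_scope.

(** * Lebesgue measure on R^n *)

(** Bessel's inequality suffices because the weights (z - Lambda_j)_+ are nonnegative and each ball
    integral only has to be bounded from above. It rests on the weight exp(- e sum_i |xi_i|): its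
    transform is a nonnegative kernel of mass (2 pi)^d for every e > 0, so f(x) f(y) <= (f(x)^2 +
    f(y)^2) / 2 under the double integral gives a bound uniform in e. The variational inequality
    uses completeness of the U_j in L^2 only. Among the terms left by the n-th partial sum P_n u,
    the one coming from Delta, a squared norm, is discarded by its sign, and z |u - P_n u|^2 tends
    to 0. Adding the cosine and the sine cancels the cross terms pointwise and leaves |Delta phi -
    |xi|^2 phi|^2 + 4 |xi.grad phi|^2. Green's formula in H^2_0 then turns - 2 |xi|^2 <phi, Delta
    phi> into 2 |xi|^2 |grad phi|^2. Weak derivatives are chosen representatives, so their calculus
    holds almost everywhere and rests on their uniqueness. The plane waves are admissible because
    H^2_0 is stable under multiplication by smooth functions with bounded derivatives. *)

Section lebesgue_rV_basics.
Context {R : realType}.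
Implicit Types n : nat.

Definition open_box n (a b : 'I_n -> R) : set 'rV[R]_n :=
  [set x | forall i, x ord0 i \in `]a i, b i[].

Definition open_boxes n : set (set 'rV[R]_n) :=
  [set A | exists a b, A = open_box a b].

Lemma measurable_box n (A : 'I_n -> set (measurableTypeR R)) :
  (forall i, measurable (A i)) ->
  measurable [set x : 'rV[R]_n | forall i, A i (x ord0 i)].
Proof.
move=> mA; rewrite [X in measurable X](_ : _ = \bigcap_(i in [set: 'I_n])
    ((fun x : 'rV[R]_n => x ord0 i : measurableTypeR R) @^-1` (A i))).
  apply: fin_bigcap_measurable => // i _.
  by rewrite -[X in measurable X]setTI; exact: measurable_coord_rV.
by apply/seteqP; split=> x /= xA i; [move=> _|]; exact: xA.
Qed.

Lemma measurable_open_box n (a b : 'I_n -> R) : measurable (open_box a b).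
Proof.
by apply: (@measurable_box n (fun i => `]a i, b i[%classic)) => i;
  exact: measurable_itv.
Qed.

Lemma setI_open_boxes n : setI_closed (@open_boxes n).
Proof.
move=> _ _ [a [b ->]] [a' [b' ->]].
exists (fun i => Num.max (a i) (a' i)), (fun i => Num.min (b i) (b' i)).
apply/seteqP; split => x /=.
  move=> [h h'] i; move: (h i) (h' i); rewrite !in_itv/=.
  by rewrite gt_max lt_min => /andP[-> ->] /andP[-> ->].
move=> h; split=> i; move: (h i); rewrite !in_itv/= gt_max lt_min;
  by move=> /andP[/andP[? ?] /andP[? ?]]; apply/andP.
Qed.

Lemma open_boxes_cover n :
  \bigcup_k @open_box n (fun=> - k%:R) (fun=> k%:R) = setT.
Proof.
apply/seteqP; split=> // x _.
exists (Num.truncn (\sum_i `|x ord0 i|)).+1 => //= i.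
have : `|x ord0 i| < (Num.truncn (\sum_i `|x ord0 i|)).+1%:R.
  apply: le_lt_trans (truncnS_gt _).
  by rewrite (bigD1 i)//= lerDl sumr_ge0.
by rewrite in_itv/= ltr_norml.
Qed.

(** Makes the boxes, a pi-system of sets of finite measure, available for the uniqueness of measures
    and for Dynkin arguments. A half-space x_i > c is a countable union of boxes. *)
Lemma measurable_rVE n : @measurable _ 'rV[R]_n = <<s @open_boxes n >>.
Proof.
apply/seteqP; split; last first.
  apply: smallest_sub; first exact: sigma_algebra_measurable.
  by move=> _ [a [b ->]]; exact: measurable_open_box.
apply: smallest_sub; first exact: smallest_sigma_algebra.
rewrite -bigcup_seq => A [i _] [B mB <-].
rewrite setTI.
pose S := [set B : set R | <<s @open_boxes n >>
  ((fun x : 'rV[R]_n => x ord0 i) @^-1` B)].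
suff : (@ocitv R).-sigma.-measurable `<=` S by apply.
(* [S] is a sigma-algebra, so it is enough that it contains the half-lines []c, +oo[]. *)
rewrite RGenOInfty.measurableE.
apply: smallest_sub.
  split.
  - rewrite /S/= preimage_set0; exact: (@measurable0 _ (g_sigma_algebraType _)).
  - move=> C SC; rewrite /S/= setTD preimage_setC.
    exact: (@measurableC _ (g_sigma_algebraType _)).
  - move=> F SF; rewrite /S/= preimage_bigcup.
    exact: (@bigcupT_measurable _ (g_sigma_algebraType _)).
move=> _ [c ->]; rewrite /S/=.
rewrite [X in <<s _ >> X](_ : _ = \bigcup_k
    (open_box (fun j : 'I_n => if j == i then c else - k%:R) (fun=> k%:R))).
  apply: (@bigcupT_measurable _ (g_sigma_algebraType _)) => k.
  by apply: sub_sigma_algebra; do 2 eexists.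
apply/seteqP; split=> x /=.
  rewrite in_itv/= andbT => cx.
  have : setT x by []. rewrite -open_boxes_cover => -[k _ /= xk].
  exists k => //= j; move: (xk j); rewrite !in_itv/= => /andP[? ->].
  by case: eqP => [->|_]; rewrite ?cx// andbT.
by move=> [k _ /= /(_ i)]; rewrite eqxx !in_itv/= => /andP[->].
Qed.

Lemma measure_rV_unique n (m1 m2 : {measure set 'rV[R]_n -> \bar R}) :
  (forall a b : 'I_n -> R, m1 (open_box a b) = m2 (open_box a b)) ->
  (forall a b : 'I_n -> R, (m1 (open_box a b) < +oo)%E) ->
  forall A, measurable A -> m1 A = m2 A.
Proof.
move=> m12 m1oo; apply: (measure_unique (@open_boxes n)
   (fun k => open_box (fun=> - k%:R) (fun=> k%:R))).
- exact: measurable_rVE.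
- exact: setI_open_boxes.
- by move=> k; do 2 eexists.
- exact: open_boxes_cover.
- by move=> _ [a [b ->]].
- by move=> k.
Qed.

Lemma lebesgue_open_box n (a b : 'I_n -> R) :
  lebesgue_rV n (open_box a b) = (\prod_i Num.max (b i - a i) 0)%:E.
Proof.
rewrite /open_box (@lebesgue_rV_box R n (fun i => `]a i, b i[%classic)); last first.
  by move=> i; exact: measurable_itv.
rewrite -prodEFin; apply: eq_bigr => i _.
rewrite lebesgue_measure_itv/= lte_fin; case: ltP => ab.
  by rewrite -EFinD max_l// subr_ge0 ltW.
by rewrite max_r// subr_le0.
Qed.

Lemma emeasurable_prod d (T : measurableType d) (D : set T) (I : Type)
    (s : seq I) (h : I -> T -> \bar R) :
  (forall i, measurable_fun D (h i)) ->
  measurable_fun D (fun x => \prod_(i <- s) h i x)%E.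
Proof.
move=> mh; elim: s => [|i s IH].
  by under eq_fun do rewrite big_nil; exact: measurable_cst.
by under eq_fun do rewrite big_cons; exact: emeasurable_funM.
Qed.

Lemma prode_ge0 (I : Type) (s : seq I) (P : pred I) (h : I -> \bar R) :
  (forall i, P i -> (0 <= h i)%E) -> (0 <= \prod_(i <- s | P i) h i)%E.
Proof. by move=> h0; elim/big_ind : _ => // x y; exact: mule_ge0. Qed.

Lemma ge0_integral_rVS n (f : 'rV[R]_n.+1 -> \bar R) :
  measurable_fun [set: 'rV[R]_n.+1] f -> (forall x, (0 <= f x)%E) ->
  (\int[lebesgue_rV n.+1]_x f x =
   \int[lebesgue_measure]_a \int[lebesgue_rV n]_v f (cons_rV (a, v)))%E.
Proof.
move=> mf f0.
have mc := @measurable_cons_rV R n.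
transitivity (\int[(lebesgue_measure \x lebesgue_rV n)%E]_z (f \o @cons_rV R n) z)%E.
  by rewrite /= /lebesgue_step ge0_integral_pushforward// preimage_setT.
rewrite (fubini_tonelli1 (f \o @cons_rV R n))//.
  exact: measurableT_comp.
by move=> x; exact: f0.
Qed.

(** Reduces the integrals of the Abel weight, of the Poisson kernel and of the Gaussian to one
    dimension. *)
Lemma ge0_integral_rV_prod n (f : 'I_n -> measurableTypeR R -> \bar R) :
  (forall i, measurable_fun [set: measurableTypeR R] (f i)) ->
  (forall i x, (0 <= f i x)%E) ->
  (\int[lebesgue_rV n]_x (\prod_i f i (x ord0 i)) =
   \prod_i \int[lebesgue_measure]_t f i t)%E.
Proof.
elim: n f => [|n IH] f mf f0.
  under eq_integral do rewrite big_ord0.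
  by rewrite big_ord0 integral_cst//= diracE mem_set//= mule1.
rewrite ge0_integral_rVS; last first.
- by move=> x; apply: prode_ge0 => i _.
- apply: emeasurable_prod => i _.
  exact: (measurableT_comp (mf _) (measurable_coord_rV _)).
rewrite big_ord_recl -ge0_integralZr//; last first.
  by apply: prode_ge0 => i _; exact: integral_ge0.
apply: eq_integral => a _.
under eq_integral => v _.
  rewrite big_ord_recl mxE unlift_none/=.
  under eq_bigr do rewrite mxE liftK/=.
  over.
rewrite ge0_integralZl//.
- by congr (_ * _)%E; exact: (IH (fun i => f (lift ord0 i))).
- apply: emeasurable_prod => i _.
  exact: (measurableT_comp (mf _) (measurable_coord_rV _)).
- by move=> v _; apply: prode_ge0 => i _.
Qed.

End lebesgue_rV_basics.

(** * Affine changes of variables for Lebesgue measure *)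

Section lebesgue_rV_affine.
Context {R : realType} {n : nat}.
Implicit Types (c b : 'I_n -> R) (s : {perm 'I_n}).

(** Scalings of the coordinates, permutations and translations map boxes to boxes, so no determinant
    is involved. They cover all uses below: translations, dilations, reflections and exchanges of
    coordinates. *)
Definition affine_rV c s b (x : 'rV[R]_n) : 'rV[R]_n :=
  \row_i (c i * x ord0 (s i) + b i).

Lemma measurable_affine_rV c s b : measurable_fun [set: 'rV[R]_n] (affine_rV c s b).
Proof.
apply: measurable_fun_rVP => i; rewrite /affine_rV.
under eq_fun do rewrite mxE.
apply: measurable_funD; last exact: measurable_cst.
apply: measurable_funM; first exact: measurable_cst.
exact: measurable_coord_rV.
Qed.

Lemma lebesgue_measure_affine_itvoo (c b u v : R) : c != 0 ->
  lebesgue_measure ((fun t : R => c * t + b) @^-1` `]u, v[%classic) =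
  (`|c|^-1 * Num.max (v - u) 0)%:E.
Proof.
move=> c0.
have -> : (fun t : R => c * t + b) @^-1` `]u, v[%classic =
   (if 0 < c then `](u - b) / c, (v - b) / c[ else `](v - b) / c, (u - b) / c[)%classic.
  apply/seteqP; split => t /=; case: ltP => c0'; rewrite /= !in_itv/=.
  - by rewrite ltr_pdivrMr// ltr_pdivlMr// ltrBlDr ltrBrDr mulrC.
  - have {}c0' : c < 0 by rewrite lt_neqAle c0.
    by rewrite ltr_ndivrMr// ltr_ndivlMr// ltrBlDr ltrBrDr mulrC andbC.
  - by rewrite ltr_pdivrMr// ltr_pdivlMr// ltrBlDr ltrBrDr mulrC.
  - have {}c0' : c < 0 by rewrite lt_neqAle c0.
    by rewrite ltr_ndivrMr// ltr_ndivlMr// ltrBlDr ltrBrDr mulrC andbC.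
case: ltP => c0'; rewrite lebesgue_measure_itv/= lte_fin.
  rewrite ltr_pM2r ?invr_gt0// ltrD2r gtr0_norm//.
  case: ltP => uv; last by rewrite max_r ?mulr0// subr_le0.
  by rewrite max_l ?subr_ge0 1?ltW// -EFinB -mulrBl mulrC; congr (_ * _)%:E; ring.
have {}c0' : c < 0 by rewrite lt_neqAle c0.
rewrite ltr_nM2r ?invr_lt0// ltrD2r ltr0_norm//.
case: ltP => uv; last by rewrite max_r ?mulr0// subr_le0.
rewrite max_l ?subr_ge0 1?ltW// -EFinB -mulrBl mulrC invrN; congr (_)%:E; ring.
Qed.

Lemma lebesgue_rV_affine c s b (A : set 'rV[R]_n) : (forall i, c i != 0) ->
  measurable A ->
  lebesgue_rV n (affine_rV c s b @^-1` A) =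
  ((\prod_i `|c i|^-1)%:E * lebesgue_rV n A)%E.
Proof.
move=> c0 mA.
have k0 : 0 <= \prod_i `|c i|^-1 by apply: prodr_ge0 => i _; rewrite invr_ge0.
pose m1 : {measure set 'rV[R]_n -> \bar R} :=
  measure_function_pushforward__canonical__measure_function_Measure
    (lebesgue_rV n) (measurable_affine_rV c s b).
pose m2 := [the {measure set 'rV[R]_n -> \bar R} of
   mscale (NngNum k0) (lebesgue_rV n)].
have H u v : m1 (open_box u v) = (\prod_i (`|c i|^-1 * Num.max (v i - u i) 0))%:E.
  rewrite /m1/= /pushforward.
  (* The i-th constraint bears on the coordinate [s i], so the coordinate [j] is constrained through
     the index [s^-1 j]. *)
  pose B j : set (measurableTypeR R) := (fun t : R =>
     c ((s^-1)%g j) * t + b ((s^-1)%g j)) @^-1` `]u ((s^-1)%g j), v ((s^-1)%g j)[%classic.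
  have -> : affine_rV c s b @^-1` open_box u v = [set x | forall j, B j (x ord0 j)].
    apply/seteqP; split => x /= + i.
      by move=> /(_ ((s^-1)%g i)); rewrite /B/= mxE permKV.
    by move=> /(_ (s i)); rewrite /B/= mxE permK.
  rewrite lebesgue_rV_box; last first.
    move=> j; rewrite -[X in measurable X]setTI /B.
    apply: (_ : measurable_fun _ _) => //.
    by apply: measurable_funD => //; apply: measurable_funM.
  have BE j : lebesgue_measure (B j) = (`|c ((s^-1)%g j)|^-1 *
      Num.max (v ((s^-1)%g j) - u ((s^-1)%g j)) 0)%:E.
    exact: lebesgue_measure_affine_itvoo.
  rewrite (eq_bigr _ (fun j _ => BE j)).
  by rewrite prodEFin (reindex_inj (@perm_inj _ s))/=; under eq_bigr do rewrite permK.
suff : m1 A = m2 A by [].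
apply: measure_rV_unique => // u v.
- rewrite H /m2/= /mscale/=.
  by rewrite big_split/= EFinM lebesgue_open_box.
- by rewrite H ltry.
Qed.

Lemma ge0_integral_affine_rV c s b (f : 'rV[R]_n -> \bar R) :
  (forall i, c i != 0) -> measurable_fun [set: 'rV[R]_n] f ->
  (forall x, (0 <= f x)%E) ->
  (\int[lebesgue_rV n]_x f (affine_rV c s b x) =
   (\prod_i `|c i|^-1)%:E * \int[lebesgue_rV n]_x f x)%E.
Proof.
move=> c0 mf f0.
have k0 : 0 <= \prod_i `|c i|^-1 by apply: prodr_ge0 => i _; rewrite invr_ge0.
have mT := measurable_affine_rV c s b.
have /= <- := @ge0_integral_mscale _ _ _ (lebesgue_rV n) setT measurableT (NngNum k0) f mf
  (fun x _ => f0 x).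
rewrite -(@ge0_integral_pushforward _ _ _ _ _ _ mT (lebesgue_rV n) setT f)//.
apply: eq_measure_integral => A mA _.
by rewrite /= /pushforward lebesgue_rV_affine.
Qed.

Lemma integral_affine_rV c s b (f : 'rV[R]_n -> R) :
  (forall i, `|c i| = 1) ->
  (lebesgue_rV n).-integrable setT (EFin \o f) ->
  \int[lebesgue_rV n]_x f (affine_rV c s b x) = \int[lebesgue_rV n]_x f x.
Proof.
move=> c1 intf.
have c0 i : c i != 0 by rewrite -normr_gt0 c1.
have pE : \prod_i `|c i|^-1 = 1 by rewrite big1// => i _; rewrite c1 invr1.
have mf : measurable_fun setT (EFin \o f) by exact: measurable_int intf.
rewrite /Rintegral; congr fine; rewrite integralE [RHS]integralE.
have mp : measurable_fun [set: 'rV[R]_n] (fun x => (EFin \o f)^\+ x)%E.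
  exact: measurable_funepos.
have mn : measurable_fun [set: 'rV[R]_n] (fun x => (EFin \o f)^\- x)%E.
  exact: measurable_funeneg.
have := ge0_integral_affine_rV s b c0 mp (fun x => funepos_ge0 _ x).
have := ge0_integral_affine_rV s b c0 mn (fun x => funeneg_ge0 _ x).
rewrite pE !mul1e => <- <-.
have -> : (fun x => (f (affine_rV c s b x))%:E) = (EFin \o f) \o affine_rV c s b by [].
by rewrite funepos_comp funeneg_comp.
Qed.

End lebesgue_rV_affine.

(** * Open sets, compact sets and boxes *)

Section open_sets_rV.
Context {R : realType} {n : nat}.

Definition closed_box (a b : 'I_n -> R) : set 'rV[R]_n :=
  [set x | forall i, x ord0 i \in `[a i, b i]].

(** The rational boxes whose closed box still lies in [A] already cover [A]. Asking for the closed
    box ensures that a cut-off function of such a box has compact support in [A]. *)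
Lemma open_bigcup_box (A : set 'rV[R]_n) : open A ->
  exists (a b : nat -> 'I_n -> R) (P : set nat),
    (forall k, P k -> closed_box (a k) (b k) `<=` A) /\
    A = \bigcup_(k in P) open_box (a k) (b k).
Proof.
move=> oA.
pose I := ({ffun 'I_n -> rat} * {ffun 'I_n -> rat})%type.
(* Enumerates the pairs of rational corners. A number that codes no pair falls back to zero corners,
   a box that the index set filters like any other. *)
pose p k : I := odflt (finfun (fun=> 0), finfun (fun=> 0)) (unpickle k).
pose a k i : R := ratr ((p k).1 i); pose b k i : R := ratr ((p k).2 i).
exists a, b, [set k | closed_box (a k) (b k) `<=` A]; split => //.
apply/seteqP; split => [x Ax|x [k /= kA xk]]; last first.
  apply: kA => i; move: (xk i); rewrite !in_itv/=.
  by move=> /andP[/ltW -> /ltW ->].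
have /nbhs_ballP[e /= e0 xeA] : nbhs x A by exact: open_nbhs_nbhs.
have /choice[u Hu] : forall i : 'I_n, exists q : rat, ratr q \in `](x ord0 i - e), (x ord0 i)[.
  by move=> i; apply: rat_in_itvoo; rewrite ltrBlDr ltrDl.
have /choice[v Hv] : forall i : 'I_n, exists q : rat, ratr q \in `](x ord0 i), (x ord0 i + e)[.
  by move=> i; apply: rat_in_itvoo; rewrite ltrDl.
have pE : p (pickle ((finfun u, finfun v) : I)) = (finfun u, finfun v).
  by rewrite /p pickleK.
exists (pickle ((finfun u, finfun v) : I)) => /=.
  move=> y yab; apply: xeA; split => // i j; rewrite (ord1 i).
  move: (yab j); rewrite /a /b pE/= !ffunE in_itv/= => /andP[h1 h2].
  move: (Hu j) (Hv j); rewrite !in_itv/= => /andP[h3 h4] /andP[h5 h6].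
  by rewrite /ball/= ltr_norml; apply/andP; split; lra.
move=> i; rewrite /a /b pE/= !ffunE in_itv/=.
by move: (Hu i) (Hv i); rewrite !in_itv/= => /andP[_ ->] /andP[->].
Qed.

Lemma open_measurable_rV (A : set 'rV[R]_n) : open A -> measurable A.
Proof.
move=> /open_bigcup_box[a [b [P [_ ->]]]].
by apply: bigcup_measurable => k _; exact: measurable_open_box.
Qed.

Lemma continuous_measurable_rV (f : 'rV[R]_n -> R) : continuous f ->
  measurable_fun [set: 'rV[R]_n] f.
Proof.
move=> cf; apply: (measurability _ (RGenOpens.measurableE R)) => /=.
move=> _ [_ [u [v ->]] <-]; rewrite setTI.
apply: open_measurable_rV; apply: open_comp => // x _; exact: cf.
Qed.

Lemma closed_closed_box (a b : 'I_n -> R) : closed (closed_box a b).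
Proof.
rewrite [X in closed X](_ : _ = \bigcap_(i in [set: 'I_n])
   ((fun x : 'rV[R]_n => x ord0 i) @^-1` `[a i, b i]%classic)).
  apply: closed_bigI => i _; apply: closed_comp => [x _|].
    exact: coord_continuous.
  exact: itv_closed.
by apply/seteqP; split=> x /= xA i; [move=> _|]; exact: xA.
Qed.

Lemma compact_closed_box (a b : 'I_n -> R) : compact (closed_box a b).
Proof.
have := @rV_compact R n (fun i => `[a i, b i]%classic) (fun i =>
  @segment_compact R (a i) (b i)).
by [].
Qed.

Lemma compact_sub_open_box (K : set 'rV[R]_n) : compact K ->
  exists M : R, K `<=` @open_box R n (fun=> - M) (fun=> M).
Proof.
move=> /compact_bounded[M [_ HM]].
exists (`|M| + 2) => x Kx i.
have : `|x| <= `|M| + 1 by apply: HM => //; rewrite (le_lt_trans (ler_norm _))// ltrDl.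
rewrite in_itv/= -ltr_norml => h.
have : ball (0 : 'rV[R]_n) (`|M| + 2) x.
  by rewrite mx_norm_ball /ball_/= sub0r normrN (le_lt_trans h)// ltrD2l ltr1n.
by move=> [_ /(_ ord0 i)]; rewrite /ball/= mxE sub0r normrN.
Qed.

End open_sets_rV.

(** * The space L^2(Omega) and its scalar product *)

Section L2_space.
Context {R : realType} {d : nat}.
Variable Omega : set 'rV[R]_d.
Hypothesis mOmega : measurable Omega.
Implicit Types u v w c : 'rV[R]_d -> R.
Local Notation mu := (lebesgue_rV d).
Local Notation L2 := (in_Lp 2%:E Omega).
Local Notation dot := (dotL2 Omega).

Lemma restrict0E u x : (u \_ Omega) x = if x \in Omega then u x else 0.
Proof. by rewrite patchE. Qed.

Lemma normLp_ge0 p u : 0 <= normLp p Omega u.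
Proof. by rewrite /normLp fine_ge0// Lnorm_ge0. Qed.

Lemma sqr_normL2 u : normLp 2%:E Omega u ^+ 2 = dot u u.
Proof.
rewrite /normLp /dotL2 /Rintegral unlock/= fine_poweR powR12_sqrt; last first.
  by rewrite fine_ge0// integral_ge0.
rewrite sqr_sqrtr ?fine_ge0 ?integral_ge0//; congr fine.
rewrite [RHS]integral_mkcond; apply: eq_integral => x _.
rewrite /= powR_mulrn// -normrX ger0_norm ?sqr_ge0// restrict0E patchE.
by case: ifP => // _; rewrite expr0n.
Qed.

Lemma in_L2P u : L2 u <->
  measurable_fun Omega u /\ mu.-integrable Omega (EFin \o (fun x => u x ^+ 2)).
Proof.
have E : EFin \o (fun x => (u \_ Omega) x ^+ 2) =
    (EFin \o (fun x => u x ^+ 2)) \_ Omega.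
  apply/funext => x; rewrite /= restrict0E patchE.
  by case: ifP => // _; rewrite expr0n.
split=> [Lu|[mf If]].
  split; last first.
    by apply/integrable_mkcond => //; rewrite -E; exact: Lfun2_integrable_sqr.
  by apply/measurable_restrictT => //; move: Lu; rewrite /in_Lp inE => /andP[/set_mem].
rewrite /in_Lp inE; apply/andP; split; apply/mem_set => /=.
  exact: (measurable_restrictT u mOmega).1.
move/(integrable_mkcond _ mOmega) : If; rewrite -E => /integrableP[_].
rewrite /finite_norm unlock/= => If.
apply: poweR_lty; apply: le_lt_trans If.
rewrite le_eqVlt; apply/orP; left; apply/eqP; apply: eq_integral => x _/=.
by rewrite powR_mulrn// -normrX.
Qed.

Lemma in_L2_integrable u v : L2 u -> L2 v ->
  mu.-integrable Omega (EFin \o (fun x => u x * v x)).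
Proof.
move=> Lu Lv; apply/integrable_mkcond => //.
have := Lfun2_mul_Lfun1 Lu Lv; rewrite Lfun1_integrable.
congr (integrable _ _ _); apply/funext => x /=.
rewrite !restrict0E patchE; case: ifP => // _; by rewrite mulr0.
Qed.

Lemma in_L2D u v : L2 u -> L2 v -> L2 (fun x => u x + v x).
Proof.
move=> Lu Lv; have := rpredD Lu Lv.
move=> /(_ ltac:(by rewrite lee_fin ler1n)).
rewrite /in_Lp; suff -> : (fun x => u x + v x) \_ Omega = (u \_ Omega) + (v \_ Omega) by [].
apply/funext => x /=.
by rewrite [RHS]/GRing.add/= !restrict0E; case: ifP => // _; rewrite addr0.
Qed.

Lemma in_L2Z (a : R) u : L2 u -> L2 (fun x => a * u x).
Proof.
move=> /in_L2P[mf If]; apply/in_L2P; split.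
  by apply: measurable_funM => //; exact: measurable_cst.
have -> : EFin \o (fun x => (a * u x) ^+ 2) =
    (fun x => (a ^+ 2)%:E * ((u x) ^+ 2)%:E)%E.
  by apply/funext => x/=; rewrite exprMn EFinM.
exact: integrableZl.
Qed.

Lemma in_L2N u : L2 u -> L2 (fun x => - u x).
Proof. by move=> /(in_L2Z (-1)); under eq_fun do rewrite mulN1r. Qed.

Lemma in_L2B u v : L2 u -> L2 v -> L2 (fun x => u x - v x).
Proof. by move=> Lu /in_L2N; exact: in_L2D. Qed.

Lemma in_L2_0 : L2 (fun=> 0).
Proof.
apply/in_L2P; split; first exact: measurable_cst.
by rewrite expr0n; exact: integrable0.
Qed.

Lemma in_L2_sum (I : Type) (s : seq I) (f : I -> 'rV[R]_d -> R) :
  (forall i, L2 (f i)) -> L2 (fun x => \sum_(i <- s) f i x).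
Proof.
move=> Lf; elim: s => [|i s IH].
  by under eq_fun do rewrite big_nil; exact: in_L2_0.
by under eq_fun do rewrite big_cons; exact: in_L2D.
Qed.

Lemma in_L2_mulb c u (M : R) : measurable_fun Omega c ->
  (forall x, `|c x| <= M) -> L2 u -> L2 (fun x => c x * u x).
Proof.
move=> mc cM /in_L2P[mf If]; apply/in_L2P; split; first exact: measurable_funM.
apply: (@le_integrable _ _ _ mu _ mOmega _
    (fun x => (M ^+ 2)%:E * ((u x) ^+ 2)%:E)%E _ _).
- by apply/measurable_EFinP; apply: measurable_funX; exact: measurable_funM.
- move=> x _.
  have h : `|(c x * u x) ^+ 2| <= `|M ^+ 2 * u x ^+ 2|.
    rewrite exprMn normrM [leRHS]normrM ler_wpM2r// !normrX ler_sqr ?nnegrE//.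
    exact: le_trans (cM x) (ler_norm M).
  by rewrite /= lee_fin.
- exact: integrableZl.
Qed.

Lemma dotL2C u v : dot u v = dot v u.
Proof. by apply: eq_Rintegral => x _; rewrite mulrC. Qed.

Lemma dotL2Dl u v w : L2 u -> L2 v -> L2 w ->
  dot (fun x => u x + v x) w = dot u w + dot v w.
Proof.
move=> Lu Lv Lw; rewrite /dotL2 -RintegralD//; [|exact: in_L2_integrable..].
by apply: eq_Rintegral => x _; rewrite mulrDl.
Qed.

Lemma dotL2Dr u v w : L2 u -> L2 v -> L2 w ->
  dot w (fun x => u x + v x) = dot w u + dot w v.
Proof. by move=> *; rewrite dotL2C dotL2Dl// dotL2C; congr (_ + _); exact: dotL2C. Qed.

Lemma dotL2Zl (a : R) u v : L2 u -> L2 v -> dot (fun x => a * u x) v = a * dot u v.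
Proof.
move=> Lu Lv; rewrite /dotL2 -RintegralZl//; last exact: in_L2_integrable.
by apply: eq_Rintegral => x _; rewrite mulrA.
Qed.

Lemma dotL2Zr (a : R) u v : L2 u -> L2 v -> dot u (fun x => a * v x) = a * dot u v.
Proof. by move=> *; rewrite dotL2C dotL2Zl// dotL2C. Qed.

Lemma dotL2Bl u v w : L2 u -> L2 v -> L2 w ->
  dot (fun x => u x - v x) w = dot u w - dot v w.
Proof.
move=> Lu Lv Lw; rewrite /dotL2 -RintegralB//; [|exact: in_L2_integrable..].
by apply: eq_Rintegral => x _; rewrite mulrBl.
Qed.

Lemma dotL2Br u v w : L2 u -> L2 v -> L2 w ->
  dot w (fun x => u x - v x) = dot w u - dot w v.
Proof. by move=> *; rewrite dotL2C dotL2Bl// dotL2C; congr (_ - _); exact: dotL2C. Qed.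

Lemma dotL20l u : dot (fun=> 0) u = 0.
Proof.
rewrite /dotL2; under eq_Rintegral do rewrite mul0r.
by rewrite Rintegral_cst ?mul0r.
Qed.

Lemma dotL2_suml (I : Type) (s : seq I) (f : I -> 'rV[R]_d -> R) v :
  (forall i, L2 (f i)) -> L2 v ->
  dot (fun x => \sum_(i <- s) f i x) v = \sum_(i <- s) dot (f i) v.
Proof.
move=> Lf Lv; elim: s => [|i s IH].
  by rewrite big_nil; under eq_fun do rewrite big_nil; exact: dotL20l.
rewrite big_cons -IH -dotL2Dl//; last exact: in_L2_sum.
by congr dotL2; apply/funext => x; rewrite big_cons.
Qed.

Lemma dotL2_sumr (I : Type) (s : seq I) (f : I -> 'rV[R]_d -> R) v :
  (forall i, L2 (f i)) -> L2 v ->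
  dot v (fun x => \sum_(i <- s) f i x) = \sum_(i <- s) dot v (f i).
Proof. by move=> *; rewrite dotL2C dotL2_suml//; under eq_bigr do rewrite dotL2C. Qed.

Lemma dotL2_ge0 u : 0 <= dot u u.
Proof. by apply: Rintegral_ge0 => x _; rewrite -expr2 sqr_ge0. Qed.

Lemma dotL2_cauchy_schwarz u v : L2 u -> L2 v ->
  dot u v ^+ 2 <= dot u u * dot v v.
Proof.
move=> Lu Lv.
have H (t s : R) : 0 <= t ^+ 2 * dot u u - 2 * t * s * dot u v + s ^+ 2 * dot v v.
  have := dotL2_ge0 (fun x => t * u x - s * v x).
  rewrite dotL2Bl ?dotL2Br ?dotL2Zl ?dotL2Zr//; try exact: in_L2Z;
    try by apply: in_L2B; exact: in_L2Z.
  by rewrite (dotL2C v u); congr (_ <= _); ring.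
have := dotL2_ge0 u; rewrite le_eqVlt => /predU1P[u0|u0].
  rewrite -u0 mul0r; have [->|s0] := eqVneq (dot u v) 0; first by rewrite expr0n.
  (* When |u| = 0 the form is affine in t; this value makes it equal to - |v|^2 - 2. *)
  have := H ((dot v v + 1) / dot u v) 1.
  rewrite -u0 mulr0 mulr1 -!mulrA mulVf// => h.
  have v0 := dotL2_ge0 v; exfalso; move: h; rewrite leNgt => /negP; apply; lra.
(* The minimizing ratio t / s = <u, v> / |u|^2, with the denominator cleared: the form becomes |u|^2
   (|u|^2 |v|^2 - <u, v>^2). *)
have := H (dot u v) (dot u u) => h.
have : 0 <= dot u u * (dot u u * dot v v - dot u v ^+ 2).
  by apply: (le_trans h); rewrite le_eqVlt; apply/orP; left; apply/eqP; ring.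
by rewrite pmulr_rge0// subr_ge0.
Qed.

Lemma dotL2_ae u u' v v' : L2 u -> L2 u' -> L2 v -> L2 v' ->
  ae_eq mu Omega u u' -> ae_eq mu Omega v v' -> dot u v = dot u' v'.
Proof.
move=> Lu Lu' Lv Lv' uu vv; rewrite /dotL2 /Rintegral; congr fine.
have m a b : L2 a -> L2 b -> measurable_fun Omega (fun x => (a x * b x)%:E).
  by move=> La Lb; apply: measurable_int (in_L2_integrable La Lb).
apply: ae_eq_integral => //; [exact: m|exact: m|].
by apply: filterS2 uu vv => x h1 h2 Ox; rewrite h1// h2.
Qed.

Lemma dotL2_eq0_ae u : L2 u -> dot u u = 0 -> ae_zero Omega u.
Proof.
move=> Lu; rewrite -sqr_normL2 => /eqP; rewrite sqrf_eq0 => /eqP u0.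
move: (Lu); rewrite /in_Lp inE => /andP[/set_mem/= mf /set_mem/= fin].
have /Lnorm_eq0_eq0 : ('N[mu]_2%:E[EFin \o u \_ Omega] = 0)%E.
  rewrite -[LHS]fineK ?[fine _]u0// ge0_fin_numE ?Lnorm_ge0//.
have /measurable_EFinP mfE := mf.
move=> /(_ mfE) /(_ ltac:(by rewrite lte_fin)).
apply: filterS => x /(_ I) /= [] + Ox.
by rewrite patchE mem_set.
Qed.

End L2_space.

(** * Smooth and test functions *)

Section smooth_functions.
Context {R : realType} {d : nat}.
Implicit Types (u v psi : 'rV[R]_d -> R) (Omega : set 'rV[R]_d) (i : 'I_d).
Local Notation e_ i := (delta_mx 0 i : 'rV[R]_d).

(** Iterated partial derivatives of products and composites have no convenient closed form;
    smoothness is obtained instead by exhibiting a class of continuous functions stable under every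
    [partial i]. *)
Lemma smooth_coind (F : set ('rV[R]_d -> R)) :
  (forall u, F u -> continuous u /\
     forall i, (forall x, derivable u x (e_ i)) /\ F (partial i u)) ->
  forall u, F u -> smooth u.
Proof.
move=> HF u Fu s.
have Fs : F (partials s u).
  elim: s => [//|i s IH] /=.
  by have [_ /(_ i)[]] := HF _ IH.
have [cu Hu] := HF _ Fs; split => // i x; exact: (Hu i).1.
Qed.

Lemma smooth_continuous u : smooth u -> continuous u.
Proof. by move=> /(_ [::])[]. Qed.

Lemma smooth_derivable u i x : smooth u -> derivable u x (e_ i).
Proof. by move=> /(_ [::])[_]. Qed.

Lemma smooth_partial i u : smooth u -> smooth (partial i u).
Proof.
(* [partials] applies the last direction of the list first, so an inner derivative is appended on
   the right. *)
move=> su s; have := su (s ++ [:: i]).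
by rewrite /partials foldr_cat.
Qed.

(** The algebra generated by the smooth functions. By the Leibniz rule it is stable under [partial],
    as [smooth_coind] requires. *)
Inductive smooth_alg : ('rV[R]_d -> R) -> Prop :=
| smooth_alg_smooth u of smooth u : smooth_alg u
| smooth_algD u v of smooth_alg u & smooth_alg v : smooth_alg (u \+ v)
| smooth_algM u v of smooth_alg u & smooth_alg v : smooth_alg (u \* v).

Lemma smooth_alg_is_smooth u : smooth_alg u -> smooth u.
Proof.
move: u; apply: smooth_coind => u; elim.
- move=> {}u su; split; first exact: smooth_continuous.
  move=> i; split; first by move=> x; exact: smooth_derivable.
  by constructor; exact: smooth_partial.
- move=> {}u v Au [cu du] Av [cv dv]; split.
    by move=> x; exact: (cvgD (cu x) (cv x)).
  move=> i; split; first by move=> x; apply: derivableD; [exact: (du i).1|exact: (dv i).1].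
  have -> : partial i (u \+ v) = partial i u \+ partial i v.
    by apply/funext => x; rewrite /partial deriveD//; [exact: (du i).1|exact: (dv i).1].
  by constructor; [exact: (du i).2|exact: (dv i).2].
- move=> {}u v Au [cu du] Av [cv dv]; split.
    by move=> x; exact: (cvgM (cu x) (cv x)).
  move=> i; split; first by move=> x; apply: derivableM; [exact: (du i).1|exact: (dv i).1].
  have -> : partial i (u \* v) = (u \* partial i v) \+ (v \* partial i u).
    by apply/funext => x; rewrite /partial deriveM//; [exact: (du i).1|exact: (dv i).1].
  apply: smooth_algD; apply: smooth_algM => //; [exact: (dv i).2|exact: (du i).2].
Qed.

Lemma smoothM u v : smooth u -> smooth v -> smooth (fun x => u x * v x).
Proof. by move=> su sv; apply: smooth_alg_is_smooth; apply: smooth_algM; constructor. Qed.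

Lemma partialD i u v : smooth u -> smooth v ->
  partial i (fun x => u x + v x) = (fun x => partial i u x + partial i v x).
Proof.
by move=> su sv; apply/funext => x; rewrite /partial -deriveD//; exact: smooth_derivable.
Qed.

Lemma partialM i u v : smooth u -> smooth v ->
  partial i (fun x => u x * v x) = (fun x => u x * partial i v x + partial i u x * v x).
Proof.
move=> su sv; apply/funext => x; rewrite /partial [X in _ + X]mulrC.
by rewrite -deriveM//; exact: smooth_derivable.
Qed.

Lemma smooth_cst (a : R) : smooth ((fun=> a) : 'rV[R]_d -> R).
Proof.
apply: (@smooth_coind [set u | exists a : R, u = fun=> a]); last by exists a.
move=> _ [b ->]; split; first by move=> x; exact: cst_continuous.
move=> i; split; first by move=> x; exact: derivable_cst.
by exists 0; apply/funext => x; rewrite /partial derive_cst.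
Qed.

Lemma smooth_prod (I : Type) (s : seq I) (f : I -> 'rV[R]_d -> R) :
  (forall k, smooth (f k)) -> smooth (fun x => \prod_(i <- s) f i x).
Proof.
move=> sf; elim: s => [|i s IH].
  by under eq_fun do rewrite big_nil; exact: smooth_cst.
by under eq_fun do rewrite big_cons; exact: smoothM.
Qed.

(** The two difference quotients are the same function of h. This gives access to the chain rule and
    the mean value theorem of one variable. *)
Lemma is_derive_line u (x v : 'rV[R]_d) (t l : R) :
  is_derive t (1 : R) (fun h : R => u (h *: v + x)) l <->
  is_derive (t *: v + x) v u l.
Proof.
set phi := fun h : R => u (h *: v + x).
have E : (fun h => h^-1 *: ((phi \o shift t) (h *: (1 : R)) - phi t)) =
    (fun h : R => h^-1 *: ((u \o shift (t *: v + x)) (h *: v) - u (t *: v + x))).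
  by apply/funext => h; rewrite /phi/= addrA scalerDl [h *: 1]mulr1.
split=> -[h1 h2]; constructor; move: h1 h2; rewrite /derivable /derive E//.
Qed.

Section ridge.
Variables (g : nat -> R -> R) (l : 'rV[R]_d -> R) (xi : 'I_d -> R).
Hypothesis dg : forall n t, is_derive t (1 : R) (g n) (g n.+1 t).
Hypothesis cl : continuous l.
Hypothesis dl : forall i x (h : R), l (h *: e_ i + x) = h * xi i + l x.

(** Chain rule along a line: [g] lists the successive derivatives of [g 0], and [l] is affine with
    slopes [xi]. The factors of the cut-off functions and the plane waves are both of this form. *)
Lemma is_derive_ridge n i x :
  is_derive x (e_ i) (g n \o l) (xi i * g n.+1 (l x)).
Proof.
have := (is_derive_line (g n \o l) x (e_ i) 0 (xi i * g n.+1 (l x))).1.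
rewrite scale0r add0r; apply.
have -> : (fun h : R => (g n \o l) (h *: e_ i + x)) =
    g n \o (fun h : R => h * xi i + l x) by apply/funext => h /=; rewrite dl.
rewrite mulrC; apply: is_derive1_comp; first by rewrite mul0r add0r.
have -> : (fun h : R => h * xi i + l x) = (xi i \*: id) + cst (l x).
  by apply/funext => h; rewrite [RHS]/GRing.add/= [_ *: _]mulrC.
by apply: is_derive_eq; rewrite addr0 [LHS]mulr1.
Qed.

Lemma partial_ridge n i :
  partial i (g n \o l) = (fun x => xi i * g n.+1 (l x)).
Proof.
by apply/funext => x; rewrite /partial; have [_ ->] := is_derive_ridge n i x.
Qed.

Lemma smooth_ridge n : smooth (g n \o l).
Proof.
(* The factor [a] absorbs the slopes [xi i] that differentiation brings out. *)
apply: (@smooth_coind [set u | exists (a : R) n, u = (fun x => a * g n (l x))]); last first.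
  by exists 1, n; apply/funext => x /=; rewrite mul1r.
move=> _ [a [m ->]].
have cg : continuous (g m).
  move=> t; apply: differentiable_continuous; apply/derivable1_diffP.
  by have [] := dg m t.
have ct i x : is_derive x (e_ i) (fun x => a * g m (l x)) (a * (xi i * g m.+1 (l x))).
  by have := is_derive_ridge m i x => H; apply: is_deriveZ.
split.
  move=> x.
  apply: (@continuousM _ _ (fun=> a) (g m \o l)); first exact: cst_continuous.
  by apply: continuous_comp; [exact: cl|exact: cg].
move=> i; split; first by move=> x; have [] := ct i x.
exists (a * xi i), m.+1; apply/funext => x.
by rewrite /partial; have [_ ->] := ct i x; rewrite mulrA.
Qed.

End ridge.
End smooth_functions.

(** * A smooth step function on the line *)

Section smooth_step.
Context {R : realType}.
Local Open Scope ring_scope.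

(* The n-th derivative of [step 0] : t |-> exp(- 1 / t) on t > 0. *)
Fixpoint step_poly (n : nat) : {poly R} :=
  if n is n'.+1 then 'X^2 * (step_poly n' - (step_poly n')^`()) else 1.

Definition step (n : nat) (t : R) : R :=
  if 0 < t then (step_poly n).[t^-1] * expR (- t^-1) else 0.

(** Raise s / k <= 1 + s / k <= exp(s / k) to the power k. *)
Lemma exprn_le_expR (k : nat) (s : R) : 0 <= s -> s ^+ k <= k%:R ^+ k * expR s.
Proof.
move=> s0; case: k => [|k]; first by rewrite !expr0 mul1r (le_trans _ (expR_ge1Dx s))// lerDl.
have -> : expR s = expR (s / k.+1%:R) ^+ k.+1.
  by rewrite -expRM_natl mulrC divfK// pnatr_eq0.
rewrite -exprMn lerXn2r// ?nnegrE ?mulr_ge0 ?expR_ge0//.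
rewrite -ler_pdivrMl ?ltr0n// mulrC (le_trans _ (expR_ge1Dx _))// lerDr//.
Qed.

Lemma horner_expR_bounded (p : {poly R}) :
  exists C, forall s : R, 0 <= s -> `|p.[s] * expR (- s)| <= C.
Proof.
exists (\sum_(i < size p) `|p`_i| * i%:R ^+ i) => s s0.
rewrite horner_coef mulr_suml (le_trans (ler_norm_sum _ _ _))// ler_sum// => i _.
rewrite -mulrA normrM ler_wpM2l// ger0_norm ?mulr_ge0 ?exprn_ge0 ?expR_ge0//.
by rewrite expRN ler_pdivrMr ?expR_gt0// exprn_le_expR.
Qed.

Lemma is_derive_step_gt0 n (t : R) : 0 < t -> is_derive t (1 : R) (step n) (step n.+1 t).
Proof.
move=> t0.
have tneq : t != 0 by rewrite gt_eqF.
apply: (@near_eq_is_derive _ _ _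
   ((horner (step_poly n) \o (fun y : R => y^-1)) * (expR \o (fun y : R => - y^-1)))).
  near=> x; rewrite /step ifT//.
  by near: x; exact: lt_nbhsr.
rewrite /step t0 /=.
have dV : is_derive t (1 : R) (fun y : R => y^-1) (- t ^- 2).
  by have := is_deriveV tneq (is_derive_id t (1 : R)); rewrite [_ *: _]mulr1.
have dH : is_derive (t^-1) (1 : R) (horner (step_poly n)) ((step_poly n)^`().[t^-1]).
  split; first exact: derivable_horner.
  by rewrite -derive1E -[RHS]/((horner (step_poly n)^`()) t^-1) derivE.
have dP := is_derive1_comp dH dV.
have dE := @is_derive1_comp _ expR (fun y : R => - y^-1) t _ _
  (is_derive_expR (- t^-1)) (is_deriveN dV).
apply: (is_derive_eq (is_deriveM dP dE)).
rewrite /= !hornerE /= -!exprVn /GRing.scale/=; ring.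
Unshelve. all: by end_near. Qed.

Lemma is_derive_step_lt0 n (t : R) : t < 0 -> is_derive t (1 : R) (step n) (step n.+1 t).
Proof.
move=> t0.
apply: (@near_eq_is_derive _ _ _ (fun=> 0)); last first.
  by rewrite /step ltNge (ltW t0)/=; exact: is_derive_cst.
near=> x; rewrite /step ltNge ifF//; apply/negbF/ltW.
by near: x; exact: lt_nbhsl.
Unshelve. all: by end_near. Qed.

(** Quadratic decay at 0 makes the difference quotients there vanish in the limit, for every order
    n. It follows from the boundedness of s^2 p(s) exp(- s) at s = 1 / t. *)
Lemma step_le n : exists C, forall t : R, `|step n t| <= C * `|t| ^+ 2.
Proof.
have [C HC] := horner_expR_bounded ('X^2 * step_poly n).
have C0 : 0 <= C by apply: le_trans (HC 0 (lexx _)).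
exists C => t; rewrite /step; case: ifPn => t0; last by rewrite normr0 mulr_ge0// exprn_ge0.
have ti : 0 <= t^-1 by rewrite invr_ge0 ltW.
have := HC _ ti; rewrite hornerM hornerXn -mulrA normrM (ger0_norm (exprn_ge0 _ ti)).
rewrite exprVn mulrC (gtr0_norm t0) => h.
by rewrite -ler_pdivrMr ?exprn_gt0.
Qed.

Lemma is_derive_step0 n : is_derive (0 : R) (1 : R) (step n) (step n.+1 0).
Proof.
have [C HC] := step_le n.
have s0 m : step m 0 = 0 by rewrite /step ltxx.
suff H : h^-1 *: ((step n \o shift (0:R)) (h *: (1:R)) - step n 0) @[h --> (0:R)^'] --> (0:R).
  by constructor; [apply/cvg_ex; exists 0|rewrite s0; apply/cvg_lim].
apply/cvgr0Pnorm_le => e e0.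
near=> h.
have h0 : h != 0 by near: h; exact: nbhs_dnbhs_neq.
rewrite s0 subr0 /= addr0 [h *: 1]mulr1 normrZ normfV.
rewrite ler_pdivrMl ?normr_gt0//.
apply: (le_trans (HC h)).
rewrite expr2 mulrA mulrC ler_pM2l ?normr_gt0//.
have : `|h| <= e / (`|C| + 1).
  near: h; apply: dnbhs0_le; rewrite divr_gt0// ltr_wpDl//.
rewrite ler_pdivlMr ?ltr_wpDl// => he.
apply: le_trans he; rewrite mulrC ler_wpM2l//.
by rewrite (le_trans (ler_norm C))// lerDl.
Unshelve. all: by end_near. Qed.

Lemma is_derive_step n (t : R) : is_derive t (1 : R) (step n) (step n.+1 t).
Proof.
have [t0|t0|->] := ltgtP t 0; first exact: is_derive_step_lt0.
  exact: is_derive_step_gt0.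
exact: is_derive_step0.
Qed.

Lemma step0_ge0 (t : R) : 0 <= step 0 t.
Proof. by rewrite /step; case: ifP => // _; rewrite hornerC mul1r expR_ge0. Qed.

Lemma step0_le1 (t : R) : step 0 t <= 1.
Proof.
rewrite /step; case: ifP => // t0; rewrite hornerC mul1r -[leRHS]expR0 ler_expR.
by rewrite oppr_le0 invr_ge0 ltW.
Qed.

Lemma step0_eq0 (t : R) : t <= 0 -> step 0 t = 0.
Proof. by rewrite /step ltNge => ->. Qed.

Lemma cvg_step0 (t : R) : 0 < t -> step 0 (n%:R * t) @[n --> \oo] --> (1 : R).
Proof.
move=> t0.
have H : expR (- (n%:R * t)^-1) @[n --> \oo] --> (1 : R).
  rewrite -[X in _ --> X](@expR0 R); apply: continuous_cvg; first exact: continuous_expR.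
  rewrite -oppr0; apply: cvgN.
  have -> : (fun n : nat => (n%:R * t)^-1) = (fun n : nat => t^-1 * n%:R^-1).
    by apply/funext => n; rewrite invfM mulrC.
  rewrite -(mulr0 t^-1); apply: cvgMr.
  have := @cvg_harmonic R; rewrite -(cvg_shiftS (fun n : nat => (n%:R : R)^-1)).
  exact.
apply: cvg_trans H; apply: near_eq_cvg; near=> n.
rewrite /step hornerC mul1r ifT// mulr_gt0// ltr0n.
by near: n; exact: nbhs_infty_gt.
Unshelve. all: by end_near. Qed.

End smooth_step.

(** * Integrals of real-valued functions *)

Section integrable_EFin.
Context d (T : measurableType d) (R : realType).
Variables (mu : {measure set T -> \bar R}) (D : set T).
Hypothesis mD : measurable D.
Implicit Types f g : T -> R.

Lemma integrable_EFinD f g : mu.-integrable D (EFin \o f) ->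
  mu.-integrable D (EFin \o g) -> mu.-integrable D (EFin \o (fun x => f x + g x)).
Proof. by move=> If Ig; exact: (integrableD mD If Ig). Qed.

Lemma integrable_EFinB f g : mu.-integrable D (EFin \o f) ->
  mu.-integrable D (EFin \o g) -> mu.-integrable D (EFin \o (fun x => f x - g x)).
Proof. by move=> If Ig; exact: (integrableB mD If Ig). Qed.

Lemma integrable_EFinZl f (k : R) : mu.-integrable D (EFin \o f) ->
  mu.-integrable D (EFin \o (fun x => k * f x)).
Proof. by move=> If; exact: (integrableZl mD k If). Qed.

Lemma integrable_EFin_sum (I : Type) (s : seq I) (F : I -> T -> R) :
  (forall i, mu.-integrable D (EFin \o F i)) ->
  mu.-integrable D (EFin \o (fun x => \sum_(i <- s) F i x)).
Proof.
move=> IF; elim: s => [|i s IH].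
  by under eq_fun do rewrite big_nil; exact: integrable0.
under eq_fun do rewrite big_cons; exact: integrable_EFinD.
Qed.

Lemma Rintegral_sum (I : Type) (s : seq I) (F : I -> T -> R) :
  (forall i, mu.-integrable D (EFin \o F i)) ->
  \int[mu]_(x in D) (\sum_(i <- s) F i x) = \sum_(i <- s) \int[mu]_(x in D) F i x.
Proof.
move=> IF; elim: s => [|i s IH].
  by under eq_Rintegral do rewrite big_nil; rewrite Rintegral_cst// mul0r big_nil.
under eq_Rintegral do rewrite big_cons.
by rewrite RintegralD//; [rewrite big_cons IH|exact: integrable_EFin_sum].
Qed.

Lemma Rintegral_dominated_cvg (f_ : nat -> T -> R) (f g : T -> R) :
  (forall n, measurable_fun D (f_ n)) -> measurable_fun D f ->
  mu.-integrable D (EFin \o g) ->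
  (forall x, D x -> f_ n x @[n --> \oo] --> f x) ->
  (forall n x, D x -> `|f_ n x| <= g x) ->
  \int[mu]_(x in D) f_ n x @[n --> \oo] --> \int[mu]_(x in D) f x.
Proof.
move=> mf_ mf Ig cf fg.
have c1 : {ae mu, forall x, D x -> (EFin \o f_ n) x @[n --> \oo] --> (EFin \o f) x}.
  by apply: aeW => x Dx; apply: cvg_EFin; [exact: nearW|exact: cf].
have c2 : {ae mu, forall x n, D x -> (`|(EFin \o f_ n) x| <= (g x)%:E)%E}.
  by apply: aeW => x n Dx; rewrite /= lee_fin fg.
have mf_E n : measurable_fun D (EFin \o f_ n) by exact/measurable_EFinP.
have mfE : measurable_fun D (EFin \o f) by exact/measurable_EFinP.
have [If _ Hc] := dominated_convergence mD mf_E mfE c1 Ig c2.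
have If_ n : mu.-integrable D (EFin \o f_ n).
  apply: (le_integrable mD (mf_E n) _ Ig) => x Dx; rewrite /= lee_fin.
  exact: le_trans (fg n x Dx) (ler_norm _).
have := @fine_cvg _ _ _ _ (fun n => \int[mu]_(x in D) (f_ n x)%:E)%E
  (fine (\int[mu]_(x in D) (f x)%:E)).
apply; rewrite fineK//; exact: integrable_fin_num.
Qed.

End integrable_EFin.

(** * Test functions and integration by parts *)

Section test_functions.
Context {R : realType} {d : nat}.
Variable Omega : set 'rV[R]_d.
Implicit Types (u v c psi : 'rV[R]_d -> R) (i : 'I_d).
Local Notation mu := (lebesgue_rV d).
Local Notation test := (test_function Omega).
Local Notation supp u := (closure [set x | u x != 0]).

Lemma test_smooth psi : test psi -> smooth psi. Proof. by case. Qed.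

Lemma test_out psi x : test psi -> ~ Omega x -> psi x = 0.
Proof.
move=> [_ _ sO] nO; apply/eqP/negPn/negP => h; apply: nO; apply: sO.
exact: subset_closure.
Qed.

Lemma test_sub psi u : test psi -> smooth u ->
  (forall x, u x != 0 -> supp psi x) -> test u.
Proof.
move=> [sp cp pO] su sub.
have cs : supp u `<=` supp psi.
  have -> : supp psi = closure (supp psi) by rewrite -closure_id//; exact: closed_closure.
  exact: closure_subset.
split => //; last exact: subset_trans cs _.
exact: subclosed_compact (@closed_closure _ _) cp cs.
Qed.

Lemma testM c psi : smooth c -> test psi -> test (fun x => c x * psi x).
Proof.
move=> sc tp; apply: (test_sub tp); first by apply: smoothM => //; exact: test_smooth tp.
by move=> x; rewrite mulf_eq0 negb_or => /andP[_ h]; exact: subset_closure.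
Qed.

Lemma test_partial i psi : test psi -> test (partial i psi).
Proof.
move=> tp; apply: (test_sub tp); first by apply: smooth_partial; exact: test_smooth tp.
move=> x; apply: contra_neqP => nx.
(* Off the closed support, psi is zero in a whole neighbourhood of x, so its difference quotients
   vanish. *)
have op : open (~` supp psi) by apply: closed_openC; exact: closed_closure.
rewrite /partial (@near_eq_derive _ _ _ _ (fun=> 0)) ?derive_cst//.
near=> y.
have : (~` supp psi) y by near: y; exact: open_nbhs_nbhs.
by move=> ny; apply/eqP/negPn/negP => h; apply: ny; exact: subset_closure.
Unshelve. all: by end_near. Qed.

Lemma test_partials s psi : test psi -> test (partials s psi).
Proof. by move=> tp; elim: s => // i s; exact: test_partial. Qed.

Lemma test_box psi : test psi ->
  exists M : R, forall x, psi x != 0 -> @open_box R d (fun=> - M) (fun=> M) x.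
Proof.
move=> [_ /compact_sub_open_box[M HM] _]; exists M => x h; apply: HM.
exact: subset_closure.
Qed.

Lemma test_bounded psi : test psi -> exists M, forall x, `|psi x| <= M.
Proof.
move=> [sp cp _].
have cc : compact (psi @` supp psi).
  apply: continuous_compact => //; apply: continuous_subspaceT.
  exact: smooth_continuous.
have [M [_ HM]] := compact_bounded cc.
exists (`|M| + 1) => x; have [->|h] := eqVneq (psi x) 0.
  by rewrite normr0 addr_ge0.
apply: (HM (`|M| + 1)); first by rewrite (le_lt_trans (ler_norm M))// ltrDl.
by exists x => //; exact: subset_closure.
Qed.

Lemma measurable_test psi : test psi -> measurable_fun [set: 'rV[R]_d] psi.
Proof. by move=> [sp _ _]; apply: continuous_measurable_rV; exact: smooth_continuous. Qed.

Lemma integrable_indic_box (M K : R) :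
  mu.-integrable setT (fun x => (M * \1_(@open_box R d (fun=> - K) (fun=> K)) x)%:E).
Proof.
have mB : measurable (@open_box R d (fun=> - K) (fun=> K)) by exact: measurable_open_box.
have mI : measurable_fun [set: 'rV[R]_d]
    (EFin \o (\1_(@open_box R d (fun=> - K) (fun=> K)) : 'rV[R]_d -> R)).
  by apply/measurable_EFinP; exact: measurable_indic.
under eq_fun do rewrite EFinM.
apply: integrableZl => //; apply/integrableP; split => //.
under eq_integral do rewrite /= ger0_norm//.
rewrite integral_indic// setIT.
by have /= -> := lebesgue_open_box (fun=> - K) (fun=> K : R); rewrite ltry.
Qed.

Lemma integrable_bounded_box (f : 'rV[R]_d -> R) (M K : R) :
  measurable_fun [set: 'rV[R]_d] f -> (forall x, `|f x| <= M) ->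
  (forall x, f x != 0 -> @open_box R d (fun=> - K) (fun=> K) x) ->
  mu.-integrable setT (EFin \o f).
Proof.
move=> mf fM fK.
apply: (@le_integrable _ _ _ mu _ measurableT _ _ _ _ (integrable_indic_box M K)).
- exact/measurable_EFinP.
- move=> x _ /=; rewrite lee_fin.
  have [->|fx0] := eqVneq (f x) 0; first by rewrite normr0.
  by rewrite indicE mem_set ?mulr1//; [exact: le_trans (fM x) (ler_norm _)|exact: fK].
Qed.

Lemma integrable_test psi : test psi -> mu.-integrable setT (EFin \o psi).
Proof.
move=> tp; have [M HM] := test_bounded tp; have [K HK] := test_box tp.
exact: (integrable_bounded_box (measurable_test tp) HM HK).
Qed.

Lemma test_in_L2 psi : measurable Omega -> test psi -> in_Lp 2%:E Omega psi.
Proof.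
move=> mO tp; apply/in_L2P => //; split.
  exact: measurable_funS (measurable_test tp).
have tp2 := testM (test_smooth tp) tp.
have -> : EFin \o (fun x => psi x ^+ 2) = EFin \o (fun x => psi x * psi x) by [].
exact: integrableS (integrable_test tp2).
Qed.

Lemma MVT_partial u i (x : 'rV[R]_d) (h M : R) : smooth u -> 0 < h ->
  (forall y, `|partial i u y| <= M) ->
  `|u (h *: delta_mx 0 i + x) - u x| <= h * M.
Proof.
move=> su h0 HM.
have D t : is_derive t (1 : R) (fun k : R => u (k *: delta_mx 0 i + x))
    (partial i u (t *: delta_mx 0 i + x)).
  apply/is_derive_line; split => //; exact: smooth_derivable.
have C : {within `[0, h], continuous (fun k : R => u (k *: delta_mx 0 i + x))}.
  apply: derivable_within_continuous => t _; by case: (D t).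
have [t _] := MVT h0 (fun t _ => D t) C.
rewrite scale0r add0r subr0 => ->.
by rewrite normrM mulrC (gtr0_norm h0) ler_pM2l.
Qed.

Lemma translate_deltaE i (h : R) (x : 'rV[R]_d) :
  h *: delta_mx 0 i + x = affine_rV (fun=> 1) 1%g (fun j => h * (j == i)%:R) x.
Proof. by apply/rowP => j; rewrite !mxE eqxx/= perm1 mul1r addrC. Qed.

(** By translation invariance the difference quotients have integral 0. The mean value theorem
    bounds them uniformly and they live in a common box, so dominated convergence passes to the
    derivative. *)
Lemma Rintegral_partial_test i psi : test psi ->
  \int[mu]_x partial i psi x = 0.
Proof.
move=> tp.
have td := test_partial i tp.
have [M HM] := test_bounded td; have [K HK] := test_box tp.
pose e_ : 'rV[R]_d := delta_mx 0 i.
pose h n : R := n.+1%:R^-1.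
have h0 n : 0 < h n by rewrite invr_gt0 ltr0n.
pose q n x : R := (h n)^-1 * (psi (h n *: e_ + x) - psi x).
have mpsi := measurable_test tp.
have mpsih n : measurable_fun [set: 'rV[R]_d] (fun x => psi (h n *: e_ + x)).
  apply: (measurableT_comp mpsi).
  have -> : +%R (h n *: e_) = affine_rV (fun=> 1) 1%g (fun j => h n * (j == i)%:R).
    by apply/funext => x; exact: translate_deltaE.
  exact: measurable_affine_rV.
have mq n : measurable_fun [set: 'rV[R]_d] (q n).
  by apply: measurable_funM => //; apply: measurable_funB.
have qM n x : `|q n x| <= M.
  rewrite normrM gtr0_norm ?invr_gt0// ler_pdivrMl//.
  by apply: MVT_partial => //; exact: test_smooth tp.
(* The step h n is at most 1, so translation by it moves the support out of the box of half-side K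
   by at most 1. *)
have qK n x : q n x != 0 -> @open_box R d (fun=> - (K + 1)) (fun=> K + 1) x.
  move=> qn0.
  have [px|px] := eqVneq (psi x) 0; last first.
    by move=> j; have := HK _ px j; rewrite !in_itv/= => /andP[? ?]; apply/andP; split; lra.
  have phx : psi (h n *: e_ + x) != 0.
    by apply: contra_neq qn0 => phx; rewrite /q px phx subrr mulr0.
  move=> j; have := HK _ phx j; rewrite !in_itv/= !mxE eqxx/=.
  have h1 : h n <= 1 by rewrite invf_le1 ?ltr0n// ler1n.
  by have := h0 n; case: (j == i); rewrite ?mulr1 ?mulr0 ?add0r => ? /andP[? ?];
    apply/andP; split; lra.
have intq n : mu.-integrable setT (EFin \o q n).
  exact: integrable_bounded_box (mq n) (qM n) (qK n).
have q0 n : (\int[mu]_x (q n x)%:E = 0)%E.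
  have intp := integrable_test tp.
  have intph : mu.-integrable setT (EFin \o (fun x => psi (h n *: e_ + x))).
    have -> : EFin \o (fun x => psi (h n *: e_ + x)) =
       (EFin \o (fun x => h n * q n x + psi x)).
      by apply/funext => x /=; rewrite /q mulrA divff ?mul1r ?subrK// gt_eqF.
    by apply: integrable_EFinD => //; exact: integrable_EFinZl.
  have E : \int[mu]_x q n x = 0.
    rewrite RintegralZl ?RintegralB//; last first.
      exact: integrable_EFinB.
    have := @integral_affine_rV R d (fun=> 1) 1%g (fun j => h n * (j == i)%:R) psi
      (fun=> normr1 _) intp.
    under eq_Rintegral do rewrite -translate_deltaE.
    by move=> ->; rewrite subrr mulr0.
  rewrite -[LHS]fineK; first by congr (_%:E).
  exact: (integrable_fin_num _ (intq n)).
have cq x : q n x @[n --> \oo] --> partial i psi x.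
  have dx : derivable psi x e_ by apply: smooth_derivable; exact: test_smooth tp.
  (* The derivative is a limit over the punctured neighbourhoods of 0; dominated convergence needs
     it along the sequence 1 / (n + 1). *)
  have H : forall u : nat -> R, u n @[n --> \oo] --> (0 : R) -> (forall n, u n != 0) ->
      (u n)^-1 *: ((psi \o shift x) (u n *: e_) - psi x) @[n --> \oo] --> 'D_e_ psi x.
    move=> u u0 un.
    apply: (@cvg_comp _ _ _ u (fun h => h^-1 *: ((psi \o shift x) (h *: e_) - psi x)) \oo (0
      : R)^');
      last exact: dx.
    apply: cvg_trans (_ : _ `=>` within (fun y => y != 0) (nbhs (0 : R))) _ => //.
    by move=> A; rewrite /within/= => /u0; rewrite /nbhs/=; apply: filterS => n; apply.
  have := H h; rewrite /partial; apply.
    exact: cvg_harmonic.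
  by move=> n; rewrite gt_eqF.
have := Rintegral_dominated_cvg measurableT mq (measurable_test td)
  (integrable_indic_box M (K + 1)) (fun x _ => cq x) _.
have -> : (fun n => \int[mu]_x q n x) = fun=> 0 by apply/funext => n; rewrite /Rintegral q0.
move=> /(_ _)/cvg_lim <-//; first by rewrite lim_cst.
move=> n x _.
have [->|qn0] := eqVneq (q n x) 0.
  rewrite normr0 mulr_ge0//.
  exact: le_trans (normr_ge0 _) (qM 0%N x).
by rewrite indicE mem_set ?mulr1//; exact: qK qn0.
Qed.

Lemma dotL2_test_setT u psi : test psi -> measurable Omega ->
  dotL2 Omega u psi = \int[mu]_x (u x * psi x).
Proof.
move=> tp mO; rewrite /dotL2 Rintegral_mkcond; apply: eq_Rintegral => x _.
rewrite patchE; case: ifPn => // /negP xO; rewrite (test_out tp) ?mulr0//.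
by move=> Ox; apply: xO; exact/mem_set.
Qed.

(** The product u psi is a test function, so its partial derivative integrates to 0. *)
Lemma dotL2_partial_test i u psi : measurable Omega -> smooth u -> test psi ->
  dotL2 Omega u (partial i psi) = - dotL2 Omega (partial i u) psi.
Proof.
move=> mO su tp.
have td := test_partial i tp.
have := Rintegral_partial_test i (testM su tp).
rewrite partialM//; last exact: test_smooth tp.
rewrite RintegralD//; last 2 first.
  exact: integrable_test (testM su td).
  exact: integrable_test (testM (smooth_partial i su) tp).
by rewrite !dotL2_test_setT// => /eqP; rewrite addr_eq0 => /eqP.
Qed.

(** The derivatives move onto u one at a time, hence in reverse order; keeping [rev s] avoids any
    appeal to the symmetry of mixed derivatives. *)
Lemma dotL2_partials_test s u psi : measurable Omega -> smooth u -> test psi ->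
  dotL2 Omega u (partials s psi) =
  (-1) ^+ size s * dotL2 Omega (partials (rev s) u) psi.
Proof.
move=> mO; elim: s u => [|i s IH] u su tp; first by rewrite expr0 mul1r.
rewrite /= dotL2_partial_test//; last exact: test_partials.
rewrite IH//; last exact: smooth_partial.
rewrite exprS mulN1r mulNr; congr (- (_ * dotL2 _ _ _)).
by rewrite rev_cons -cats1 /partials foldr_cat.
Qed.

Lemma test_is_weak_partial s psi : measurable Omega -> test psi ->
  is_weak_partial Omega s psi (partials (rev s) psi).
Proof.
move=> mO tp; split; first by apply: test_in_L2 => //; exact: test_partials.
by move=> c tc; apply: dotL2_partials_test => //; exact: test_smooth tp.
Qed.

Lemma test_H2 psi : measurable Omega -> test psi -> H2 Omega psi.
Proof.
move=> mO tp; split; first exact: test_in_L2.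
by move=> s _; exists (partials (rev s) psi); exact: test_is_weak_partial.
Qed.

End test_functions.

(** * The du Bois-Reymond lemma *)

Section du_bois_reymond.
Context {R : realType} {d : nat}.
Variable Omega : set 'rV[R]_d.
Local Notation mu := (lebesgue_rV d).
Local Notation test := (test_function Omega).

(** Smooth approximations, as n grows, of the indicator of the open box; each factor is supported on
    one side of a face. *)
Definition bump (n : nat) (a b : 'I_d -> R) (x : 'rV[R]_d) : R :=
  \prod_(i < d) (step 0 (n%:R * (x ord0 i - a i)) * step 0 (n%:R * (b i - x ord0 i))).

Lemma smooth_step_coord (i : 'I_d) (m c : R) :
  smooth (fun x : 'rV[R]_d => step 0 (m * x ord0 i + c)).
Proof.
apply: (@smooth_ridge R d step (fun x => m * x ord0 i + c) (fun j => m * (i == j)%:R)).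
- by move=> n t; exact: is_derive_step.
- move=> x; apply: (@continuousD _ _ _ (fun x : 'rV[R]_d => m * x ord0 i) (fun=> c)).
    apply: (@continuousM _ _ (fun=> m) (fun x : 'rV[R]_d => x ord0 i)).
      exact: cst_continuous.
    exact: coord_continuous.
  exact: cst_continuous.
- by move=> j x h; rewrite !mxE eqxx/= eq_sym; ring.
Qed.

Lemma smooth_bump n a b : smooth (bump n a b).
Proof.
apply: smooth_prod => i; apply: smoothM.
  have := smooth_step_coord i n%:R (- (n%:R * a i)).
  by congr smooth; apply/funext => x; congr (step _ _); ring.
have := smooth_step_coord i (- n%:R) (n%:R * b i).
by congr smooth; apply/funext => x; congr (step _ _); ring.
Qed.

Lemma bump_ge0 n a b x : 0 <= bump n a b x.
Proof. by apply: prodr_ge0 => i _; rewrite mulr_ge0 ?step0_ge0. Qed.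

Lemma bump_le1 n a b x : bump n a b x <= 1.
Proof.
rewrite -[leRHS](@big1 _ _ *%R _ (index_enum 'I_d) xpredT (fun=> 1))//.
apply: ler_prod => i _; rewrite mulr_ge0 ?step0_ge0//=.
by rewrite mulr_ile1 ?step0_ge0 ?step0_le1.
Qed.

Lemma bump_out n a b x : ~ open_box a b x -> bump n a b x = 0.
Proof.
move=> /existsNP[i]; rewrite in_itv/= => /negP h.
apply/eqP; rewrite prodf_seq_eq0; apply/hasP; exists i; first by rewrite mem_index_enum.
rewrite /= mulf_eq0; apply/orP; move: h; rewrite negb_and -!leNgt => /orP[h|h]; [left|right];
  by rewrite step0_eq0// mulr_ge0_le0 ?ler0n// subr_le0.
Qed.

Lemma cvg_prod_seq (I : Type) (s : seq I) (f : I -> nat -> R) (l : I -> R) :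
  (forall i, f i n @[n --> \oo] --> l i) ->
  \prod_(i <- s) f i n @[n --> \oo] --> \prod_(i <- s) l i.
Proof.
move=> fl; elim: s => [|i s IH].
  by under eq_fun do rewrite big_nil; rewrite big_nil; exact: cvg_cst.
by under eq_fun do rewrite big_cons; rewrite big_cons; exact: cvgM.
Qed.

Lemma cvg_bump a b x :
  bump n a b x @[n --> \oo] --> (\1_(open_box a b) x : R).
Proof.
rewrite indicE; case: (pselect (open_box a b x)) => h; last first.
  rewrite memNset//; under eq_fun do rewrite bump_out//; exact: cvg_cst.
rewrite mem_set//.
rewrite -[X in _ --> X](_ : \prod_(i < d) ((1 : R) * 1) = _); last by rewrite big1// => i _;
  rewrite mulr1.
apply: cvg_prod_seq => i.
have := h i; rewrite in_itv/= => /andP[ai bi].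
by apply: cvgM; apply: cvg_step0; rewrite subr_gt0.
Qed.

Lemma test_bump n a b : closed_box a b `<=` Omega -> test (bump n a b).
Proof.
move=> abO.
have sub : closure [set x | bump n a b x != 0] `<=` closed_box a b.
  rewrite [X in _ `<=` X](closure_id _).1; last exact: closed_closed_box.
  apply: closure_subset => x /= /eqP h i.
  have : open_box a b x by apply: contrapT => /(bump_out n); exact: h.
  by move=> /(_ i); rewrite !in_itv/= => /andP[/ltW -> /ltW ->].
split; first exact: smooth_bump.
- by apply: (@subclosed_compact _ _ (closed_box a b));
  [exact: closed_closure|exact: compact_closed_box|].
- exact: subset_trans abO.
Qed.

(** The sets over which [G] has integral 0 form a Dynkin system, the vanishing total integral giving
    the complements. It contains the pi-system of boxes, hence all measurable sets. *)
Lemma ae_eq0_open_boxes (G : 'rV[R]_d -> R) :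
  mu.-integrable setT (EFin \o G) -> \int[mu]_x G x = 0 ->
  (forall a b : 'I_d -> R, \int[mu]_(x in open_box a b) G x = 0) ->
  {ae mu, forall x, G x = 0}.
Proof.
move=> IG GT GB.
have IGS A : measurable A -> mu.-integrable A (EFin \o G).
  by move=> mA; exact: integrableS IG.
have fin A : measurable A -> \int[mu]_(x in A) G x = 0 -> (\int[mu]_(x in A) (G x)%:E = 0)%E.
  move=> mA h; rewrite -[LHS]fineK; first by congr (_%:E).
  exact: (integrable_fin_num mA (IGS _ mA)).
have Hall A : measurable A -> (\int[mu]_(x in A) (G x)%:E = 0)%E.
  rewrite measurable_rVE; move: A.
  apply: (@dynkin_induction _ _ (@open_boxes R d)
    (fun A => (\int[mu]_(x in A) (G x)%:E = 0)%E)).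
  - exact: measurable_rVE.
  - exact: setI_open_boxes.
  - exact: fin.
  - by move=> _ [a [b ->]]; apply: fin; [exact: measurable_open_box|exact: GB].
  - move=> S mS S0; apply: fin; first exact: measurableC.
    have := @Rintegral_setU _ _ _ mu S (~` S) G mS (measurableC mS).
    rewrite setUv GT => /(_ IG) ->; last by apply/disj_setPS; rewrite setICr.
    have -> : \int[mu]_(x in S) G x = 0 by rewrite /Rintegral S0.
    by rewrite add0r.
  - move=> F mF tF F0; rewrite integral_bigcup//; last first.
      by apply: IGS; exact: bigcupT_measurable.
    by rewrite eseries0.
have : ae_eq mu setT (EFin \o G) (cst 0%E).
  apply: integral_ae_eq => // E _ mE.
  by rewrite Hall// integral0.
by apply: filterS => x /(_ I) [].
Qed.

(** Localize to one of countably many boxes Q whose closed box lies in Omega. Cut-off functions of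
    sub-boxes are test functions, and in the limit g 1_Q has integral 0 over every box. *)
Lemma du_bois_reymond (g : 'rV[R]_d -> R) : open Omega -> in_Lp 2%:E Omega g ->
  (forall psi, test psi -> dotL2 Omega g psi = 0) -> ae_zero Omega g.
Proof.
move=> oO Lg gtest.
have mO := open_measurable_rV oO.
have [a [b [P [PO OE]]]] := open_bigcup_box oO.
suff H k : P k -> {ae mu, forall x, open_box (a k) (b k) x -> g x = 0}.
  have H' : {ae mu, forall x k, P k -> open_box (a k) (b k) x -> g x = 0}.
    apply: ae_foralln => k; have [Pk|nPk] := pselect (P k).
      by have := H k Pk; apply: filterS => x h _.
    exact: aeW.
  by apply: filterS H' => x h; rewrite OE => -[k Pk]; exact: h.
move=> Pk; set Q := open_box (a k) (b k).
have mQ : measurable Q by exact: measurable_open_box.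
have QO : Q `<=` Omega.
  by move=> x Qx; apply: (PO k Pk) => i; move: (Qx i);
    rewrite !in_itv/= => /andP[/ltW -> /ltW ->].
(* Since the indicator of Q is in L^2, its product with [g] is integrable over the whole space. *)
have L1 : in_Lp 2%:E Omega (\1_Q : 'rV[R]_d -> R).
  apply/in_L2P => //; split; first exact: measurable_indic.
  have IQ : mu.-integrable setT (EFin \o (\1_Q : 'rV[R]_d -> R)).
    apply/integrableP; split; first by apply/measurable_EFinP; exact: measurable_indic.
    under eq_integral do rewrite /= ger0_norm//.
    by rewrite integral_indic// setIT; have /= -> := lebesgue_open_box (a k) (b k);
      rewrite ltry.
  have -> : EFin \o (fun x => \1_Q x ^+ 2 : R) = EFin \o (\1_Q : 'rV[R]_d -> R).
    by apply/funext => x; rewrite /= indicE; case: (_ \in _); rewrite ?expr1n ?expr0n.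
  exact: integrableS IQ.
pose G x : R := g x * \1_Q x.
have IG : mu.-integrable setT (EFin \o G).
  have := in_L2_integrable mO Lg L1; move/(integrable_mkcond _ mO).1.
  congr (integrable _ _ _); apply/funext => x; rewrite patchE/=.
  case: ifPn => // /negP nO; rewrite /G indicE memNset ?mulr0// => Qx.
  by apply: nO; apply/mem_set; exact: QO.
have GB u v : \int[mu]_(x in open_box u v) G x = 0.
  (* Corners of the intersection with Q. The corresponding closed box stays inside that of Q, hence
     inside Omega. *)
  pose u' i := Num.max (u i) (a k i); pose v' i := Num.min (v i) (b k i).
  have E : open_box u v `&` Q = open_box u' v'.
    apply/seteqP; split => x /=.
      move=> [h h'] i; move: (h i) (h' i); rewrite !in_itv/=.
      by rewrite gt_max lt_min => /andP[-> ->] /andP[-> ->].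
    move=> h; split=> i; move: (h i); rewrite !in_itv/= gt_max lt_min;
      by move=> /andP[/andP[? ?] /andP[? ?]]; apply/andP.
  have sub : closed_box u' v' `<=` Omega.
    apply: subset_trans (PO k Pk) => x h i; move: (h i).
    by rewrite !in_itv/= ge_max le_min => /andP[/andP[? ->] /andP[? ->]].
  have := @Rintegral_dominated_cvg _ _ _ mu setT measurableT
    (fun n x => G x * bump n u' v' x) (fun x => G x * \1_(open_box u' v') x) (fun x => `|G x|).
  have mG : measurable_fun [set: 'rV[R]_d] G by apply/measurable_EFinP;
    exact: measurable_int IG.
  have mb n : measurable_fun [set: 'rV[R]_d] (bump n u' v').
    by apply: continuous_measurable_rV; apply: smooth_continuous; exact: smooth_bump.
  have m1 : measurable_fun [set: 'rV[R]_d] (\1_(open_box u' v') : 'rV[R]_d -> R).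
    by apply: measurable_indic; exact: measurable_open_box.
  move=> /(_ (fun n => measurable_funM mG (mb n)) (measurable_funM mG m1) (integrable_norm IG)).
  have c1 (x : 'rV[R]_d) : [set: 'rV[R]_d] x ->
      G x * bump n u' v' x @[n --> \oo] --> G x * \1_(open_box u' v') x.
    by move=> _; apply: cvgMr; exact: cvg_bump.
  have c2 n (x : 'rV[R]_d) : [set: 'rV[R]_d] x -> `|G x * bump n u' v' x| <= `|G x|.
    by move=> _; rewrite normrM ler_piMr// ger0_norm ?bump_ge0// bump_le1.
  move=> /(_ c1 c2).
  have z n : \int[mu]_x (G x * bump n u' v' x) = 0.
    rewrite -(gtest _ (test_bump n sub)) (dotL2_test_setT _ (test_bump n sub))//.
    apply: eq_Rintegral => x _; rewrite /G -mulrA; congr (_ * _).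
    rewrite indicE; case: (pselect (Q x)) => Qx; first by rewrite mem_set// mul1r.
    rewrite memNset// mul0r bump_out// -E => -[_]; exact: Qx.
  have -> : (fun n => \int[mu]_x (G x * bump n u' v' x)) = fun=> 0 by apply/funext.
  move=> cG; rewrite Rintegral_mkcond.
  have -> : G \_ (open_box u v) = (fun x => G x * \1_(open_box u' v') x).
    apply/funext => x; rewrite patchE -E indicE in_setI /G.
    case: ifPn => _ /=; last by rewrite mulr0.
    by rewrite indicE; case: (x \in Q); rewrite ?mulr1// !mulr0.
  by move/cvg_lim : cG => <-//; rewrite lim_cst.
have GT : \int[mu]_x G x = 0.
  rewrite -(GB (a k) (b k)) [RHS]Rintegral_mkcond; apply: eq_Rintegral => x _.
  rewrite patchE /G indicE -/Q; by case: (x \in Q); rewrite ?mulr1// mulr0.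
have := ae_eq0_open_boxes IG GT GB; apply: filterS => x Gx Qx.
by move: Gx; rewrite /G indicE mem_set// mulr1.
Qed.

End du_bois_reymond.

(** * Weak derivatives *)

Section weak_derivatives.
Context {R : realType} {d : nat}.
Variable Omega : set 'rV[R]_d.
Hypothesis oO : open Omega.
Let mO : measurable Omega := open_measurable_rV oO.
Implicit Types (u v g c psi phi : 'rV[R]_d -> R) (i j : 'I_d).
Local Notation mu := (lebesgue_rV d).
Local Notation test := (test_function Omega).
Local Notation L2 := (in_Lp 2%:E Omega).
Local Notation dot := (dotL2 Omega).
Local Notation is_wp := (is_weak_partial Omega).
Local Notation wp := (weak_partial Omega).

Lemma weak_partialP s u : (exists g, is_wp s u g) -> is_wp s u (wp s u).
Proof. exact: xgetPex. Qed.

Lemma weak_partial_unique s u g g' : is_wp s u g -> is_wp s u g' -> ae_eq mu Omega g g'.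
Proof.
move=> [Lg Hg] [Lg' Hg'].
have : ae_zero Omega (fun x => g x - g' x).
  apply: du_bois_reymond => //; first exact: in_L2B.
  move=> psi tp; rewrite dotL2Bl//; last exact: test_in_L2.
  have := Hg _ tp; rewrite Hg'// => /(congr1 (fun t => (-1) ^+ size s * t)).
  by rewrite !mulrA -expr2 sqrr_sign !mul1r => ->; rewrite subrr.
by apply: filterS => x h Ox; apply/eqP; rewrite -subr_eq0; apply/eqP; exact: h.
Qed.

Lemma weak_partial_ae s u g : is_wp s u g -> ae_eq mu Omega (wp s u) g.
Proof.
move=> Hg; apply: weak_partial_unique (Hg); apply: weak_partialP; by exists g.
Qed.

Lemma is_weak_partialB s u v g g' : L2 u -> L2 v -> is_wp s u g -> is_wp s v g' ->
  is_wp s (fun x => u x - v x) (fun x => g x - g' x).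
Proof.
move=> Lu Lv [Lg Hg] [Lg' Hg']; split; first exact: in_L2B.
move=> psi tp.
by rewrite !dotL2Bl ?Hg ?Hg' ?mulrBr//; apply: test_in_L2 => //; exact: test_partials.
Qed.

Lemma H2_L2 u : H2 Omega u -> L2 u. Proof. by case. Qed.

Lemma H2_weak_partial u s : H2 Omega u -> (size s <= 2)%N -> is_wp s u (wp s u).
Proof. by move=> [_ H] /H; exact: weak_partialP. Qed.

Lemma H2_weak_partial_L2 u s : H2 Omega u -> (size s <= 2)%N -> L2 (wp s u).
Proof. by move=> Hu hs; have [] := H2_weak_partial Hu hs. Qed.

Lemma H2B u v : H2 Omega u -> H2 Omega v -> H2 Omega (fun x => u x - v x).
Proof.
move=> Hu Hv; split; first by apply: in_L2B => //; exact: H2_L2.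
move=> s hs; exists (fun x => wp s u x - wp s v x).
by apply: is_weak_partialB; [exact: H2_L2..|exact: H2_weak_partial|exact: H2_weak_partial].
Qed.

(** The multipliers for which H^2 and H^2_0 will be shown stable. The symmetry of second derivatives
    is carried along as a field because it is immediate for plane waves. *)
Definition bounded2 c (M : R) := [/\ smooth c, forall x, `|c x| <= M,
  forall i x, `|partial i c x| <= M, forall i j x, `|partial i (partial j c) x| <= M
  & forall i j, partial i (partial j c) = partial j (partial i c)].

Lemma smooth_measurable c : smooth c -> measurable_fun Omega c.
Proof.
move=> sc; apply: (@measurable_funS _ _ _ _ setT) => //.
by apply: continuous_measurable_rV; exact: smooth_continuous.
Qed.

Lemma smooth_in_L2M c u (M : R) : smooth c -> (forall x, `|c x| <= M) -> L2 u ->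
  L2 (fun x => c x * u x).
Proof. by move=> sc cM; apply: in_L2_mulb cM => //; exact: smooth_measurable. Qed.

Lemma dotL2_mulA c u v : dot (fun x => c x * u x) v = dot u (fun x => c x * v x).
Proof. by apply: eq_Rintegral => x _; ring. Qed.

(** Leibniz rule: c psi is again a test function, so the definition of g can be tested against
    it. *)
Lemma is_weak_partialM c M i u g : bounded2 c M -> L2 u -> is_wp [:: i] u g ->
  is_wp [:: i] (fun x => c x * u x) (fun x => c x * g x + partial i c x * u x).
Proof.
move=> [sc cM cM1 cM2 _] Lu [Lg Hg]; split.
  apply: in_L2D => //; first exact: smooth_in_L2M cM Lg.
  by apply: smooth_in_L2M (cM1 i) Lu; exact: smooth_partial.
move=> psi tp; rewrite /= expr1 mulN1r.
have Lp := test_in_L2 mO tp.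
have Lcu : L2 (fun x => c x * g x) by exact: smooth_in_L2M cM Lg.
have Ldcu : L2 (fun x => partial i c x * u x).
  by apply: smooth_in_L2M (cM1 i) Lu; exact: smooth_partial.
have tcp := testM sc tp.
rewrite dotL2Dl// !dotL2_mulA.
have := Hg _ tcp; rewrite /= expr1 mulN1r partialM//; last exact: test_smooth tp.
have tdp := test_partial i tp.
rewrite dotL2Dr//; last 2 first.
  by apply: test_in_L2 => //; exact: testM.
  by apply: test_in_L2 => //; apply: testM => //; exact: smooth_partial.
by move=> h; lra.
Qed.

(** Test g against c psi, gi against (d_j c) psi and gj against (d_i c) psi. After expansion the
    claim is a linear combination of the three identities, once d_i d_j c and d_j d_i c are
    identified. *)
Lemma is_weak_partialM2 c M i j u gi gj g : bounded2 c M -> L2 u ->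
  is_wp [:: i] u gi -> is_wp [:: j] u gj -> is_wp [:: i; j] u g ->
  is_wp [:: i; j] (fun x => c x * u x)
    (fun x => c x * g x + partial i c x * gj x + partial j c x * gi x
              + partial i (partial j c) x * u x).
Proof.
move=> [sc cM cM1 cM2 csym] Lu [Lgi Hgi] [Lgj Hgj] [Lg Hg].
have sdc k : smooth (partial k c) by exact: smooth_partial.
have sddc k l : smooth (partial k (partial l c)) by exact: smooth_partial.
have L1 : L2 (fun x => c x * g x) by exact: smooth_in_L2M cM Lg.
have L2' : L2 (fun x => partial i c x * gj x) by exact: smooth_in_L2M (cM1 i) Lgj.
have L3 : L2 (fun x => partial j c x * gi x) by exact: smooth_in_L2M (cM1 j) Lgi.
have L4 : L2 (fun x => partial i (partial j c) x * u x) by exact: smooth_in_L2M (cM2 i j) Lu.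
have L12 := in_L2D L1 L2'. have L123 := in_L2D L12 L3.
split; first exact: in_L2D.
move=> psi tp; rewrite /= -signr_odd/= expr0 mul1r.
have Lp := test_in_L2 mO tp.
have sp := test_smooth tp.
rewrite !dotL2Dl// !dotL2_mulA.
have tpj := test_partial j tp. have tpi := test_partial i tp.
have LT w : test w -> L2 w by exact: test_in_L2.
have := Hg _ (testM sc tp); rewrite /= -signr_odd/= expr0 mul1r.
have := Hgi _ (testM (sdc j) tp); rewrite /= expr1 mulN1r.
have := Hgj _ (testM (sdc i) tp); rewrite /= expr1 mulN1r.
have spj := smooth_partial j sp.
rewrite (partialM j (sdc i) sp) (partialM j sc sp).
rewrite (partialD i (smoothM sc spj) (smoothM (sdc j) sp)).
rewrite (partialM i sc spj) (partialM i (sdc j) sp).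
have T1 := testM sc (test_partial i tpj).
have T2 := testM (sdc i) tpj.
have T3 := testM (sdc j) tpi.
have T4 := testM (sddc i j) tp.
have T4' := testM (sddc j i) tp.
have D w w' : L2 w -> L2 w' -> dot u (fun x => w x + w' x) = dot u w + dot u w'.
  by move=> Lw Lw'; exact: dotL2Dr.
have e1 := D _ _ (LT _ T2) (LT _ T4').
have e2 := D _ _ (LT _ T3) (LT _ T4).
have e3 := D _ _ (in_L2D (LT _ T1) (LT _ T2)) (in_L2D (LT _ T3) (LT _ T4)).
have e4 := D _ _ (LT _ T1) (LT _ T2).
move=> /(etrans (esym e1)) h1 /(etrans (esym e2)) h2 /(etrans (esym e3)) h3.
have h3' := etrans (esym (congr2 +%R e4 e2)) h3.
move: h1 h2 h3'; rewrite (csym j i).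
clear; move: (dot u _) (dot u _) (dot u _) (dot u _) (dot g _) (dot gi _) (dot gj _).
by move=> *; lra.
Qed.

End weak_derivatives.

(** * Products in H^2_0 and Green's formula *)

Section H20_products.
Context {R : realType} {d : nat}.
Variable Omega : set 'rV[R]_d.
Hypothesis oO : open Omega.
Let mO : measurable Omega := open_measurable_rV oO.
Implicit Types (u v g c psi phi : 'rV[R]_d -> R) (i j : 'I_d).
Local Notation mu := (lebesgue_rV d).
Local Notation test := (test_function Omega).
Local Notation L2 := (in_Lp 2%:E Omega).
Local Notation dot := (dotL2 Omega).
Local Notation is_wp := (is_weak_partial Omega).
Local Notation wp := (weak_partial Omega).

Lemma dotL2D_le u v : L2 u -> L2 v ->
  dot (fun x => u x + v x) (fun x => u x + v x) <= 2 * dot u u + 2 * dot v v.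
Proof.
move=> Lu Lv; have := dotL2_ge0 Omega (fun x => u x - v x).
have Lp := in_L2D Lu Lv. have Lm := in_L2B mO Lu Lv.
rewrite (dotL2Bl mO Lu Lv Lm) (dotL2Br mO Lu Lv Lu) (dotL2Br mO Lu Lv Lv).
rewrite (dotL2Dl mO Lu Lv Lp) (dotL2Dr mO Lu Lv Lu) (dotL2Dr mO Lu Lv Lv).
by move=> h; lra.
Qed.

Lemma dotL2M_le c u (M : R) : smooth c -> (forall x, `|c x| <= M) -> L2 u ->
  dot (fun x => c x * u x) (fun x => c x * u x) <= M ^+ 2 * dot u u.
Proof.
move=> sc cM Lu; have Lcu := smooth_in_L2M oO sc cM Lu.
rewrite -(dotL2Zl mO (M ^+ 2) Lu Lu); apply: le_Rintegral => //.
- exact: (in_L2_integrable mO Lcu Lcu).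
- have LM := in_L2Z mO (M ^+ 2) Lu; exact: (in_L2_integrable mO LM Lu).
- move=> x _ /=; rewrite -expr2 exprMn -mulrA -expr2.
  apply: ler_wpM2r; first exact: sqr_ge0.
  rewrite -(real_normK (num_real (c x))) ler_sqr ?nnegrE//.
  exact: le_trans (cM x).
Qed.

Lemma sqr_norm_grad u :
  norm_grad Omega u ^+ 2 = \sum_i dot (wp [:: i] u) (wp [:: i] u).
Proof.
rewrite /norm_grad sqr_sqrtr; last by apply: sumr_ge0 => i _; exact: sqr_ge0.
by apply: eq_bigr => i _; rewrite sqr_normL2.
Qed.

Lemma sqr_normH2 u :
  normH2 Omega u ^+ 2 = dot u u + \sum_i dot (wp [:: i] u) (wp [:: i] u) +
    \sum_i \sum_j dot (wp [:: i; j] u) (wp [:: i; j] u).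
Proof.
rewrite /normH2 sqr_sqrtr; last first.
  rewrite !addr_ge0 ?sqr_ge0//.
  by apply: sumr_ge0 => i _; apply: sumr_ge0 => j _; exact: sqr_ge0.
rewrite sqr_norm_grad sqr_normL2; congr (_ + _).
by apply: eq_bigr => i _; apply: eq_bigr => j _; rewrite sqr_normL2.
Qed.

Lemma normH2_ge0 u : 0 <= normH2 Omega u. Proof. exact: sqrtr_ge0. Qed.

Lemma dotL2_sum_ge0 (I : finType) (P : pred I) (f : I -> 'rV[R]_d -> R) :
  0 <= \sum_(k | P k) dot (f k) (f k).
Proof. by apply: sumr_ge0 => k _; exact: dotL2_ge0. Qed.

Lemma dotL2_sum2_ge0 (I J : finType) (f : I -> J -> 'rV[R]_d -> R) :
  0 <= \sum_k \sum_l dot (f k l) (f k l).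
Proof. by apply: sumr_ge0 => k _; exact: dotL2_sum_ge0. Qed.

Lemma L2_le_normH2 u : dot u u <= normH2 Omega u ^+ 2.
Proof.
by rewrite sqr_normH2 -addrA lerDl addr_ge0 ?dotL2_sum_ge0 ?dotL2_sum2_ge0.
Qed.

Lemma ler_sum_term (I : finType) (F : I -> R) (k : I) :
  (forall l, 0 <= F l) -> F k <= \sum_i F i.
Proof. by move=> F0; rewrite (bigD1 k)//= lerDl sumr_ge0. Qed.

Lemma weak_partial_le_normH2 u i : dot (wp [:: i] u) (wp [:: i] u) <= normH2 Omega u ^+ 2.
Proof.
rewrite sqr_normH2 (bigD1 i)//=.
have := dotL2_ge0 Omega u; have := dotL2_sum2_ge0 (fun i j => wp [:: i; j] u).
have := dotL2_sum_ge0 (fun k => k != i) (fun i => wp [:: i] u).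
by move=> *; lra.
Qed.

Lemma weak_partial2_le_normH2 u i j :
  dot (wp [:: i; j] u) (wp [:: i; j] u) <= normH2 Omega u ^+ 2.
Proof.
apply: le_trans (_ : \sum_j dot (wp [:: i; j] u) (wp [:: i; j] u) <= _).
  apply: (ler_sum_term (F := fun j => dot (wp [:: i; j] u) (wp [:: i; j] u))) => k.
  exact: dotL2_ge0.
apply: le_trans (_ : \sum_i \sum_j dot (wp [:: i; j] u) (wp [:: i; j] u) <= _).
  apply: (ler_sum_term (F := fun i => \sum_j dot (wp [:: i; j] u) (wp [:: i; j] u))) => k.
  exact: dotL2_sum_ge0.
by rewrite sqr_normH2 lerDr addr_ge0 ?dotL2_sum_ge0 ?dotL2_ge0.
Qed.

Lemma weak_partialM_ae c M i u : bounded2 c M -> H2 Omega u ->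
  ae_eq mu Omega (wp [:: i] (fun x => c x * u x))
    (fun x => c x * wp [:: i] u x + partial i c x * u x).
Proof.
move=> cM Hu; apply: weak_partial_ae => //.
apply: is_weak_partialM cM (H2_L2 Hu) _ => //; exact: H2_weak_partial.
Qed.

Lemma weak_partialM2_ae c M i j u : bounded2 c M -> H2 Omega u ->
  ae_eq mu Omega (wp [:: i; j] (fun x => c x * u x))
    (fun x => c x * wp [:: i; j] u x + partial i c x * wp [:: j] u x
      + partial j c x * wp [:: i] u x + partial i (partial j c) x * u x).
Proof.
move=> cM Hu; apply: weak_partial_ae => //.
by apply: is_weak_partialM2 cM (H2_L2 Hu) _ _ _ => //; exact: H2_weak_partial.
Qed.

Lemma H2M c M u : bounded2 c M -> H2 Omega u -> H2 Omega (fun x => c x * u x).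
Proof.
move=> cM Hu; have Lu := H2_L2 Hu; have [sc cM0 _ _ _] := cM.
have Lcu : L2 (fun x => c x * u x) by exact: smooth_in_L2M cM0 Lu.
split => // -[|i [|j [|//]]] _.
- by exists (fun x => c x * u x); split => // psi tp; rewrite expr0 mul1r.
- by eexists; apply: is_weak_partialM cM Lu _ => //; exact: H2_weak_partial.
- by eexists; apply: is_weak_partialM2 cM Lu _ _ _ => //; exact: H2_weak_partial.
Qed.

Lemma add_sub_cancelling (a b p q : R) : p = - q -> a + b = (a - p) + (b - q).
Proof. by move=> ->; ring. Qed.

(** Three uses of |u + v|^2 <= 2 |u|^2 + 2 |v|^2 on a sum of four terms of square at most X give 4
    X, then 10 X, then 22 X. *)
Lemma quadruple_bound (a1 a2 a3 a4 a12 a123 X : R) : 0 <= X -> a123 <= 2 * a12 + 2 * a3 ->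
  a12 <= 2 * a1 + 2 * a2 -> a1 <= X -> a2 <= X -> a3 <= X -> a4 <= X ->
  2 * a123 + 2 * a4 <= 22 * X.
Proof. by move=> *; lra. Qed.

Lemma dotL2_ae_self u v : L2 u -> L2 v -> ae_eq mu Omega u v -> dot u u = dot v v.
Proof. by move=> Lu Lv uv; exact: dotL2_ae. Qed.

(** Continuity of multiplication by c in H^2. The constant counts the function, d first derivatives
    with two terms each and d^2 second derivatives with four; what matters is that it does not
    depend on u. *)
Lemma normH2M_le c M u : bounded2 c M -> H2 Omega u ->
  normH2 Omega (fun x => c x * u x) ^+ 2 <=
  M ^+ 2 * (1 + 4 * d%:R + 22 * (d%:R * d%:R)) * normH2 Omega u ^+ 2.
Proof.
move=> cM Hu; have Lu := H2_L2 Hu; have [sc cM0 cM1 cM2 _] := cM.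
have Hcu := H2M cM Hu.
have sdc i : smooth (partial i c) by exact: smooth_partial.
have sddc i j : smooth (partial i (partial j c)) by exact: smooth_partial.
set H := normH2 Omega u ^+ 2.
have M0 : 0 <= M ^+ 2 by exact: sqr_ge0.
have b0 := L2_le_normH2 u.
have b1 i := weak_partial_le_normH2 u i.
have b2 i j := weak_partial2_le_normH2 u i j.
have Li i : L2 (wp [:: i] u) by exact: H2_weak_partial_L2.
have Lij i j : L2 (wp [:: i; j] u) by exact: H2_weak_partial_L2.
have mle a w : smooth a -> (forall x, `|a x| <= M) -> L2 w -> dot w w <= H ->
    dot (fun x => a x * w x) (fun x => a x * w x) <= M ^+ 2 * H.
  move=> sa aM Lw wH; apply: le_trans (dotL2M_le sa aM Lw) _.
  exact: ler_wpM2l.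
have Lm a w : smooth a -> (forall x, `|a x| <= M) -> L2 w -> L2 (fun x => a x * w x).
  by move=> sa aM Lw; exact: smooth_in_L2M aM Lw.
have t0 : dot (fun x => c x * u x) (fun x => c x * u x) <= M ^+ 2 * H by exact: mle.
have t1 i : dot (wp [:: i] (fun x => c x * u x)) (wp [:: i] (fun x => c x * u x))
    <= 4 * (M ^+ 2 * H).
  have A1 := Lm _ _ sc cM0 (Li i). have A2 := Lm _ _ (sdc i) (cM1 i) Lu.
  rewrite (dotL2_ae_self _ (in_L2D A1 A2) (weak_partialM_ae i cM Hu)); last first.
    exact: H2_weak_partial_L2.
  apply: le_trans (dotL2D_le A1 A2) _.
  have := mle _ _ sc cM0 (Li i) (b1 i); have := mle _ _ (sdc i) (cM1 i) Lu b0.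
  by move=> h1 h2; lra.
have t2 i j : dot (wp [:: i; j] (fun x => c x * u x)) (wp [:: i; j] (fun x => c x * u x))
    <= 22 * (M ^+ 2 * H).
  have A1 := Lm _ _ sc cM0 (Lij i j). have A2 := Lm _ _ (sdc i) (cM1 i) (Li j).
  have A3 := Lm _ _ (sdc j) (cM1 j) (Li i). have A4 := Lm _ _ (sddc i j) (cM2 i j) Lu.
  have A12 := in_L2D A1 A2. have A123 := in_L2D A12 A3.
  rewrite (dotL2_ae_self _ (in_L2D A123 A4) (weak_partialM2_ae i j cM Hu)); last first.
    exact: H2_weak_partial_L2.
  apply: le_trans (dotL2D_le A123 A4) _.
  have h1 := dotL2D_le A12 A3; have h2 := dotL2D_le A1 A2.
  have H0 : 0 <= M ^+ 2 * H by rewrite mulr_ge0// sqr_ge0.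
  exact: quadruple_bound H0 h1 h2 (mle _ _ sc cM0 (Lij i j) (b2 i j))
    (mle _ _ (sdc i) (cM1 i) (Li j) (b1 j)) (mle _ _ (sdc j) (cM1 j) (Li i) (b1 i))
    (mle _ _ (sddc i j) (cM2 i j) Lu b0).
rewrite sqr_normH2.
have s1 : \sum_i dot (wp [:: i] (fun x => c x * u x)) (wp [:: i] (fun x => c x * u x))
    <= d%:R * (4 * (M ^+ 2 * H)).
  apply: le_trans (ler_sum _ (fun i _ => t1 i)) _.
  by rewrite sumr_const card_ord -[leLHS]mulr_natl.
have s2 : \sum_i \sum_j dot (wp [:: i; j] (fun x => c x * u x)) (wp [:: i;
  j] (fun x => c x * u x))
    <= d%:R * (d%:R * (22 * (M ^+ 2 * H))).
  apply: le_trans (ler_sum _ (fun i _ => ler_sum _ (fun j _ => t2 i j))) _.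
  by rewrite !sumr_const card_ord -[leLHS]mulr_natl -[X in _ * X <= _]mulr_natl.
apply: le_trans (lerD (lerD t0 s1) s2) _.
by rewrite le_eqVlt; apply/orP; left; apply/eqP; ring.
Qed.

Lemma H20M c M u : bounded2 c M -> H20 Omega u -> H20 Omega (fun x => c x * u x).
Proof.
move=> cM [Hu appr]; split; first exact: H2M cM Hu.
move=> e e0; have [sc _ _ _ _] := cM.
pose K := M ^+ 2 * (1 + 4 * d%:R + 22 * (d%:R * d%:R)) : R.
have K0 : 0 <= K.
  by rewrite mulr_ge0 ?sqr_ge0// !addr_ge0 ?mulr_ge0 ?ler0n.
(* With 1 + K the quotient makes sense even if K = 0, and K < (1 + K)^2 gives the strict inequality
   at the end. *)
have e'0 : 0 < e / (1 + K) by rewrite divr_gt0// ltr_pwDl.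
have [psi tp pe] := appr _ e'0.
exists (fun x => c x * psi x); first exact: testM.
have -> : ((fun x => c x * u x) \- (fun x => c x * psi x)) = (fun x => c x * (u x - psi x)).
  by apply/funext => x /=; rewrite mulrBr.
have Hd : H2 Omega (fun x => u x - psi x) by apply: H2B => //; exact: test_H2.
have := normH2M_le cM Hd; rewrite -/K => h.
rewrite -(ltr_pXn2r (n := 2)) ?nnegrE ?normH2_ge0 ?(ltW e0)//.
apply: le_lt_trans h _.
have H1 : normH2 Omega (fun x => u x - psi x) ^+ 2 < (e / (1 + K)) ^+ 2.
  by rewrite ltr_pXn2r// ?nnegrE ?normH2_ge0 ?(ltW e'0).
have K1 : 0 < 1 + K by rewrite ltr_pwDl.
apply: (@le_lt_trans _ _ (K * (e / (1 + K)) ^+ 2)).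
  by rewrite ler_wpM2l// ltW.
rewrite expr_div_n mulrA ltr_pdivrMr ?exprn_gt0// mulrC ltr_pM2l ?exprn_gt0//.
by rewrite sqrrD expr1n; nra.
Qed.

Lemma H20_H2 u : H20 Omega u -> H2 Omega u. Proof. by case. Qed.

Lemma weak_partialB_ae s u v : H2 Omega u -> H2 Omega v -> (size s <= 2)%N ->
  ae_eq mu Omega (wp s (fun x => u x - v x)) (fun x => wp s u x - wp s v x).
Proof.
move=> Hu Hv hs; apply: weak_partial_ae => //.
by apply: is_weak_partialB => //; [exact: H2_L2..|exact: H2_weak_partial|exact:
  H2_weak_partial].
Qed.

Lemma dotL2_le_normL2 u v : L2 u -> L2 v ->
  `|dot u v| <= normLp 2%:E Omega u * normLp 2%:E Omega v.
Proof.
move=> Lu Lv; rewrite -(ler_pXn2r (n := 2)) ?nnegrE ?mulr_ge0 ?normLp_ge0//.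
by rewrite exprMn !sqr_normL2 real_normK ?num_real// dotL2_cauchy_schwarz.
Qed.

(** Density argument: the identity is exact when one factor u is replaced by an approximating test
    function psi, and both remaining terms are bounded by the H^2 distance from u to psi. *)
Lemma H20_green i u : H20 Omega u ->
  dot u (wp [:: i; i] u) = - dot (wp [:: i] u) (wp [:: i] u).
Proof.
move=> [Hu appr].
have Lu := H2_L2 Hu.
have Li : L2 (wp [:: i] u) by exact: H2_weak_partial_L2.
have Lii : L2 (wp [:: i; i] u) by exact: H2_weak_partial_L2.
have rfl (w : 'rV[R]_d -> R) : ae_eq mu Omega w w by exact: aeW.
set A := normLp 2%:E Omega u + normLp 2%:E Omega (wp [:: i] u).
have A0 : 0 <= A by rewrite addr_ge0 ?normLp_ge0.
apply/eqP; rewrite -subr_eq0 opprK -normr_le0; apply/ler_addgt0Pr => e e0.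
rewrite add0r.
have e'0 : 0 < e / (1 + A) by rewrite divr_gt0// ltr_pwDl.
have [psi tp pe] := appr _ e'0.
have Hp := test_H2 mO tp.
have Hd : H2 Omega (fun x => u x - psi x) by exact: H2B.
have Lwi : L2 (wp [:: i] (fun x => u x - psi x)) by exact: H2_weak_partial_L2.
have Lwii : L2 (wp [:: i; i] (fun x => u x - psi x)) by exact: H2_weak_partial_L2.
have Lpi : L2 (wp [:: i] psi) by exact: H2_weak_partial_L2.
have Lpii : L2 (wp [:: i; i] psi) by exact: H2_weak_partial_L2.
have tpi := test_partial i tp.
have Ltpi := test_in_L2 mO tpi. have Ltpii := test_in_L2 mO (test_partial i tpi).
have E1 : dot u (wp [:: i; i] u) - dot u (wp [:: i; i] psi) = dot u (wp [:: i;
  i] (fun x => u x - psi x)).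
  rewrite -(dotL2Br mO Lii Lpii Lu); apply/esym.
  exact: (dotL2_ae mO Lu Lu Lwii (in_L2B mO Lii Lpii) (rfl u) (weak_partialB_ae (s := [:: i;
    i]) Hu Hp isT)).
have E2 : dot (wp [:: i] u) (wp [:: i] u) - dot (wp [:: i] u) (wp [:: i] psi) =
    dot (wp [:: i] u) (wp [:: i] (fun x => u x - psi x)).
  rewrite -(dotL2Br mO Li Lpi Li); apply/esym.
  exact: (dotL2_ae mO Li Li Lwi (in_L2B mO Li Lpi) (rfl _) (weak_partialB_ae (s := [:: i]) Hu
    Hp isT)).
(* The definition of the weak derivative of u, tested against d_i psi. *)
have E3 : dot u (wp [:: i; i] psi) = - dot (wp [:: i] u) (wp [:: i] psi).
  have W1 : ae_eq mu Omega (wp [:: i; i] psi) (partial i (partial i psi)).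
    by apply: weak_partial_ae => //; exact: (test_is_weak_partial [:: i; i] mO tp).
  have W2 : ae_eq mu Omega (wp [:: i] psi) (partial i psi).
    by apply: weak_partial_ae => //; exact: (test_is_weak_partial [:: i] mO tp).
  rewrite (dotL2_ae mO Lu Lu Lpii Ltpii (rfl u) W1).
  rewrite (dotL2_ae mO Li Li Lpi Ltpi (rfl _) W2).
  have [_ Hi] := H2_weak_partial Hu (isT : size [:: i] <= 2)%N.
  by have := Hi _ tpi; rewrite /= expr1 mulN1r.
have le1 : normLp 2%:E Omega (wp [:: i; i] (fun x => u x - psi x)) <= e / (1 + A).
  rewrite -(ler_pXn2r (n := 2)) ?nnegrE ?normLp_ge0 ?(ltW e'0)// sqr_normL2.
  apply: le_trans (weak_partial2_le_normH2 _ _ _) _.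
  by rewrite ler_pXn2r ?nnegrE ?normH2_ge0 ?(ltW e'0)// ltW.
have le2 : normLp 2%:E Omega (wp [:: i] (fun x => u x - psi x)) <= e / (1 + A).
  rewrite -(ler_pXn2r (n := 2)) ?nnegrE ?normLp_ge0 ?(ltW e'0)// sqr_normL2.
  apply: le_trans (weak_partial_le_normH2 _ _) _.
  by rewrite ler_pXn2r ?nnegrE ?normH2_ge0 ?(ltW e'0)// ltW.
have -> : dot u (wp [:: i; i] u) + dot (wp [:: i] u) (wp [:: i] u) =
   dot u (wp [:: i; i] (fun x => u x - psi x)) + dot (wp [:: i] u) (wp [:: i] (fun x =>
     u x - psi x)).
  apply: etrans (congr2 +%R E1 E2); apply: add_sub_cancelling E3.
apply: le_trans (ler_normD _ _) _.
apply: le_trans (lerD (dotL2_le_normL2 Lu Lwii) (dotL2_le_normL2 Li Lwi)) _.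
apply: (@le_trans _ _ (A * (e / (1 + A)))).
  by rewrite /A mulrDl lerD// ler_wpM2l ?normLp_ge0.
rewrite mulrA ler_pdivrMr ?ltr_pwDl// mulrC ler_pM2l//.
by rewrite lerDr.
Qed.

End H20_products.

(** * Plane waves as multipliers *)

Section plane_waves.
Context {R : realType} {d : nat}.
Implicit Types (xi x : 'rV[R]_d) (p : R).

Definition rdot xi x : R := \sum_i xi ord0 i * x ord0 i.

(* The phases 0 and - pi/2 give cos(xi.x) and sin(xi.x), the real and imaginary
   parts of exp(i xi.x). *)
Definition wave p xi x : R := cos (rdot xi x + p).

Lemma continuous_rdot xi : continuous (rdot xi).
Proof.
rewrite /rdot; elim: (index_enum _) => [|i s IH] x.
  by under eq_fun do rewrite big_nil; exact: cst_continuous.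
under eq_fun do rewrite big_cons.
apply: (@continuousD _ _ _ (fun x : 'rV[R]_d => xi ord0 i * x ord0 i)); last exact: IH.
apply: (@continuousM _ _ (fun=> xi ord0 i) (fun x : 'rV[R]_d => x ord0 i)).
  exact: cst_continuous.
exact: coord_continuous.
Qed.

(** Each derivative advances the phase by pi / 2, so the derivatives of a wave are multiples of
    waves with the same frequency. *)
Lemma is_derive_cosD (n : nat) p (t : R) :
  is_derive t (1 : R) (fun t => cos (t + (p + n%:R * (pi / 2))))
    (cos (t + (p + n.+1%:R * (pi / 2)))).
Proof.
have -> : t + (p + n.+1%:R * (pi / 2)) = (t + (p + n%:R * (pi / 2))) + pi / 2.
  by rewrite -natr1; ring.
rewrite cosDpihalf.
have := @is_derive1_comp _ (@cos R) (fun s => s + (p + n%:R * (pi / 2))) t _ 1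
  (is_derive_cos (t + (p + n%:R * (pi / 2)))).
rewrite mulr1; apply.
have H : is_derive t (1 : R) (id + cst (p + n%:R * (pi / 2))) (1 + 0 : R) by exact: is_deriveD.
by rewrite addr0 in H.
Qed.

Lemma wave_is_ridge p xi :
  wave p xi = (fun t => cos (t + (p + 0%:R * (pi / 2)))) \o rdot xi.
Proof. by apply/funext => x; rewrite /wave/= mul0r addr0. Qed.

Lemma rdot_translate xi i x (h : R) :
  rdot xi (h *: delta_mx 0 i + x) = h * xi ord0 i + rdot xi x.
Proof.
rewrite /rdot.
under eq_bigr do rewrite !mxE eqxx/= mulrDr.
rewrite big_split/=; congr (_ + _).
rewrite (bigD1 i)//= eqxx mulr1 big1 ?addr0 1?mulrC// => j ji.
by rewrite (negbTE ji) !mulr0.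
Qed.

Lemma smooth_wave p xi : smooth (wave p xi).
Proof.
rewrite wave_is_ridge.
apply: (@smooth_ridge R d (fun n t => cos (t + (p + n%:R * (pi / 2)))) (rdot xi) (fun i =>
  xi ord0 i) _ _ _ 0%N).
- by move=> n t; exact: is_derive_cosD.
- exact: continuous_rdot.
- by move=> i x h; exact: rdot_translate.
Qed.

Lemma partial_wave i p xi :
  partial i (wave p xi) = (fun x => xi ord0 i * wave (p + pi / 2) xi x).
Proof.
rewrite wave_is_ridge.
have := @partial_ridge R d (fun n t => cos (t + (p + n%:R * (pi / 2)))) (rdot xi) (fun i =>
  xi ord0 i)
  (fun n t => is_derive_cosD n p t) (fun i x h => rdot_translate xi i x h) 0%N i.
by move=> ->; apply/funext => x; rewrite /wave mul1r.
Qed.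

Lemma partialZ i (a : R) (u : 'rV[R]_d -> R) : smooth u ->
  partial i (fun x => a * u x) = (fun x => a * partial i u x).
Proof.
move=> su; rewrite partialM//; last exact: smooth_cst.
by apply/funext => x; rewrite /partial derive_cst mul0r addr0.
Qed.

Lemma wave_pi p xi x : wave (p + pi / 2 + pi / 2) xi x = - wave p xi x.
Proof.
rewrite /wave -[in RHS]cosDpi; congr cos.
by rewrite -!addrA -splitr.
Qed.

Lemma partial2_wave i j p xi :
  partial i (partial j (wave p xi)) = (fun x => - (xi ord0 i * xi ord0 j) * wave p xi x).
Proof.
rewrite partial_wave partialZ; last exact: smooth_wave.
apply/funext => x; rewrite partial_wave wave_pi; ring.
Qed.

Lemma wave_le1 p xi x : `|wave p xi x| <= 1. Proof. exact: cos_max. Qed.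

(** With S the sum of the |xi_i|, the constant (1 + S)^2 dominates 1, S and S^2 at once. *)
Lemma bounded2_wave p xi :
  bounded2 (wave p xi) ((1 + \sum_i `|xi ord0 i|) ^+ 2).
Proof.
set S := \sum_i `|xi ord0 i|.
have S0 : 0 <= S by exact: sumr_ge0.
have xS i : `|xi ord0 i| <= S.
  by rewrite /S (bigD1 i)//= lerDl sumr_ge0.
split; first exact: smooth_wave.
- by move=> x; apply: le_trans (wave_le1 p xi x) _; nra.
- move=> i x; rewrite partial_wave normrM.
  have := wave_le1 (p + pi / 2) xi x => h.
  apply: (@le_trans _ _ (S * 1)); last by nra.
  by rewrite ler_pM.
- move=> i j x; rewrite partial2_wave normrM normrN normrM.
  have := wave_le1 p xi x => h.
  apply: (@le_trans _ _ (S * S * 1)); last by nra.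
  by rewrite ler_pM// ?mulr_ge0// ler_pM.
- by move=> i j; rewrite !partial2_wave; apply/funext => x; rewrite (mulrC (xi ord0 i)).
Qed.

Lemma wave0E xi x : wave 0 xi x = cos (rdot xi x). Proof. by rewrite /wave addr0. Qed.

Lemma waveNE xi x : wave (- (pi / 2)) xi x = sin (rdot xi x).
Proof. by rewrite /wave cosBpihalf. Qed.

Variable Omega : set 'rV[R]_d.
Hypothesis oO : open Omega.
Let mO : measurable Omega := open_measurable_rV oO.
Local Notation mu := (lebesgue_rV d).
Local Notation L2 := (in_Lp 2%:E Omega).
Local Notation dot := (dotL2 Omega).
Local Notation wp := (weak_partial Omega).
Local Notation lap := (weak_laplacian Omega).

Lemma H2_laplacian_L2 u : H2 Omega u -> L2 (lap u).
Proof.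
by move=> Hu; apply: in_L2_sum => // i; exact: H2_weak_partial_L2.
Qed.

Lemma ae_eq_sum (I : Type) (s : seq I) (f g : I -> 'rV[R]_d -> R) :
  (forall i, ae_eq mu Omega (f i) (g i)) ->
  ae_eq mu Omega (fun x => \sum_(i <- s) f i x) (fun x => \sum_(i <- s) g i x).
Proof.
move=> fg; elim: s => [|i s IH]; first by apply: aeW => x _; rewrite !big_nil.
by apply: filterS2 (fg i) IH => x h1 h2 Ox; rewrite !big_cons h1// h2.
Qed.

(** Real form of Delta(exp(i xi.x) u) = exp(i xi.x) (Delta u - |xi|^2 u + 2 i xi.grad u): the factor
    i appears as the phase shift pi / 2. *)
Lemma laplacian_wave_ae p xi u : H2 Omega u ->
  ae_eq mu Omega (lap (fun x => wave p xi x * u x))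
    (fun x => wave p xi x * (lap u x - rdot xi xi * u x) +
       wave (p + pi / 2) xi x * (2 * \sum_i xi ord0 i * wp [:: i] u x)).
Proof.
move=> Hu.
have H i := weak_partialM2_ae oO i i (bounded2_wave p xi) Hu.
apply: ae_eq_trans (ae_eq_sum (index_enum 'I_d) H) _.
apply: aeW => x _.
rewrite /weak_laplacian /rdot mulrBr !mulr_sumr mulr_suml mulr_sumr.
rewrite -sumrB -big_split/=; apply: eq_bigr => i _.
by rewrite partial2_wave partial_wave; ring.
Qed.

Lemma wave_L2 p xi u : L2 u -> L2 (fun x => wave p xi x * u x).
Proof. by move=> Lu; apply: smooth_in_L2M (wave_le1 p xi) Lu => //; exact: smooth_wave. Qed.

Lemma wave_H20 p xi u : H20 Omega u -> H20 Omega (fun x => wave p xi x * u x).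
Proof. exact: H20M (bounded2_wave p xi). Qed.

(** The squared L^2 norm of xi.grad u, expanded as a quadratic form in xi so that it can be averaged
    over a ball. *)
Definition grad_form u xi : R :=
  \sum_i \sum_j xi ord0 i * xi ord0 j * dot (wp [:: i] u) (wp [:: j] u).

(** Pointwise, (c a - s b)^2 + (s a + c b)^2 = a^2 + b^2 when c^2 + s^2 = 1: the cross terms cancel
    between the two phases. *)
Lemma dotL2_wave_sum u v : L2 u -> L2 v -> forall xi,
  let f p x := wave p xi x * u x + wave (p + pi / 2) xi x * v x in
  dot (f 0) (f 0) + dot (f (- (pi / 2))) (f (- (pi / 2))) = dot u u + dot v v.
Proof.
move=> Lu Lv xi f.
have Lf p : L2 (f p) by apply: in_L2D; exact: wave_L2.
rewrite /dotL2 -RintegralD//; [|exact: in_L2_integrable..].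
rewrite -RintegralD//; [|exact: in_L2_integrable..].
apply: eq_Rintegral => x _; rewrite /f.
have -> : wave (0 + pi / 2) xi x = - sin (rdot xi x) by rewrite add0r /wave cosDpihalf.
have -> : wave (- (pi / 2) + pi / 2) xi x = cos (rdot xi x) by rewrite addNr wave0E.
rewrite wave0E waveNE.
have := cos2Dsin2 (rdot xi x).
move: (cos _) (sin _) (u x) (v x) => c s a b cs.
transitivity ((c ^+ 2 + s ^+ 2) * (a * a + b * b)); first by ring.
by rewrite cs mul1r.
Qed.

(** The two phases together give |Delta u - |xi|^2 u|^2 + |2 xi.grad u|^2. Green's formula evaluates
    <u, Delta u> as - |grad u|^2. *)
Lemma laplacian_waves u xi : H20 Omega u ->
  dot (lap (fun x => wave 0 xi x * u x)) (lap (fun x => wave 0 xi x * u x)) +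
  dot (lap (fun x => wave (- (pi / 2)) xi x * u x)) (lap (fun x =>
    wave (- (pi / 2)) xi x * u x)) =
  dot (lap u) (lap u) + 2 * rdot xi xi * norm_grad Omega u ^+ 2
    + rdot xi xi ^+ 2 * dot u u + 4 * grad_form u xi.
Proof.
move=> Hu0; have Hu := H20_H2 Hu0; have Lu := H2_L2 Hu.
have LL := H2_laplacian_L2 Hu.
have Lg i : L2 (wp [:: i] u) by exact: H2_weak_partial_L2.
pose A x := lap u x - rdot xi xi * u x.
pose B x := 2 * \sum_i xi ord0 i * wp [:: i] u x.
have LqU : L2 (fun x => rdot xi xi * u x) by exact: in_L2Z.
have LA : L2 A by exact: in_L2B.
have Lxg i : L2 (fun x => xi ord0 i * wp [:: i] u x) by exact: in_L2Z.
have LS : L2 (fun x => \sum_i xi ord0 i * wp [:: i] u x) by exact: in_L2_sum.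
have LB : L2 B by exact: in_L2Z.
have HE p : dot (lap (fun x => wave p xi x * u x)) (lap (fun x => wave p xi x * u x)) =
    dot (fun x => wave p xi x * A x + wave (p + pi / 2) xi x * B x)
        (fun x => wave p xi x * A x + wave (p + pi / 2) xi x * B x).
  apply: dotL2_ae_self => //.
  - by apply: H2_laplacian_L2; apply: H20_H2; exact: wave_H20.
  - by apply: in_L2D; exact: wave_L2.
  - exact: laplacian_wave_ae.
rewrite !HE (dotL2_wave_sum LA LB); congr (_ + _).
  have green : dot u (lap u) = - norm_grad Omega u ^+ 2.
    rewrite sqr_norm_grad dotL2_sumr//; last by move=> i; exact: H2_weak_partial_L2.
    by rewrite -sumrN; apply: eq_bigr => i _; exact: H20_green.
  rewrite (dotL2Bl mO LL LqU LA) (dotL2Br mO LL LqU LL) (dotL2Br mO LL LqU LqU).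
  rewrite !(dotL2Zl mO _ Lu)// !(dotL2Zr mO _ _ Lu)// (dotL2C Omega (lap u) u) green; ring.
rewrite (dotL2Zl mO 2 LS LB) (dotL2Zr mO 2 LS LS) mulrA -natrM; congr (_ * _).
rewrite dotL2_suml//; apply: eq_bigr => i _.
rewrite dotL2_sumr//; apply: eq_bigr => j _.
by rewrite dotL2Zl// dotL2Zr// mulrA.
Qed.

End plane_waves.

(** * The spectral inequality *)

Section spectral_inequality.
Context {R : realType} {d : nat}.
Variable Omega : set 'rV[R]_d.
Hypothesis oO : open Omega.
Let mO : measurable Omega := open_measurable_rV oO.
Local Notation L2 := (in_Lp 2%:E Omega).
Local Notation dot := (dotL2 Omega).
Local Notation lap := (weak_laplacian Omega).

(** Used twice with the same coefficients c_j = <u, U_j>: for the U_j with l = 1, and for their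
    Laplacians, which are orthogonal with l = Lambda. *)
Lemma dotL2_sub_projection (V : nat -> 'rV[R]_d -> R) (l c : nat -> R) v :
  (forall j, L2 (V j)) -> L2 v ->
  (forall i j, dot (V i) (V j) = l i * (i == j)%:R) ->
  (forall j, dot v (V j) = l j * c j) -> forall n : nat,
  dot (fun x => v x - \sum_(j < n) c j * V j x)
      (fun x => v x - \sum_(j < n) c j * V j x) =
  dot v v - \sum_(j < n) l j * c j ^+ 2.
Proof.
move=> LV Lv VV vV n.
have LcV j : L2 (fun x => c j * V j x) by exact: in_L2Z.
have LS : L2 (fun x => \sum_(j < n) c j * V j x) by exact: in_L2_sum.
have Lr := in_L2B mO Lv LS.
have vS : dot v (fun x => \sum_(j < n) c j * V j x) = \sum_(j < n) l j * c j ^+ 2.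
  rewrite dotL2_sumr//; apply: eq_bigr => j _.
  by rewrite dotL2Zr// vV; ring.
have SS : dot (fun x => \sum_(j < n) c j * V j x) (fun x => \sum_(j < n) c j * V j x) =
    \sum_(j < n) l j * c j ^+ 2.
  rewrite dotL2_suml//; apply: eq_bigr => i _.
  rewrite dotL2Zl// dotL2_sumr// (bigD1 i)//= dotL2Zr// VV eqxx big1 ?addr0 /= ?mulr1;
    first by ring.
  move=> j ji; rewrite dotL2Zr// VV.
  by rewrite (_ : (i == j :> nat) = false) ?mulr0//; apply/negbTE; rewrite eq_sym; exact: ji.
rewrite (dotL2Bl mO Lv LS Lr) (dotL2Br mO Lv LS Lv) (dotL2Br mO Lv LS LS).
rewrite vS SS dotL2C vS; ring.
Qed.

Variables (Lambda : nat -> R) (U : nat -> 'rV[R]_d -> R).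
Hypothesis hspec : biharmonic_spectrum Omega Lambda U.

Lemma eigenfunction_L2 j : L2 (U j).
Proof. by have [_ _ []] := hspec. Qed.

Lemma eigenfunction_H20 j : H20 Omega (U j).
Proof. by have [_ /(_ j)[]] := hspec. Qed.

Lemma dotL2_laplacian_eigenfunction u j : H20 Omega u ->
  dot (lap u) (lap (U j)) = Lambda j * dot u (U j).
Proof.
move=> Hu; have [_ /(_ j)[_ _ H] _] := hspec.
by rewrite dotL2C H// dotL2C.
Qed.

(** With c_j = <u, U_j>, z |u|^2 - |Delta u|^2 equals the sum of (z - Lambda_j) c_j^2 over j < n,
    plus z times the squared remainder of u, minus the squared remainder of Delta u. The last one is
    dropped, z is replaced by |z| and z - Lambda_j by its positive part. *)
Lemma spectral_inequality_trunc u (z : R) (n : nat) : H20 Omega u ->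
  z * dot u u - dot (lap u) (lap u) <=
  \sum_(j < n) Num.max (z - Lambda j) 0 * dot u (U j) ^+ 2 +
  `|z| * normLp 2%:E Omega (fun x => u x - \sum_(j < n) dot u (U j) * U j x) ^+ 2.
Proof.
move=> Hu; have Lu := H2_L2 (H20_H2 Hu).
have LU := eigenfunction_L2.
have [_ _ [_ orth _]] := hspec.
have := @dotL2_sub_projection U (fun=> 1) (fun j => dot u (U j)) u LU Lu.
move=> /(_ (fun i j => etrans (orth i j) (esym (mul1r _))) (fun j => esym (mul1r _)) n) E1.
have LlU j : L2 (lap (U j)) by apply: H2_laplacian_L2 => //;
  exact: H20_H2 (eigenfunction_H20 j).
have Llu : L2 (lap u) by apply: H2_laplacian_L2 => //; exact: H20_H2.
have := @dotL2_sub_projection (fun j => lap (U j)) Lambda (fun j =>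
  dot u (U j)) (lap u) LlU Llu.
move=> /(_ _ (fun j => dotL2_laplacian_eigenfunction j Hu) n) E2.
have {}E2 : dot (fun x => lap u x - \sum_(j < n) dot u (U j) * lap (U j) x)
    (fun x => lap u x - \sum_(j < n) dot u (U j) * lap (U j) x) =
    dot (lap u) (lap u) - \sum_(j < n) Lambda j * dot u (U j) ^+ 2.
  apply: E2 => i j; rewrite (dotL2_laplacian_eigenfunction j (eigenfunction_H20 i)) orth.
  by case: eqP => [->//|_]; rewrite !mulr0.
have E2' := dotL2_ge0 Omega (fun x => lap u x - \sum_(j < n) dot u (U j) * lap (U j) x).
rewrite E2 in E2'.
have sum1 : \sum_(j < n) 1 * dot u (U j) ^+ 2 = \sum_(j < n) dot u (U j) ^+ 2.
  by apply: eq_bigr => j _; rewrite mul1r.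
rewrite sum1 in E1; rewrite sqr_normL2 E1.
set N := dot u u in E1 *; set L := dot (lap u) (lap u) in E2' *.
have h : \sum_(j < n) (z - Lambda j) * dot u (U j) ^+ 2 <=
    \sum_(j < n) Num.max (z - Lambda j) 0 * dot u (U j) ^+ 2.
  by apply: ler_sum => j _; rewrite ler_wpM2r ?sqr_ge0// le_max lexx.
have := dotL2_ge0 Omega (fun x => u x - \sum_(j < n) dot u (U j) * U j x).
rewrite E1.
have hs : \sum_(j < n) (z - Lambda j) * dot u (U j) ^+ 2 =
   z * (\sum_(j < n) dot u (U j) ^+ 2) - \sum_(j < n) Lambda j * dot u (U j) ^+ 2.
  by rewrite mulr_sumr -sumrB; apply: eq_bigr => j _; rewrite mulrBl.
rewrite hs in h.
move: E2' h; move: (\sum_(j < n) Lambda j * _) (\sum_(j < n) Num.max _ _ * _) (\sum_(j < n) _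
  ^+ 2).
clear => a b s h1 h2 h3.
have : z * (N - s) <= `|z| * (N - s) by rewrite ler_wpM2r// ler_norm.
by rewrite mulrBr => h4; lra.
Qed.

Lemma spectral_inequality u (z : R) : H20 Omega u ->
  ((z * dot u u - dot (lap u) (lap u))%:E <=
  \sum_(0 <= j <oo) (Num.max (z - Lambda j) 0 * dot u (U j) ^+ 2)%:E)%E.
Proof.
move=> Hu; have Lu := H2_L2 (H20_H2 Hu).
have [_ _ [_ _ /(_ u Lu) complete]] := hspec.
apply/lee_addgt0Pr => e e0.
(* The remainder enters squared and multiplied by |z|; the summand 1 covers z = 0. *)
have e'0 : 0 < Num.sqrt (e / (1 + `|z|)) by rewrite sqrtr_gt0 divr_gt0// ltr_pwDl.
have /cvgrPdist_lt/(_ _ e'0)[n _ /(_ n (leqnn n))/=] := complete.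
rewrite sub0r normrN ger0_norm ?normLp_ge0// => hn.
have hn2 : `|z| * normLp 2%:E Omega (fun x => u x - \sum_(j < n) dot u (U j) * U j x) ^+ 2 <= e.
  apply: (@le_trans _ _ (`|z| * (e / (1 + `|z|)))).
    rewrite ler_wpM2l// -[leRHS]sqr_sqrtr; last by rewrite divr_ge0 ?addr_ge0// ltW.
    by rewrite ler_pXn2r ?nnegrE ?normLp_ge0 ?sqrtr_ge0// ltW.
  rewrite mulrA ler_pdivrMr ?ltr_pwDl// mulrC ler_pM2l//.
  by rewrite lerDr.
have h := spectral_inequality_trunc z n Hu.
have hE : ((z * dot u u - dot (lap u) (lap u))%:E <=
   (\sum_(j < n) Num.max (z - Lambda j) 0 * dot u (U j) ^+ 2)%:E + e%:E)%E.
  by rewrite -EFinD lee_fin; apply: le_trans h _; rewrite lerD2l.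
apply: le_trans hE _; rewrite leeD2r//.
rewrite -sumEFin -(big_mkord xpredT (fun j =>
  (Num.max (z - Lambda j) 0 * dot u (U j) ^+ 2)%:E)).
apply: nneseries_lim_ge => k _; rewrite lee_fin mulr_ge0 ?sqr_ge0//.
by rewrite le_max lexx orbT.
Qed.

End spectral_inequality.

(** * Fourier integrals *)

Section poisson_kernel_1d.
Context {R : realType}.
Variable e : R.
Hypothesis e0 : 0 < e.
Local Notation leb := (@lebesgue_measure R).

Definition abel (s : R) : R := expR (- (e * `|s|)).

Lemma abel_ge0 s : 0 <= abel s. Proof. exact: expR_ge0. Qed.

Lemma continuous_abel : continuous abel.
Proof.
move=> x; apply: (@continuous_comp _ _ _ (fun s : R => - (e * `|s|)) expR);
  last exact: continuous_expR.
apply: continuousN; apply: (@continuousM _ _ (fun=> e) Num.norm); first exact: cst_continuous.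
exact: norm_continuous.
Qed.

Let D t : R := e ^+ 2 + t ^+ 2.
Let D0 t : 0 < D t. Proof. by rewrite /D ltr_pwDl ?exprn_gt0// sqr_ge0. Qed.

(** Primitive of exp(- e s) (1 + cos(t s)). Adding 1 to the cosine makes the integrand nonnegative,
    as the fundamental theorem on a half-line requires here. *)
Let F t (s : R) : R :=
  - expR (- (e * s)) * (e^-1 + (e * cos (t * s) - t * sin (t * s)) / D t).

Lemma is_derive_abel_primitive t s :
  is_derive s (1 : R) (F t) (expR (- (e * s)) * (1 + cos (t * s))).
Proof.
have dl (k : R) : is_derive s (1 : R) (fun s => k * s) k.
  by have := @is_deriveZ _ _ _ id k s 1 1 (is_derive_id s (1 : R)); rewrite [_ *: _]mulr1.
have dexp : is_derive s (1 : R) (fun s => expR (- e * s)) (expR (- e * s) * - e).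
  exact: is_derive1_comp (is_derive_expR _) (dl (- e)).
have dcos : is_derive s (1 : R) (fun s => cos (t * s)) (- sin (t * s) * t).
  exact: is_derive1_comp (is_derive_cos _) (dl t).
have dsin : is_derive s (1 : R) (fun s => sin (t * s)) (cos (t * s) * t).
  exact: is_derive1_comp (is_derive_sin _) (dl t).
have d1 : is_derive s (1 : R) (fun s => e * cos (t * s)) (e * (- sin (t * s) * t)).
  exact: (is_deriveZ e dcos).
have d2 : is_derive s (1 : R) (fun s => t * sin (t * s)) (t * (cos (t * s) * t)).
  exact: (is_deriveZ t dsin).
have d3 : is_derive s (1 : R) (fun s => e * cos (t * s) - t * sin (t * s))
    (e * (- sin (t * s) * t) - t * (cos (t * s) * t)).
  exact: (is_deriveB d1 d2).
have d4 : is_derive s (1 : R) (fun s => (D t)^-1 * (e * cos (t * s) - t * sin (t * s)))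
    ((D t)^-1 * (e * (- sin (t * s) * t) - t * (cos (t * s) * t))).
  exact: (is_deriveZ (D t)^-1 d3).
have d5 : is_derive s (1 : R) (fun s => e^-1 + (D t)^-1 * (e * cos (t * s) - t * sin (t * s)))
    (0 + (D t)^-1 * (e * (- sin (t * s) * t) - t * (cos (t * s) * t))).
  exact: (is_deriveD (is_derive_cst (e^-1 : R) s (1 : R)) d4).
have d6 : is_derive s (1 : R) (fun s => - expR (- e * s)) (- (expR (- e * s) * - e)).
  exact: (is_deriveN dexp).
have d7 : is_derive s (1 : R) (fun s => - expR (- e * s) *
     (e^-1 + (D t)^-1 * (e * cos (t * s) - t * sin (t * s))))
   (- expR (- e * s) * (0 + (D t)^-1 * (e * (- sin (t * s) * t) - t * (cos (t * s) * t))) +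
    (e^-1 + (D t)^-1 * (e * cos (t * s) - t * sin (t * s))) * (- (expR (- e * s) * - e))).
  exact: (is_deriveM d6 d5).
have E1 : F t = (fun s => - expR (- e * s) *
     (e^-1 + (D t)^-1 * (e * cos (t * s) - t * sin (t * s)))).
  by apply/funext => x; rewrite /F -mulNr [_ / D t]mulrC.
rewrite E1; apply: (is_derive_eq d7).
rewrite (_ : - (e * s) = - e * s); last by rewrite mulNr.
have := D0 t; rewrite /D => Dp.
by field; rewrite !gt_eqF.
Qed.

Lemma cvg_expR_Ny : expR (- (e * s)) @[s --> +oo] --> (0 : R).
Proof.
have H := @cvgr_expR R; apply: (cvg_comp (fun s => e * s) (fun s => expR (- s)) _ H).
exact: gt0_cvgMry.
Qed.

Lemma integral0y_abel_cos t :
  (\int[leb]_(s in `[0%R, +oo[) (abel s * (1 + cos (t * s)))%:E = (e^-1 + e / D t)%:E)%E.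
Proof.
have c1 : continuous (fun s => expR (- (e * s)) * (1 + cos (t * s))).
  move=> s; apply: (@continuousM _ _ (fun s => expR (- (e * s))) (fun s => 1 + cos (t * s))).
    apply: (@continuous_comp _ _ _ (fun s => - (e * s)) expR); last exact: continuous_expR.
    by apply: continuousN; apply: mulrl_continuous.
  apply: (@continuousD _ _ _ (fun=> (1 : R)) (fun s : R => cos (t * s)));
    first exact: cst_continuous.
  apply: (@continuous_comp _ _ _ (fun s => t * s) cos); last exact: continuous_cos.
  exact: mulrl_continuous.
have E : (\int[leb]_(s in `[0%R, +oo[) (abel s * (1 + cos (t * s)))%:E =
   \int[leb]_(s in `[0%R, +oo[) (expR (- (e * s)) * (1 + cos (t * s)))%:E)%E.
  apply: eq_integral => s /set_mem; rewrite /= in_itv/= andbT => s0.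
  by rewrite /abel ger0_norm.
rewrite E (@ge0_continuous_FTC2y _ _ (F t) 0 0).
- rewrite /F !mulr0 oppr0 expR0 cos0 sin0 mulr0 subr0 mulr1 -EFinB; congr (_%:E); ring.
- by move=> s _; rewrite mulr_ge0 ?expR_ge0// -lerBlDl sub0r cos_geN1.
- exact: continuous_subspaceT.
- apply: (@squeeze_cvgr _ _ _ _ (fun s => - (expR (- (e * s)) * (e^-1 + (e + `|t|) / D t)))
     (fun s => expR (- (e * s)) * (e^-1 + (e + `|t|) / D t))).
  + apply: nearW => s; rewrite -ler_norml /F normrM normrN (ger0_norm (expR_ge0 _)).
    rewrite ler_wpM2l ?expR_ge0// (le_trans (ler_normD _ _))//.
    rewrite ger0_norm ?invr_ge0 ?(ltW e0)// lerD2l normrM.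
    rewrite [`|(D t)^-1|]ger0_norm ?invr_ge0 ?(ltW (D0 t))//.
    rewrite ler_wpM2r ?invr_ge0 ?(ltW (D0 t))//.
    rewrite (le_trans (ler_normB _ _))// !normrM (gtr0_norm e0).
    by rewrite lerD// ler_piMr ?(ltW e0) ?cos_max ?sin_max.
  + rewrite -[X in _ --> X]oppr0 -[X in _ --> - X](mul0r (e^-1 + (e + `|t|) / D t)).
    by apply: cvgN; apply: cvgMl; exact: cvg_expR_Ny.
  + rewrite -[X in _ --> X](mul0r (e^-1 + (e + `|t|) / D t)).
    by apply: cvgMl; exact: cvg_expR_Ny.
- by move=> s _; have [] := is_derive_abel_primitive t s.
- apply: cvg_at_right_filter; apply: differentiable_continuous.
  by apply/derivable1_diffP; have [] := is_derive_abel_primitive t 0.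
- by move=> s _; rewrite derive1E; have [_ ->] := is_derive_abel_primitive t s.
Qed.

Lemma integral_abel_1cos t :
  (\int[leb]_s (abel s * (1 + cos (t * s)))%:E = (2 / e + 2 * e / D t)%:E)%E.
Proof.
rewrite ge0_symfun_integralT.
- rewrite (_ : [set x | _] = `[0, +oo[%classic); last first.
    by apply/seteqP; split => x/=; rewrite in_itv/= andbT.
  by rewrite integral0y_abel_cos -EFinM mulrDr mulrA.
- by move=> s; rewrite mulr_ge0 ?abel_ge0// -lerBlDl sub0r cos_geN1.
- move=> s; apply: (@continuousM _ _ abel (fun s => 1 + cos (t * s)));
  first exact: continuous_abel.
  apply: (@continuousD _ _ _ (fun=> (1 : R)) (fun s : R => cos (t * s)));
    first exact: cst_continuous.
  apply: (@continuous_comp _ _ _ (fun s => t * s) cos); last exact: continuous_cos.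
  exact: mulrl_continuous.
- by move=> s /=; rewrite /abel normrN mulrN cosN.
Qed.

Lemma measurable_abel : measurable_fun [set: measurableTypeR R] abel.
Proof. by apply: continuous_measurable_fun; exact: continuous_abel. Qed.

Lemma integral_abel : (\int[leb]_s (abel s)%:E = (2 / e)%:E)%E.
Proof.
(* At t = 0 the integrand is twice the weight. *)
have := integral_abel_1cos 0.
under eq_integral do rewrite mul0r cos0 mulrC EFinM.
rewrite ge0_integralZl//; last 2 first.
- by apply/measurable_EFinP; exact: measurable_abel.
- by move=> x _; rewrite lee_fin abel_ge0.
have -> : (2 / e + 2 * e / D 0)%:E = ((1 + 1)%:E * (2 / e)%:E)%E.
  rewrite -EFinM; congr (_%:E); rewrite /D expr0n addr0.
  by field; rewrite gt_eqF.
move=> /(congr1 (fun x => (2^-1)%:E * x)%E); rewrite !muleA -!EFinM mulVf//.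
by rewrite mul1r mul1e.
Qed.

Lemma integrable_abel : leb.-integrable setT (EFin \o abel).
Proof.
apply/integrableP; split; first by apply/measurable_EFinP; exact: measurable_abel.
under eq_integral do rewrite /= ger0_norm ?abel_ge0//.
by rewrite integral_abel ltry.
Qed.

Lemma measurable_cosM t : measurable_fun [set: measurableTypeR R] (fun s : R => cos (t * s)).
Proof.
apply: continuous_measurable_fun => s.
apply: (@continuous_comp _ _ _ (fun s => t * s) cos); last exact: continuous_cos.
exact: mulrl_continuous.
Qed.

(** The mass 2 / e of the weight is subtracted from [integral_abel_1cos]. *)
Lemma Rintegral_abel_cos t :
  \int[leb]_s (abel s * cos (t * s)) = 2 * e / D t.
Proof.
have I1 : leb.-integrable setT (EFin \o (fun s => abel s * cos (t * s))).
  apply: (le_integrable _ _ _ integrable_abel) => //.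
    by apply/measurable_EFinP; apply: measurable_funM;
      [exact: measurable_abel|exact: measurable_cosM].
  by move=> s _; rewrite /= lee_fin normrM ler_piMr ?cos_max.
have := congr1 fine (integral_abel_1cos t); rewrite -[LHS]/(Rintegral _ _ _) /=.
under eq_Rintegral do rewrite mulrDr mulr1.
rewrite RintegralD//; last exact: integrable_abel.
rewrite {1}/Rintegral integral_abel /=; exact: addrI.
Qed.

Lemma integral_cauchy : (\int[leb]_s ((1 + s ^+ 2)^-1)%:E = pi%:E)%E.
Proof.
rewrite ge0_symfun_integralT.
- rewrite (_ : [set x | _] = `[0, +oo[%classic); last first.
    by apply/seteqP; split => x/=; rewrite in_itv/= andbT.
  by have := @integral0y_oneDsqr R; rewrite /oneDsqr => ->; rewrite -EFinM mulrC divfK.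
- by move=> s; rewrite invr_ge0 addr_ge0 ?sqr_ge0.
- exact: continuous_oneDsqrV.
- by move=> s /=; rewrite sqrrN.
Qed.

End poisson_kernel_1d.

(** * The Abel weight and the Poisson kernel in R^n *)

Section poisson_kernel.
Context {R : realType}.
Variable e : R.
Hypothesis e0 : 0 < e.
Local Notation leb := (@lebesgue_measure R).
Local Notation mu n := (@lebesgue_rV R n).

(* [aweight] is an Abel weight that makes the frequency integral absolutely
   convergent; its Fourier transform is the Poisson kernel [pkernel]. *)
Definition aweight n (xi : 'rV[R]_n) : R := \prod_i abel e (xi ord0 i).

Definition pkernel n (t : 'rV[R]_n) : R := \prod_i (2 * e / (e ^+ 2 + (t ord0 i) ^+ 2)).

Lemma aweight_ge0 n (xi : 'rV[R]_n) : 0 <= aweight xi.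
Proof. by apply: prodr_ge0 => i _; exact: abel_ge0. Qed.

Lemma pkernel_ge0 n (t : 'rV[R]_n) : 0 <= pkernel t.
Proof.
apply: prodr_ge0 => i _.
by rewrite divr_ge0// ?mulr_ge0 ?addr_ge0 ?sqr_ge0// ltW.
Qed.

Lemma measurable_prodr d (T : measurableType d) (I : Type) (s : seq I)
    (h : I -> T -> R) : (forall i, measurable_fun [set: T] (h i)) ->
  measurable_fun [set: T] (fun x => \prod_(i <- s) h i x).
Proof.
move=> mh; elim: s => [|i s IH].
  by under eq_fun do rewrite big_nil; exact: measurable_cst.
by under eq_fun do rewrite big_cons; exact: measurable_funM.
Qed.

Lemma measurable_aweight n : measurable_fun [set: 'rV[R]_n] (@aweight n).
Proof.
apply: measurable_prodr => i.
exact: (measurableT_comp (measurable_abel e) (measurable_coord_rV i)).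
Qed.

Lemma integrable_aweight n : (mu n).-integrable setT (EFin \o @aweight n).
Proof.
apply/integrableP; split; first by apply/measurable_EFinP; exact: measurable_aweight.
under eq_integral do rewrite /= ger0_norm ?aweight_ge0// /aweight -prodEFin.
rewrite (@ge0_integral_rV_prod _ _ (fun=> EFin \o abel e)).
- rewrite (eq_bigr (fun=> (2 / e)%:E)); last by move=> i _; exact: integral_abel.
  by rewrite prodEFin ltry.
- by move=> i; apply/measurable_EFinP; exact: measurable_abel.
- by move=> i x; rewrite lee_fin abel_ge0.
Qed.

Lemma measurable_rdot d (T : measurableType d) n (f g : T -> 'rV[R]_n) :
  measurable_fun [set: T] f -> measurable_fun [set: T] g ->
  measurable_fun [set: T] (fun x => rdot (f x) (g x)).
Proof.
move=> mf mg; apply: measurable_sum => i; apply: measurable_funM.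
  exact: measurableT_comp (measurable_coord_rV i) mf.
exact: measurableT_comp (measurable_coord_rV i) mg.
Qed.

Lemma measurable_cos_rV d (T : measurableType d) (f : T -> R) :
  measurable_fun [set: T] f -> measurable_fun [set: T] (fun x => cos (f x)).
Proof.
move=> mf; apply: (measurableT_comp _ mf).
apply: continuous_measurable_fun; exact: continuous_cos.
Qed.

Lemma measurable_sin_rV d (T : measurableType d) (f : T -> R) :
  measurable_fun [set: T] f -> measurable_fun [set: T] (fun x => sin (f x)).
Proof.
move=> mf; apply: (measurableT_comp _ mf).
apply: continuous_measurable_fun; exact: continuous_sin.
Qed.

Lemma integrable_aweightM n (h : 'rV[R]_n -> R) : measurable_fun setT h ->
  (forall x, `|h x| <= 1) ->
  (mu n).-integrable setT (EFin \o (fun x => aweight x * h x)).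
Proof.
move=> mh h1; apply: (le_integrable _ _ _ (integrable_aweight n)) => //.
  by apply/measurable_EFinP; apply: measurable_funM => //; exact: measurable_aweight.
by move=> x _; rewrite /= lee_fin normrM ler_piMr.
Qed.

(** The weight is even and the sine is odd, so the reflection xi -> - xi changes the sign of the
    integral. *)
Lemma Rintegral_aweight_sin n (t : 'rV[R]_n) :
  \int[mu n]_xi (aweight xi * sin (rdot xi t)) = 0.
Proof.
have I1 : (mu n).-integrable setT (EFin \o (fun xi => aweight xi * sin (rdot xi t))).
  apply: integrable_aweightM; last by move=> x; exact: sin_max.
  by apply: measurable_sin_rV; apply: measurable_rdot => //; exact: measurable_cst.
have := @integral_affine_rV R n (fun=> -1) 1%g (fun=> 0) _ (fun=> normrN1 _) I1.
have E x : affine_rV (fun=> -1) 1%g (fun=> 0) x = - x :> 'rV[R]_n.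
  by apply/rowP => i; rewrite !mxE perm1 mulN1r addr0.
under eq_Rintegral => x _.
  rewrite E.
  have -> : aweight (- x) = aweight x.
    by apply: eq_bigr => i _; rewrite mxE /abel normrN.
  have -> : rdot (- x) t = - rdot x t.
    by rewrite /rdot -sumrN; apply: eq_bigr => i _; rewrite mxE mulNr.
  rewrite sinN mulrN -mulN1r.
  over.
rewrite RintegralZl// => h; lra.
Qed.

Lemma integral_rVS n (f : 'rV[R]_n.+1 -> R) :
  (mu n.+1).-integrable setT (EFin \o f) ->
  (\int[mu n.+1]_x (f x)%:E =
   \int[leb]_a \int[mu n]_v (f (cons_rV (a, v)))%:E)%E.
Proof.
move=> If.
have mc := @measurable_cons_rV R n.
have mf : measurable_fun [set: 'rV[R]_n.+1] (EFin \o f) by exact: measurable_int If.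
have If' : (leb \x mu n)%E.-integrable (@cons_rV R n @^-1` setT) ((EFin \o f) \o @cons_rV R n).
  rewrite preimage_setT; apply/integrableP; split; first exact: measurableT_comp.
  move/integrableP : If => [_]; apply: le_lt_trans.
  rewrite [leRHS]/= /lebesgue_step (ge0_integral_pushforward mc)//.
  apply/measurable_EFinP; apply: measurableT_comp => //; exact/measurable_EFinP.
rewrite preimage_setT in If'.
transitivity (\int[(leb \x mu n)%E]_z ((EFin \o f) \o @cons_rV R n) z)%E.
  rewrite [LHS]/= /lebesgue_step (integral_pushforward mc)// ?preimage_setT//.
by rewrite -integral12_prod_meas1.
Qed.

(** Induction on the dimension: the first coordinate is split off by the addition formula for the
    cosine, and the term with sines vanishes by [Rintegral_aweight_sin]. *)
Lemma Rintegral_aweight_cos n (t : 'rV[R]_n) :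
  \int[mu n]_xi (aweight xi * cos (rdot xi t)) = pkernel t.
Proof.
elim: n t => [|n IH] t.
  rewrite /pkernel big_ord0.
  under eq_Rintegral do rewrite /aweight /rdot !big_ord0 cos0 mul1r.
  rewrite Rintegral_cst//; transitivity (1 * fine (mu 0%N setT)); first by [].
  by rewrite [mu 0%N setT]diracE mem_set// mulr1.
have I1 : (mu n.+1).-integrable setT (EFin \o (fun xi => aweight xi * cos (rdot xi t))).
  apply: integrable_aweightM; last by move=> x; exact: cos_max.
  by apply: measurable_cos_rV; apply: measurable_rdot => //; exact: measurable_cst.
pose t' : 'rV[R]_n := \row_j t ord0 (lift ord0 j).
rewrite /Rintegral (integral_rVS I1).
have inner a : (\int[mu n]_v (aweight (cons_rV (a, v)) * cos (rdot (cons_rV (a, v)) t))%:E =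
    (abel e a * cos (t ord0 ord0 * a) * pkernel t')%:E)%E.
  have E v : aweight (cons_rV (a, v)) * cos (rdot (cons_rV (a, v)) t) =
     abel e a * cos (t ord0 ord0 * a) * (aweight v * cos (rdot v t'))
     - abel e a * sin (t ord0 ord0 * a) * (aweight v * sin (rdot v t')).
    have -> : aweight (cons_rV (a, v)) = abel e a * aweight v.
      rewrite /aweight big_ord_recl mxE unlift_none; congr (_ * _).
      by apply: eq_bigr => i _; rewrite mxE liftK.
    have -> : rdot (cons_rV (a, v)) t = t ord0 ord0 * a + rdot v t'.
      rewrite /rdot big_ord_recl mxE unlift_none mulrC; congr (_ + _).
      by apply: eq_bigr => i _; rewrite !mxE liftK.
    by rewrite cosD; ring.
  have Ic : (mu n).-integrable setT (EFin \o (fun v => aweight v * cos (rdot v t'))).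
    apply: integrable_aweightM; last by move=> x; exact: cos_max.
    by apply: measurable_cos_rV; apply: measurable_rdot => //; exact: measurable_cst.
  have Is : (mu n).-integrable setT (EFin \o (fun v => aweight v * sin (rdot v t'))).
    apply: integrable_aweightM; last by move=> x; exact: sin_max.
    by apply: measurable_sin_rV; apply: measurable_rdot => //; exact: measurable_cst.
  under eq_integral do rewrite E.
  rewrite -[LHS]fineK; last first.
    apply: integrable_fin_num => //.
    exact: (integrable_EFinB _ (integrable_EFinZl _ _ Ic) (integrable_EFinZl _ _ Is)).
  congr (_%:E); rewrite -[LHS]/(Rintegral _ _ _).
  rewrite RintegralB//; [|exact: integrable_EFinZl..].
  by rewrite !RintegralZl// IH Rintegral_aweight_sin mulr0 subr0.
under eq_integral do rewrite inner.
rewrite -[LHS]/(Rintegral _ _ _).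
have Ia : leb.-integrable setT (EFin \o (fun s => abel e s * cos (t ord0 ord0 * s))).
  apply: (le_integrable _ _ _ (integrable_abel e0)) => //.
    by apply/measurable_EFinP; apply: measurable_funM;
      [exact: measurable_abel|exact: measurable_cosM].
  by move=> s _; rewrite /= lee_fin normrM ler_piMr ?cos_max.
rewrite RintegralZr// Rintegral_abel_cos// /pkernel big_ord_recl; congr (_ * _).
by apply: eq_bigr => i _; rewrite mxE.
Qed.

Lemma measurable_pkernel n : measurable_fun [set: 'rV[R]_n] (@pkernel n).
Proof.
apply: measurable_prodr => i.
apply: (@measurableT_comp _ _ _ _ _ _ (fun s : R => 2 * e / (e ^+ 2 + s ^+ 2)));
  last exact: measurable_coord_rV.
apply: continuous_measurable_fun => s.
apply: (@continuousM _ _ (fun=> 2 * e) (fun s : R => (e ^+ 2 + s ^+ 2)^-1)).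
  exact: cst_continuous.
apply: continuousV; first by rewrite gt_eqF// ltr_pwDl ?exprn_gt0// sqr_ge0.
apply: (@continuousD _ _ _ (fun=> e ^+ 2) (fun s : R => s ^+ 2)); first exact: cst_continuous.
exact: exprn_continuous.
Qed.

(** The substitution (y - x) / e turns the kernel into a product of functions 1 / (1 + s^2). The
    factors (2 / e)^n, e^n and pi^n multiply to a mass independent of e and x. *)
Lemma integral_pkernel n (x : 'rV[R]_n) :
  (\int[mu n]_y (pkernel (x - y))%:E = ((2 * pi) ^+ n)%:E)%E.
Proof.
pose H (y : 'rV[R]_n) : \bar R := (\prod_i ((1 + (y ord0 i) ^+ 2)^-1)%:E)%E.
have mH1 : measurable_fun [set: measurableTypeR R] (fun s : R => ((1 + s ^+ 2)^-1)%:E).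
  by apply/measurable_EFinP; apply: continuous_measurable_fun; exact: continuous_oneDsqrV.
have H10 (s : R) : (0 <= ((1 + s ^+ 2)^-1)%:E)%E by rewrite lee_fin invr_ge0 addr_ge0 ?sqr_ge0.
have mH : measurable_fun [set: 'rV[R]_n] H.
  apply: emeasurable_prod => i.
  exact: (measurableT_comp mH1 (measurable_coord_rV i)).
have H0 y : (0 <= H y)%E by apply: prode_ge0.
have IH : (\int[mu n]_y H y = (pi ^+ n)%:E)%E.
  rewrite (@ge0_integral_rV_prod _ _ (fun=> fun s => ((1 + s ^+ 2)^-1)%:E))//.
  rewrite (eq_bigr (fun=> pi%:E)); last by move=> i _; exact: integral_cauchy.
  by rewrite prodEFin prodr_const card_ord.
have ei0 (i : 'I_n) : e^-1 != 0 by rewrite invr_neq0// gt_eqF.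
have := ge0_integral_affine_rV 1%g (fun i => - x ord0 i / e) ei0 mH H0.
rewrite IH.
have E y : (pkernel (x - y))%:E = (((2 / e) ^+ n)%:E *
    H (affine_rV (fun=> (e^-1)%R) 1%g (fun i => (- x ord0 i / e)%R) y))%E.
  rewrite /H prodEFin -EFinM; congr (_%:E).
  have pw (a : R) : a ^+ n = \prod_(i < n) a by rewrite prodr_const card_ord.
  rewrite pw -big_split/=; apply: eq_bigr => i _; rewrite !mxE perm1.
  have De : e ^+ 2 + (x ord0 i - y ord0 i) ^+ 2 != 0.
    by rewrite gt_eqF// ltr_pwDl ?exprn_gt0// sqr_ge0.
  have De' : 1 + (e^-1 * y ord0 i + - x ord0 i / e) ^+ 2 != 0.
    by rewrite gt_eqF// ltr_pwDl// sqr_ge0.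
  have -> : 1 + (e^-1 * y ord0 i + - x ord0 i / e) ^+ 2 =
     (e ^+ 2 + (x ord0 i - y ord0 i) ^+ 2) / e ^+ 2.
    by field; rewrite gt_eqF.
  by field; rewrite De gt_eqF.
move=> h; under eq_integral do rewrite E.
rewrite ge0_integralZl//; last 2 first.
- by apply: (measurableT_comp mH); exact: measurable_affine_rV.
- by rewrite lee_fin exprn_ge0// divr_ge0// ltW.
rewrite h -!EFinM; congr (_%:E).
rewrite prodr_const card_ord normfV invrK (gtr0_norm e0) mulrA -exprMn divfK ?gt_eqF//.
by rewrite -exprMn.
Qed.

End poisson_kernel.

(* The canonical sigma-finite structure found for [m1 \x m2] is the one of
   products of subprobabilities; the alias makes room for the general one. *)
Section sigma_prod.
Context d1 d2 (T1 : measurableType d1) (T2 : measurableType d2) (R : realType).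
Variable m1 : {sigma_finite_measure set T1 -> \bar R}.
Variable m2 : {sigma_finite_measure set T2 -> \bar R}.

Definition sigma_prod : set (T1 * T2) -> \bar R := (m1 \x m2)%E.

HB.instance Definition _ := Measure.on sigma_prod.

Let sigma_prod_sigma_finite : sigma_finite setT sigma_prod.
Proof.
have [F TF Foo] := sigma_finiteT m1.
have [G TG Goo] := sigma_finiteT m2.
have [h hb] : {h : nat -> nat * nat | forall p, exists k, h k = p}.
  exists (fun k => odflt (0%N, 0%N) (unpickle k)) => p.
  by exists (pickle p); rewrite pickleK.
exists (fun k => F (h k).1 `*` G (h k).2).
  apply/seteqP; split=> // -[x y] _.
  have [i _ Fi] : (\bigcup_i F i) x by rewrite -TF.
  have [j _ Gj] : (\bigcup_i G i) y by rewrite -TG.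
  by have [k hk] := hb (i, j); exists k => //; rewrite hk.
move=> k; have [mF Fk] := Foo (h k).1; have [mG Gk] := Goo (h k).2.
split; first exact: measurableX.
by rewrite /sigma_prod product_measure1E// lte_mul_pinfty// ge0_fin_numE.
Qed.

HB.instance Definition _ := Measure_isSigmaFinite.Build _ _ _ sigma_prod
  sigma_prod_sigma_finite.

End sigma_prod.

(** * Tensor products of integrable functions *)

Section tensor.
Context d1 d2 (T1 : measurableType d1) (T2 : measurableType d2) (R : realType).
Variable m1 : {sigma_finite_measure set T1 -> \bar R}.
Variable m2 : {sigma_finite_measure set T2 -> \bar R}.
Variables (g : T1 -> R) (h : T2 -> R).

Lemma measurable_tensor : measurable_fun setT g -> measurable_fun setT h ->
  measurable_fun [set: T1 * T2] (fun z => g z.1 * h z.2).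
Proof.
move=> mg mh; apply: measurable_funM.
  exact: measurableT_comp mg measurable_fst.
exact: measurableT_comp mh measurable_snd.
Qed.

Hypotheses (Ig : m1.-integrable setT (EFin \o g))
  (Ih : m2.-integrable setT (EFin \o h)).

Lemma integrable_tensor :
  (m1 \x m2)%E.-integrable setT (EFin \o (fun z => g z.1 * h z.2)).
Proof.
have mg : measurable_fun setT g by apply/measurable_EFinP; exact: measurable_int Ig.
have mh : measurable_fun setT h by apply/measurable_EFinP; exact: measurable_int Ih.
have mgh : measurable_fun setT (EFin \o (fun z => g z.1 * h z.2)).
  by apply/measurable_EFinP; exact: measurable_tensor.
apply/(integrable12ltyP m1 m2 mgh).
have mae : measurable_fun setT (fun y => `|(h y)%:E|%E).
  by apply: measurableT_comp => //; exact/measurable_EFinP.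
have mag : measurable_fun setT (fun y => `|(g y)%:E|%E).
  by apply: measurableT_comp => //; exact/measurable_EFinP.
under eq_integral => x _.
  under eq_integral => y _ do rewrite /= normrM EFinM.
  rewrite ge0_integralZl//.
  over.
rewrite ge0_integralZr//; last by apply: integral_ge0.
by rewrite lte_mul_pinfty ?integral_ge0//; [apply: integrable_fin_num => //;
  exact: integrable_abse Ig|move/integrableP : Ih => []].
Qed.

Lemma Rintegral_tensor :
  \int[(m1 \x m2)%E]_z (g z.1 * h z.2) = (\int[m1]_x g x) * (\int[m2]_y h y).
Proof.
rewrite /Rintegral -[in LHS](integral12_prod_meas1 integrable_tensor).
have E x : (\int[m2]_y ((g x * h y)%:E) = ((\int[m2]_y h y)%R * g x)%:E)%E.
  under eq_integral do rewrite EFinM.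
  rewrite integralZl// EFinM muleC fineK//; exact: integrable_fin_num.
have F x : (fubini_F m2 (EFin \o (fun z =>
  (g z.1 * h z.2)%R)) x = (\int[m2]_y h y)%:E * (g x)%:E)%E.
  by rewrite -EFinM -E.
rewrite [X in fine X](eq_integral _ _ (fun x _ => F x)).
rewrite integralZl// fineM//; last exact: integrable_fin_num.
by rewrite mulrC.
Qed.

End tensor.

(** * Bessel's inequality for the Fourier transform *)

Section plancherel.
Context {R : realType} {n : nat}.
Local Notation mu := (@lebesgue_rV R n).
Variable f : 'rV[R]_n -> R.
Hypotheses (If : mu.-integrable setT (EFin \o f))
  (If2 : mu.-integrable setT (EFin \o (fun x => f x ^+ 2))).

(** The squared modulus of the integral of f(x) exp(i xi.x), without normalization. *)
Definition spectral_power (xi : 'rV[R]_n) : R :=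
  (\int[mu]_x (f x * cos (rdot xi x))) ^+ 2 + (\int[mu]_x (f x * sin (rdot xi x))) ^+ 2.

Let mf : measurable_fun setT f.
Proof. by apply/measurable_EFinP; exact: measurable_int If. Qed.

Lemma integrable_fM (h : 'rV[R]_n -> R) : measurable_fun setT h ->
  (forall x, `|h x| <= 1) ->
  mu.-integrable setT (EFin \o (fun x => f x * h x)).
Proof.
move=> mh h1; apply: (le_integrable _ _ _ If) => //.
  by apply/measurable_EFinP; exact: measurable_funM.
by move=> x _; rewrite /= lee_fin normrM ler_piMr.
Qed.

Lemma rdotBr (xi x y : 'rV[R]_n) : rdot xi (x - y) = rdot xi x - rdot xi y.
Proof. by rewrite /rdot -sumrB; apply: eq_bigr => i _; rewrite !mxE mulrBr. Qed.

(** Two products of integrals become one double integral by cos(a - b) = cos a cos b + sin a sin b.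
    The frequency is then confined to the cosine and can be integrated out first. *)
Lemma spectral_powerE xi : spectral_power xi =
  \int[(mu \x mu)%E]_z (f z.1 * f z.2 * cos (rdot xi (z.1 - z.2))).
Proof.
have mc : measurable_fun setT (fun x => cos (rdot xi x)).
  by apply: measurable_cos_rV; apply: measurable_rdot => //; exact: measurable_cst.
have ms : measurable_fun setT (fun x => sin (rdot xi x)).
  by apply: measurable_sin_rV; apply: measurable_rdot => //; exact: measurable_cst.
have Ic := integrable_fM mc (fun x => cos_max _).
have Is := integrable_fM ms (fun x => sin_max _).
rewrite /spectral_power !expr2 -(Rintegral_tensor Ic Ic) -(Rintegral_tensor Is Is).
have I1 := integrable_tensor Ic Ic.
have I2 := integrable_tensor Is Is.
rewrite -RintegralD//.
by apply: eq_Rintegral => z _; rewrite rdotBr cosB; ring.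
Qed.

Section weight.
Variable e : R.
Hypothesis e0 : 0 < e.

Lemma measurable_rV_sub : measurable_fun setT (fun z : 'rV[R]_n * 'rV[R]_n => z.1 - z.2).
Proof.
apply: measurable_fun_rVP => i.
under eq_fun do rewrite !mxE.
apply: measurable_funB.
  exact: (measurableT_comp (measurable_coord_rV i) measurable_fst).
exact: (measurableT_comp (measurable_coord_rV i) measurable_snd).
Qed.

Let measurable_pkernel_sub :
  measurable_fun setT (fun z : 'rV[R]_n * 'rV[R]_n => pkernel e (z.1 - z.2)).
Proof.
apply: (@measurableT_comp _ _ _ _ _ _ (@pkernel R e n)); last exact: measurable_rV_sub.
exact: measurable_pkernel.
Qed.

Let P : {sigma_finite_measure set ('rV[R]_n * 'rV[R]_n)%type -> \bar R} := [the
  {sigma_finite_measure set _ -> \bar R} of sigma_prod mu mu].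

Let K (p : 'rV[R]_n * ('rV[R]_n * 'rV[R]_n)) : R :=
  aweight e p.1 * (f p.2.1 * f p.2.2) * cos (rdot p.1 (p.2.1 - p.2.2)).

(** Dominated by the tensor product of the weight with f(x) f(y); this justifies exchanging the
    frequency integral with the integrals in x and y. *)
Let IK : (mu \x P)%E.-integrable setT (EFin \o K).
Proof.
have IT2 : P.-integrable setT (EFin \o (fun z =>
  f z.1 * f z.2)) by exact: (integrable_tensor If If).
have IT := @integrable_tensor _ _ _ _ R mu P _ _ (integrable_aweight e0 n) IT2.
apply: (le_integrable _ _ _ IT) => //.
  apply/measurable_EFinP; apply: measurable_funM.
    by apply/measurable_EFinP; exact: measurable_int IT.
  apply: measurable_cos_rV; apply: measurable_rdot; first exact: measurable_fst.
  exact: (measurableT_comp measurable_rV_sub measurable_snd).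
by move=> p _; rewrite /= lee_fin normrM ler_piMr// cos_max.
Qed.

Let KE xi : (fubini_F P (EFin \o K) xi = (aweight e xi * spectral_power xi)%:E)%E.
Proof.
have I1 : (mu \x mu)%E.-integrable setT (EFin \o (fun z =>
  f z.1 * f z.2 * cos (rdot xi (z.1 - z.2)))).
  have IT := integrable_tensor If If.
  apply: (le_integrable _ _ _ IT) => //.
    apply/measurable_EFinP; apply: measurable_funM.
      by apply/measurable_EFinP; exact: measurable_int IT.
    by apply: measurable_cos_rV; apply: measurable_rdot;
      [exact: measurable_cst|exact: measurable_rV_sub].
  by move=> p _; rewrite /= lee_fin normrM ler_piMr// cos_max.
rewrite /fubini_F spectral_powerE EFinM fineK; last exact: integrable_fin_num.
rewrite -integralZl//; apply: eq_integral => z _ /=.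
by rewrite /K/= -EFinM !mulrA.
Qed.

(** Integrating in xi first gives the double integral of f(x) f(y) against the Poisson kernel. As in
    Schur's test, f(x) f(y) is at most (f(x)^2 + f(y)^2) / 2, and the kernel has mass (2 pi)^n in
    either variable. *)
Lemma integral_spectral_power_aweight :
  (\int[mu]_xi (aweight e xi * spectral_power xi)%:E <=
   ((2 * pi) ^+ n * \int[mu]_x (f x ^+ 2)%R)%:E)%E.
Proof.
under eq_integral do rewrite -KE.
rewrite (integral12_prod_meas1 IK) -(integral21_prod_meas1 IK).
have GE z : (fubini_G mu (EFin \o K) z = (f z.1 * f z.2 * pkernel e (z.1 - z.2))%:E)%E.
  have I1 : mu.-integrable setT (EFin \o (fun xi => aweight e xi * cos (rdot xi (z.1 - z.2)))).
    apply: integrable_aweightM => //; last by move=> x; exact: cos_max.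
    by apply: measurable_cos_rV; apply: measurable_rdot => //; exact: measurable_cst.
  rewrite /fubini_G -(Rintegral_aweight_cos e0) EFinM fineK; last exact: integrable_fin_num.
  rewrite -integralZl//; apply: eq_integral => xi _ /=.
  by rewrite /K/= -EFinM; congr (_%:E); ring.
under eq_integral do rewrite GE.
have mk := measurable_pkernel_sub.
have mf2 : measurable_fun setT (fun x => f x ^+ 2) by exact: measurable_funX.
have m1 : measurable_fun setT (fun z : 'rV[R]_n * 'rV[R]_n =>
  f z.1 ^+ 2 * pkernel e (z.1 - z.2)).
  by apply: measurable_funM => //; exact: (measurableT_comp mf2 measurable_fst).
have m2 : measurable_fun setT (fun z : 'rV[R]_n * 'rV[R]_n =>
  f z.2 ^+ 2 * pkernel e (z.1 - z.2)).
  by apply: measurable_funM => //; exact: (measurableT_comp mf2 measurable_snd).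
have pos1 z : 0 <= f z.1 ^+ 2 * pkernel e (z.1 - z.2).
  by rewrite mulr_ge0 ?sqr_ge0 ?pkernel_ge0.
have pos2 z : 0 <= f z.2 ^+ 2 * pkernel e (z.1 - z.2).
  by rewrite mulr_ge0 ?sqr_ge0 ?pkernel_ge0.
have pos (x y : 'rV[R]_n) : (0 <= (pkernel e (x - y))%:E)%E by rewrite lee_fin pkernel_ge0.
have mky (x : 'rV[R]_n) : measurable_fun setT (fun y : 'rV[R]_n => (pkernel e (x - y))%:E).
  apply/measurable_EFinP.
  exact: (measurableT_comp mk (pair1_measurable x)).
have f2 : ((\int[mu]_x (f x ^+ 2)%R)%:E = \int[mu]_x (f x ^+ 2)%:E)%E.
  by rewrite fineK//; exact: integrable_fin_num.
have int2 : (0 <= ((2 * pi) ^+ n : R)%:E)%E by rewrite lee_fin exprn_ge0// mulr_ge0// pi_ge0.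
have E1 : (\int[P]_z (f z.1 ^+ 2 * pkernel e (z.1 - z.2))%:E = ((2 * pi) ^+ n * \int[mu]_x (f
  x ^+ 2)%R)%:E)%E.
  rewrite fubini_tonelli1; last 2 first.
  - exact/measurable_EFinP.
  - by move=> z; rewrite lee_fin.
  rewrite EFinM f2 -ge0_integralZl//.
  - apply: eq_integral => x _; rewrite /fubini_F.
    transitivity (\int[mu]_y ((f x ^+ 2)%:E * (pkernel e (x - y))%:E))%E; first by [].
    by rewrite ge0_integralZl// ?lee_fin ?sqr_ge0// integral_pkernel// muleC.
  - exact/measurable_EFinP.
  - by move=> x _; rewrite lee_fin sqr_ge0.
have pke (x y : 'rV[R]_n) : pkernel e (x - y) = pkernel e (y - x).
  by apply: eq_bigr => i _; rewrite !mxE; congr (_ / (_ + _)); ring.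
have E2 : (\int[P]_z (f z.2 ^+ 2 * pkernel e (z.1 - z.2))%:E = ((2 * pi) ^+ n * \int[mu]_x (f
  x ^+ 2)%R)%:E)%E.
  rewrite fubini_tonelli2; last 2 first.
  - exact/measurable_EFinP.
  - by move=> z; rewrite lee_fin.
  rewrite EFinM f2 -ge0_integralZl//.
  - apply: eq_integral => x _; rewrite /fubini_G.
    transitivity (\int[mu]_y ((f x ^+ 2)%:E * (pkernel e (x - y))%:E))%E.
      by apply: eq_integral => y _; rewrite -EFinM pke.
    by rewrite ge0_integralZl// ?lee_fin ?sqr_ge0// integral_pkernel// muleC.
  - exact/measurable_EFinP.
  - by move=> x _; rewrite lee_fin sqr_ge0.
pose S z := f z.1 ^+ 2 * pkernel e (z.1 - z.2) + f z.2 ^+ 2 * pkernel e (z.1 - z.2).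
have IS : (\int[P]_z (2^-1 * S z)%:E = ((2 * pi) ^+ n * \int[mu]_x (f x ^+ 2)%R)%:E)%E.
  under eq_integral do rewrite EFinM.
  rewrite ge0_integralZl//; last 2 first.
  - by apply/measurable_EFinP; exact: measurable_funD.
  - by move=> z _; rewrite lee_fin addr_ge0.
  under eq_integral do rewrite EFinD.
  rewrite ge0_integralD//; last 4 first.
  - by move=> z _; rewrite lee_fin.
  - exact/measurable_EFinP.
  - by move=> z _; rewrite lee_fin.
  - exact/measurable_EFinP.
  by rewrite E1 E2 -EFinD -EFinM; congr (_%:E); lra.
have le z : `|f z.1 * f z.2 * pkernel e (z.1 - z.2)| <= 2^-1 * S z.
  rewrite /S -(mulrDl (f z.1 ^+ 2)) mulrA normrM (ger0_norm (pkernel_ge0 _ _))//.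
  rewrite ler_wpM2r ?pkernel_ge0// normrM -[f z.1 ^+ 2]real_normK ?num_real//.
  rewrite -[f z.2 ^+ 2]real_normK ?num_real//.
  by have := sqr_ge0 (`|f z.1| - `|f z.2|); rewrite sqrrB mulr2n; lra.
have IS' : P.-integrable setT (EFin \o (fun z => 2^-1 * S z)).
  apply/integrableP; split.
    by apply/measurable_EFinP; apply: measurable_funM => //; exact: measurable_funD.
  rewrite (eq_integral (fun z => (2^-1 * S z)%:E)); first by rewrite IS ltry.
  by move=> z _; rewrite gee0_abs// lee_fin mulr_ge0// addr_ge0.
rewrite -IS; apply: le_integral => //.
- apply: (le_integrable _ _ _ IS') => //.
    apply/measurable_EFinP; apply: measurable_funM => //.
    by apply: measurable_tensor.
  by move=> z _; rewrite /= lee_fin (le_trans (le z))// ler_norm.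
- by move=> z _; rewrite lee_fin (le_trans (ler_norm _)).
Qed.

Lemma measurable_aweight_spectral_power :
  measurable_fun setT (fun xi => aweight e xi * spectral_power xi).
Proof.
apply/measurable_EFinP; have := measurable_fubini_F IK.
by rewrite (_ : fubini_F _ _ = EFin \o (fun xi => aweight e xi * spectral_power xi))//;
  apply/funext => xi; rewrite KE.
Qed.

End weight.

Lemma measurable_spectral_power : measurable_fun setT spectral_power.
Proof.
have e0 : 0 < 1 :> R by [].
have h := measurable_aweight_spectral_power e0.
(* [aweight (-1)] is the reciprocal of [aweight 1]; only the weighted function is known to be
   measurable, through Fubini. *)
rewrite (_ : spectral_power = (fun xi => (aweight 1 xi * spectral_power xi) * aweight (-1) xi)).
  by apply: measurable_funM => //; exact: measurable_aweight.
apply/funext => xi; rewrite mulrAC -big_split/= big1 ?mul1r// => i _.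
by rewrite /abel mul1r mulN1r opprK -expRD addNr expR0.
Qed.

Lemma spectral_power_ge0 xi : 0 <= spectral_power xi.
Proof. by rewrite addr_ge0 ?sqr_ge0. Qed.

(* Bessel's inequality up to the factor (2 pi)^n, i.e. the half of Plancherel's
   theorem that survives the limit e -> 0 in the Abel weight. *)
Lemma bessel_box (D : set 'rV[R]_n) (r : R) : measurable D ->
  (forall xi, D xi -> forall i, `|xi ord0 i| <= r) ->
  (\int[mu]_(xi in D) (spectral_power xi)%:E <=
   ((2 * pi) ^+ n * \int[mu]_x (f x ^+ 2)%R)%:E)%E.
Proof.
move=> mD Dr; set M := (2 * pi) ^+ n * _.
have M0 : 0 <= M.
  rewrite mulr_ge0 ?exprn_ge0 ?mulr_ge0 ?pi_ge0//.
  by apply: Rintegral_ge0 => x _; exact: sqr_ge0.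
have msp := measurable_spectral_power.
have key e : 0 < e -> (\int[mu]_(xi in D) (spectral_power xi)%:E <=
    (expR (e * (r *+ n)) * M)%:E)%E.
  move=> e0.
  (* On D the weight is at least exp(- e n r). The compensating factor exp(e n r) tends to 1 with
     e. *)
  have w0 xi : D xi -> 1 <= expR (e * (r *+ n)) * aweight e xi.
    move=> Dxi; rewrite -[X in r *+ X]card_ord -sumr_const mulr_sumr expR_sum -big_split/=.
    apply: (@le_trans _ _ (\prod_(i < n) 1)); first by rewrite big1.
    apply: ler_prod => i _; rewrite ler01 /abel -expRD -{1}expR0 ler_expR.
    by rewrite -mulrBr mulr_ge0 ?subr_ge0 ?Dr// ltW.
  apply: (@le_trans _ _ (\int[mu]_xi ((expR (e * (r *+ n)))%:E * (aweight e xi *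
    spectral_power xi)%:E))%E).
    rewrite integral_mkcond; apply: ge0_le_integral => //.
    - move=> xi _; rewrite patchE; case: ifP => // _; rewrite lee_fin;
      exact: spectral_power_ge0.
    - apply/(measurable_restrictT _ mD).
      by apply: measurable_funTS; exact/measurable_EFinP.
    - apply: emeasurable_funM => //.
      by apply/measurable_EFinP; exact: measurable_aweight_spectral_power.
    - move=> xi _; rewrite patchE; case: ifPn => [/set_mem Dxi|_].
        rewrite -EFinM lee_fin mulrA ler_peMl ?spectral_power_ge0//.
        exact: w0.
      by rewrite /= -EFinM lee_fin !mulr_ge0 ?expR_ge0 ?aweight_ge0 ?spectral_power_ge0.
  rewrite ge0_integralZl//; last 2 first.
  - by apply/measurable_EFinP; exact: measurable_aweight_spectral_power.
  - by move=> xi _; rewrite lee_fin mulr_ge0 ?aweight_ge0 ?spectral_power_ge0.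
  by rewrite EFinM lee_wpmul2l// ?integral_spectral_power_aweight// lee_fin expR_ge0.
have /fineK Afin : (\int[mu]_(xi in D) (spectral_power xi)%:E)%E \is a fin_num.
  rewrite ge0_fin_numE; first exact: le_lt_trans (key 1 ltr01) (ltry _).
  by apply: integral_ge0 => xi _; rewrite lee_fin spectral_power_ge0.
rewrite -Afin lee_fin; set A := fine _.
(* The limit e -> 0 is taken along e = 1 / (k + 1). *)
have cv : (fun k => expR (k.+1%:R^-1 * (r *+ n)) * M) @ \oo --> M.
  rewrite -[X in _ --> X]mul1r -[X in X * _]expR0 -(mul0r (r *+ n)).
  apply: cvgM; last exact: cvg_cst.
  apply: (cvg_comp _ expR); last exact: continuous_expR.
  by apply: cvgM; [exact: cvg_harmonic|exact: cvg_cst].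
rewrite -(cvg_lim _ cv)//; apply: limr_ge; first by apply/cvg_ex; exists M.
by near=> k; have := key k.+1%:R^-1; rewrite invr_gt0 ltr0n => /(_ isT); rewrite -Afin lee_fin.
Unshelve. all: by end_near. Qed.

End plancherel.

(** * Moments of the ball *)

Section ball.
Context {R : realType}.
Local Notation leb := (@lebesgue_measure R).
Local Notation mu n := (@lebesgue_rV R n).
Implicit Types n : nat.

(** The Euclidean ball; the norm carried by row vectors is the supremum norm, hence the detour
    through [rdot]. *)
Definition rball n (r : R) : set 'rV[R]_n := [set x | rdot x x <= r ^+ 2].
Arguments rball : clear implicits.

Definition unit_volume n : R := fine (mu n (rball n 1)).

Lemma rdot_ge0 n (x : 'rV[R]_n) : 0 <= rdot x x.
Proof. by apply: sumr_ge0 => i _; exact: sqr_ge0. Qed.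

Lemma rdot_coord_le n (x : 'rV[R]_n) i : (x ord0 i) ^+ 2 <= rdot x x.
Proof.
rewrite /rdot (bigD1 i)//= expr2 lerDl; apply: sumr_ge0 => j _; exact: sqr_ge0.
Qed.

Lemma measurable_rdot_self n : measurable_fun [set: 'rV[R]_n] (fun x => rdot x x).
Proof. exact: measurable_rdot. Qed.

Lemma measurable_le_fun d (T : measurableType d) (f g : T -> R) :
  measurable_fun setT f -> measurable_fun setT g -> measurable [set x | f x <= g x].
Proof.
move=> mf mg; rewrite (_ : [set x | _] = (fun x => g x - f x) @^-1` `[0, +oo[%classic).
  rewrite -[X in measurable X]setTI; apply: measurable_funB => //; exact: measurable_itv.
by apply/seteqP; split => x /=; rewrite in_itv/= andbT subr_ge0.
Qed.

Lemma measurable_rball n r : measurable (rball n r).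
Proof.
apply: (@measurable_le_fun _ 'rV[R]_n (fun x => rdot x x) (fun=> r ^+ 2));
  last exact: measurable_cst.
exact: measurable_rdot_self.
Qed.

Lemma rball_coord n r (x : 'rV[R]_n) i : 0 <= r -> rball n r x -> `|x ord0 i| <= r.
Proof.
move=> r0 xr; rewrite -ler_sqr ?nnegrE// real_normK ?num_real//.
exact: le_trans (rdot_coord_le x i) xr.
Qed.

Lemma rball1_fin n : mu n (rball n 1) \is a fin_num.
Proof.
rewrite ge0_fin_numE//; apply: (@le_lt_trans _ _ (mu n (@open_box R n (fun=> -2) (fun=> 2)))).
  apply: le_measure; [apply/mem_set; exact: measurable_rball|apply/mem_set;
    exact: measurable_open_box|].
  move=> x x1 i; rewrite in_itv/= -ltr_norml.
  by apply: le_lt_trans (rball_coord i ler01 x1) _; lra.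
by rewrite lebesgue_open_box ltry.
Qed.

Lemma lebesgue_rball n r : 0 < r -> mu n (rball n r) = (r ^+ n * unit_volume n)%:E.
Proof.
move=> r0; have ri0 (i : 'I_n) : r^-1 != 0 by rewrite invr_neq0// gt_eqF.
have := lebesgue_rV_affine 1%g (fun=> 0) ri0 (@measurable_rball n 1).
rewrite prodr_const card_ord normfV invrK gtr0_norm//.
rewrite -(fineK (rball1_fin n)) -EFinM => <-; congr (mu n _).
apply/seteqP; split=> x; rewrite /rball/= /rdot.
  move=> h; rewrite expr1n.
  under eq_bigr do rewrite !mxE perm1 addr0 mulrACA.
  by rewrite -mulr_sumr -expr2 exprVn ler_pdivrMl ?exprn_gt0// mulr1.
under eq_bigr do rewrite !mxE perm1 addr0 mulrACA.
by rewrite -mulr_sumr -expr2 exprVn ler_pdivrMl ?exprn_gt0// expr1n mulr1.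
Qed.

Lemma unit_volume_ge0 n : 0 <= unit_volume n.
Proof. by rewrite fine_ge0. Qed.

Definition sublevel n (a : R -> R) : set ('rV[R]_n * measurableTypeR R) :=
  [set p | rdot p.1 p.1 <= a p.2].
Arguments sublevel : clear implicits.

Lemma measurable_sublevel n a : measurable_fun [set: measurableTypeR R] a ->
  measurable (sublevel n a).
Proof.
move=> ma; apply: (@measurable_le_fun _ ('rV[R]_n * measurableTypeR R)%type
   (fun p => rdot p.1 p.1) (fun p => a p.2)).
  by apply: measurable_rdot; exact: measurable_fst.
exact: measurableT_comp ma measurable_snd.
Qed.

(** Tonelli for a radial function written as a superposition of indicators of balls. [a t] is the
    squared radius: t itself for the Gaussian, u^2 for the moments of |x|. *)
Lemma layer_cake n (a : R -> R) (g : R -> \bar R) :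
  measurable_fun [set: measurableTypeR R] a -> measurable_fun [set: measurableTypeR R] g ->
  (forall t, (0 <= g t)%E) ->
  (\int[mu n]_x \int[leb]_t (g t * (\1_[set t | rdot x x <= a t] t)%:E) =
   \int[leb]_t (g t * mu n [set x | (rdot x x <= a t)%R]))%E.
Proof.
move=> ma mg g0.
have mS := @measurable_sublevel n _ ma.
pose F (p : 'rV[R]_n * measurableTypeR R) : \bar R := (g p.2 * (\1_(sublevel n a) p)%:E)%E.
have mF : measurable_fun setT F.
  apply: emeasurable_funM; first exact: measurableT_comp mg measurable_snd.
  apply/measurable_EFinP; exact: measurable_indic.
have F0 p : (0 <= F p)%E by rewrite mule_ge0// lee_fin indicE.
have := @fubini_tonelli _ _ _ _ R (mu n) leb F mF F0.
have E1 x : (\int[leb]_t (g t * (\1_[set t | rdot x x <= a t] t)%:E) =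
   \int[leb]_t F (x, t))%E.
  by apply: eq_integral => t _; rewrite /F/= !indicE.
have E2 t : (\int[mu n]_x F (x, t) = g t * mu n [set x | (rdot x x <= a t)%R])%E.
  have mA : measurable [set x : 'rV[R]_n | rdot x x <= a t].
    by apply: measurable_le_fun; [exact: measurable_rdot_self|exact: measurable_cst].
  rewrite -[X in (_ * mu n X)%E]setIT -integral_indic//.
  transitivity (\int[mu n]_x (g t * ((\1_[set x : 'rV[R]_n | rdot x x <= a t] : 'rV[R]_n ->
    R) x)%:E))%E.
    by apply: eq_integral => x _; rewrite /F/= !indicE.
  by rewrite ge0_integralZl//; apply/measurable_EFinP; exact: measurable_indic.
by rewrite (eq_integral _ _ (fun x _ => E1 x)) => ->; apply: eq_integral => t _; rewrite E2.
Qed.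

Lemma measurable_sublevel_volume n a : measurable_fun [set: measurableTypeR R] a ->
  measurable_fun [set: measurableTypeR R] (fun t => mu n [set x | rdot x x <= a t]).
Proof.
move=> ma.
have := @measurable_fun_ysection _ _ _ _ R (mu n) _ (@measurable_sublevel n _ ma).
rewrite (_ : _ \o _ = (fun t => mu n [set x | rdot x x <= a t]))//.
by apply/funext => t /=; congr (mu n _); apply/seteqP; split => x /=; rewrite ysectionP.
Qed.

Lemma integral_expRN q : 0 <= q ->
  (\int[leb]_(t in `[q, +oo[) (expR (- t))%:E = (expR (- q))%:E)%E.
Proof.
move=> q0.
have dN t : is_derive t (1 : R) (fun t : R => - expR (- t)) (expR (- t)).
  have d1 : is_derive t (1 : R) (fun t : R => - t) (- 1) by exact: is_deriveN.
  have d2 := @is_derive1_comp R expR (fun t : R => - t) t _ _ (is_derive_expR _) d1.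
  have d3 : is_derive t (1 : R) (fun t : R => - expR (- t)) (- (-1 * expR (- t))).
    by have := is_deriveN d2; rewrite [_ * -1]mulrC.
  by apply: (is_derive_eq d3); rewrite mulN1r opprK.
have ce : continuous (fun t : R => expR (- t)).
  move=> t; apply: (@continuous_comp _ _ _ (fun t : R => - t) expR);
    last exact: continuous_expR.
  by apply: continuousN.
rewrite (@ge0_continuous_FTC2y _ _ (fun t => - expR (- t)) q 0).
- by rewrite -EFinB sub0r opprK.
- by move=> t _; exact: expR_ge0.
- exact: continuous_subspaceT.
- rewrite -[X in _ --> X]oppr0; apply: cvgN; exact: cvgr_expR.
- by move=> t _; have [] := dN t.
- by apply: cvg_at_right_filter; apply: cvgN; exact: ce.
- by move=> t _; rewrite derive1E; have [_ ->] := dN t.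
Qed.

Lemma integral_rV_gauss n :
  (\int[mu n]_x (expR (- rdot x x))%:E = (Num.sqrt pi ^+ n)%:E)%E.
Proof.
transitivity (\int[mu n]_x (\prod_i (gauss_fun (x ord0 i))%:E))%E.
  apply: eq_integral => x _; rewrite prodEFin; congr (_%:E).
  by rewrite /gauss_fun -expR_sum -sumrN.
rewrite (@ge0_integral_rV_prod _ _ (fun=> EFin \o @gauss_fun R)).
- rewrite (eq_bigr (fun=> (Num.sqrt pi)%:E)); last by move=> i _; exact: integralT_gauss.
  by rewrite prodEFin prodr_const card_ord.
- by move=> i; apply/measurable_EFinP; exact: measurable_gauss_fun.
- by move=> i x; rewrite lee_fin gauss_fun_ge0.
Qed.

(* The Gaussian integral computed in two ways, through
   exp(- |x|^2) = \int_(|x|^2)^oo exp(- t) dt. *)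
Lemma gamma_unit_volume n :
  (\int[leb]_(t in `]0%R, +oo[) (t `^ (n%:R / 2) * expR (- t))%:E *
   (unit_volume n)%:E = (pi `^ (n%:R / 2))%:E)%E.
Proof.
have pi0 := @pi_gt0 R.
have -> : pi `^ (n%:R / 2) = Num.sqrt pi ^+ n :> R.
  by rewrite mulrC powRrM -powR12_sqrt ?pi_ge0// powR_mulrn// powR_ge0.
rewrite -integral_rV_gauss.
pose g : R -> \bar R := (fun t => (expR (- t))%:E) \_ `[0, +oo[.
have ce : measurable_fun [set: measurableTypeR R] (fun t : R => (expR (- t))%:E).
  apply/measurable_EFinP; apply: continuous_measurable_fun.
  move=> t; apply: (@continuous_comp _ _ _ (fun t : R => - t) expR);
    last exact: continuous_expR.
  by apply: continuousN.
have mg : measurable_fun [set: measurableTypeR R] g.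
  by apply/(measurable_restrictT _ (measurable_itv _)); exact: measurable_funTS.
have g0 t : (0 <= g t)%E by rewrite /g patchE; case: ifP => // _; rewrite lee_fin expR_ge0.
have := @layer_cake n id g (@measurable_id _ _ _) mg g0.
have -> : (\int[mu n]_x \int[leb]_t (g t * (\1_[set t0 | rdot x x <= id t0] t)%:E) =
   \int[mu n]_x (expR (- rdot x x))%:E)%E.
  apply: eq_integral => x _; rewrite -integral_expRN ?rdot_ge0//.
  rewrite [RHS]integral_mkcond; apply: eq_integral => t _.
  rewrite /g !patchE indicE; case: (leP (rdot x x) t) => xt.
    have -> : t \in [set t0 | rdot x x <= t0] by apply/mem_set.
    have -> : t \in `[0, +oo[%classic.
      by apply/mem_set; rewrite /= in_itv/= andbT (le_trans (rdot_ge0 x)).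
    have -> : t \in `[rdot x x, +oo[%classic by apply/mem_set; rewrite /= in_itv/= andbT.
    by rewrite mule1.
  have -> : (t \in [set t0 | rdot x x <= t0]) = false.
    by apply: memNset; apply/negP; rewrite -ltNge.
  have -> : (t \in `[rdot x x, +oo[%classic) = false.
    by apply: memNset; apply/negP; rewrite in_itv/= andbT -ltNge.
  by rewrite mule0.
move=> ->.
have mf : measurable_fun [set: measurableTypeR R] (fun t =>
  (expR (- t))%:E * mu n [set x | (rdot x x <= t)%R])%E.
  apply: emeasurable_funM => //; exact: measurable_sublevel_volume (@measurable_id _ _ _).
transitivity (\int[leb]_(t in `[0%R, +oo[) ((expR (- t))%:E * mu n [set x | (rdot x x <=
  t)%R]))%E; last first.
  rewrite [LHS]integral_mkcond; apply: eq_integral => t _.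
  by rewrite /g !patchE; case: ifP => //; rewrite mul0e.
(* The point 0 is removed: [lebesgue_rball] wants a positive radius, and the Gamma integral is over
   the open half-line. *)
rewrite -integral_itv_obnd_cbnd; last exact: measurable_funTS.
rewrite -ge0_integralZr//; last 3 first.
- apply: measurable_funTS; apply/measurable_EFinP; apply: measurable_funM;
  first exact: measurable_powR.
  exact/measurable_EFinP.
- by move=> t _; rewrite lee_fin mulr_ge0 ?powR_ge0 ?expR_ge0.
- by rewrite lee_fin unit_volume_ge0.
apply: eq_integral => t /set_mem; rewrite /= in_itv/= andbT => t0.
have -> : mu n [set x | rdot x x <= t] = (t `^ (n%:R / 2) * unit_volume n)%:E.
  have -> : t `^ (n%:R / 2) = Num.sqrt t ^+ n.
    by rewrite mulrC powRrM -powR12_sqrt ?(ltW t0)// powR_mulrn// powR_ge0.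
  rewrite -lebesgue_rball ?sqrtr_gt0//; congr (mu n _); apply/seteqP.
  by split => x; rewrite /rball/= sqr_sqrtr ?(ltW t0).
by rewrite -!EFinM; congr (_%:E); ring.
Qed.

(** A zero volume would make the left-hand side of [gamma_unit_volume] vanish, while a power of pi
    is positive. *)
Lemma unit_volume_gt0 n : 0 < unit_volume n.
Proof.
have pi0 : 0 < pi `^ (n%:R / 2) :> R by rewrite powR_gt0 ?pi_gt0.
rewrite lt_neqAle unit_volume_ge0 andbT eq_sym; apply/eqP => V0.
have := gamma_unit_volume n; rewrite V0 mule0 => -[h].
by move: pi0; rewrite -h ltxx.
Qed.

(** [gamma_unit_volume] also shows that the Gamma integral is finite, since an infinite value times
    a positive volume would be infinite. One may then divide by it. *)
Lemma unit_volumeE n : unit_volume n = ball_volume R n.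
Proof.
have := gamma_unit_volume n; set I := (\int[leb]_(_ in _) _)%E => h.
have I0 : (0 <= I)%E.
  by apply: integral_ge0 => t _; rewrite lee_fin mulr_ge0 ?powR_ge0 ?expR_ge0.
have pi0 : 0 < pi `^ (n%:R / 2) :> R by rewrite powR_gt0 ?pi_gt0.
have V0 := unit_volume_gt0 n.
have Ifin : I \is a fin_num.
  rewrite ge0_fin_numE//; case: I I0 h => [r|//|//] _; first by rewrite ltry.
  by rewrite gt0_mulye// ?lte_fin.
rewrite /ball_volume /Gamma (addrC 1) addrK /Rintegral.
have -> : (\int[leb]_(t in `]0%R, +oo[) (t `^ (n%:R / 2) * expR (- t))%:E = I)%E by [].
move: h; rewrite -(fineK Ifin) -EFinM => -[h]; rewrite /= -h mulrC mulKf//.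
by apply/eqP => I00; move: pi0; rewrite -h I00 mul0r ltxx.
Qed.

Lemma integral_exprn k (a b : R) : a <= b ->
  (\int[leb]_(t in `[a, b]) (k.+1%:R * t ^+ k)%:E = (b ^+ k.+1 - a ^+ k.+1)%:E)%E.
Proof.
rewrite le_eqVlt => /predU1P[->|ab].
  by rewrite set_itv1 integral_set1 subrr.
have dX t : is_derive t (1 : R) (fun t : R => t ^+ k.+1) (k.+1%:R * t ^+ k).
  have d := @is_deriveX R R id k.+1 t (1 : R) 1 (is_derive_id t (1 : R)).
  have E : (fun t : R => t ^+ k.+1) = (@id R) ^+ k.+1 by apply/funext => s; rewrite exprfctE.
  by rewrite E; apply: (is_derive_eq d); rewrite [_ *: _]mulr1.
have cX (t : R) : {for t, continuous (fun t : R => t ^+ k.+1)} by exact: exprn_continuous.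
rewrite (@continuous_FTC2 _ _ (fun t => t ^+ k.+1)) ?EFinB//.
- apply: continuous_subspaceT => t.
  by apply: (@continuousM _ _ (fun=> k.+1%:R) (fun t : R => t ^+ k));
    [exact: cst_continuous|exact: exprn_continuous].
- split.
  + by move=> t _; have [] := dX t.
  + by apply: cvg_at_right_filter; exact: cX.
  + by apply: cvg_at_left_filter; exact: cX.
- by move=> t _; rewrite derive1E; have [_ ->] := dX t.
Qed.

Lemma integrable_rball n r (f : 'rV[R]_n -> R) M : 0 < r ->
  measurable_fun setT f -> (forall x, rball n r x -> `|f x| <= M) ->
  (mu n).-integrable (rball n r) (EFin \o f).
Proof.
move=> r0 mf fM; apply: measurable_bounded_integrable.
- exact: measurable_rball.
- by have /= -> := lebesgue_rball n r0; rewrite ltry.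
- exact: measurable_funTS.
- exists M; split; first exact: num_real.
  by move=> K MK x /= xr; apply: le_trans (fM x xr) (ltW MK).
Qed.

Lemma integrable_rball_rdotX n r m : 0 < r ->
  (mu n).-integrable (rball n r) (EFin \o (fun x => rdot x x ^+ m)).
Proof.
move=> r0; apply: (@integrable_rball _ _ _ (r ^+ 2 ^+ m)) => //.
  by apply: measurable_funX; exact: measurable_rdot_self.
move=> x xr; rewrite ger0_norm ?exprn_ge0 ?rdot_ge0//.
by rewrite lerXn2r ?nnegrE ?sqr_ge0 ?rdot_ge0.
Qed.

(* r^(2m) - |x|^(2m) is the integral of 2m u^(2m-1) over |x| <= u <= r. *)
Lemma Rintegral_rball_rdotX n r m : (0 < m)%N -> 0 < r ->
  \int[mu n]_(x in rball n r) (rdot x x ^+ m) =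
  n%:R / (n + 2 * m)%:R * (r ^+ (n + 2 * m) * unit_volume n).
Proof.
move=> m0 r0; set k := (2 * m).-1.
have k1 : (2 * m)%N = k.+1 by rewrite prednK// muln_gt0.
pose g : R -> \bar R := (fun u => (k.+1%:R * u ^+ k)%:E) \_ `[0, r].
have ck : measurable_fun [set: measurableTypeR R] (fun u : R => (k.+1%:R * u ^+ k)%:E).
  apply/measurable_EFinP; apply: measurable_funM; first exact: measurable_cst.
  exact: measurable_funX.
have mg : measurable_fun [set: measurableTypeR R] g.
  by apply/(measurable_restrictT _ (measurable_itv _)); exact: measurable_funTS.
have g0 t : (0 <= g t)%E.
  rewrite /g patchE; case: ifP => // /set_mem; rewrite /= in_itv/= => /andP[t0 _].
  by rewrite lee_fin mulr_ge0// exprn_ge0.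
have m2 : measurable_fun [set: measurableTypeR R] (fun u : R =>
  u ^+ 2) by exact: measurable_funX.
have := @layer_cake n (fun u => u ^+ 2) g m2 mg g0.
have -> : (\int[mu n]_x \int[leb]_t (g t * (\1_[set t0 | rdot x x <= t0 ^+ 2] t)%:E) =
   \int[mu n]_(x in rball n r) ((r ^+ 2 ^+ m - rdot x x ^+ m)%R)%:E)%E.
  rewrite [RHS]integral_mkcond; apply: eq_integral => x _.
  rewrite patchE; set q := rdot x x.
  have q0 : 0 <= q by exact: rdot_ge0.
  have sE t : 0 <= t -> (q <= t ^+ 2) = (Num.sqrt q <= t).
    by move=> t0; rewrite -[RHS]ler_sqr ?nnegrE ?sqrtr_ge0// sqr_sqrtr.
  case: (leP q (r ^+ 2)) => qr.
    rewrite mem_set//.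
    have sr : Num.sqrt q <= r by rewrite -sE// ltW.
    have -> : r ^+ 2 ^+ m - q ^+ m = r ^+ k.+1 - Num.sqrt q ^+ k.+1.
      by rewrite -k1 !exprM sqr_sqrtr.
    rewrite -integral_exprn// [RHS]integral_mkcond; apply: eq_integral => t _.
    rewrite /g !patchE indicE.
    have -> : (t \in `[Num.sqrt q, r]%classic) =
        (t \in `[0, r]%classic) && (t \in [set t0 | q <= t0 ^+ 2]).
      have -> : (t \in [set t0 | q <= t0 ^+ 2]) = (q <= t ^+ 2).
        by apply/idP/idP => [/set_mem//|?]; exact/mem_set.
      rewrite !mem_setE !in_itv/=.
      have [t0|t0] := leP 0 t; first by rewrite sE// andbC.
      by rewrite /= leNgt (lt_le_trans t0) ?sqrtr_ge0.
    by case: (t \in `[0, r]%classic) => /=; case: (t \in [set _ | _]);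
      rewrite ?mule1 ?mule0 ?mul0e.
  rewrite memNset; last by apply/negP; rewrite -ltNge.
  apply: integral0_eq => t _; rewrite /g patchE indicE.
  case: ifP => [/set_mem|_]; last by rewrite mul0e.
  rewrite /= in_itv/= => /andP[t0 tr].
  rewrite memNset ?mule0//=; apply/negP; rewrite -ltNge (le_lt_trans _ qr)//.
  by rewrite ler_sqr ?nnegrE// ltW.
have mV : measurable_fun [set: measurableTypeR R] (fun t =>
  (k.+1%:R * t ^+ k)%:E * mu n [set x | (rdot x x <= t ^+ 2)%R])%E.
  apply: emeasurable_funM => //; exact: measurable_sublevel_volume m2.
have -> : (\int[leb]_t (g t * mu n [set x | (rdot x x <= t ^+ 2)%R]) =
   ((2 * m)%:R / (n + 2 * m)%:R * unit_volume n * r ^+ (n + 2 * m))%:E)%E.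
  transitivity (\int[leb]_(t in `[0%R, r]) ((k.+1%:R * t ^+ k)%:E * mu n [set x | (rdot x x
    <= t ^+ 2)%R]))%E.
    rewrite [RHS]integral_mkcond; apply: eq_integral => t _.
    by rewrite /g !patchE; case: ifP => //; rewrite mul0e.
  rewrite -integral_itv_obnd_cbnd; last exact: measurable_funTS.
  have nk : (n + 2 * m)%N = (n + k).+1 by rewrite k1 addnS.
  pose c := (2 * m)%:R / (n + 2 * m)%:R * unit_volume n.
  transitivity (\int[leb]_(t in `]0%R, r]) (c%:E * ((n + k).+1%:R * t ^+ (n + k))%:E))%E.
    apply: eq_integral => t /set_mem; rewrite /= in_itv/= => /andP[t0 _].
    have /= -> := lebesgue_rball n t0; rewrite -!EFinM; congr (_%:E).
    have w0 : (n + k).+1%:R != 0 :> R by rewrite pnatr_eq0.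
    rewrite /c nk -k1 exprD; move: (t ^+ n) (t ^+ k) (unit_volume n) w0 => p q v.
    by move: ((n + k).+1%:R) ((2 * m)%:R) => w w' w0; field.
  rewrite integral_itv_obnd_cbnd; last first.
    apply: measurable_funTS; apply: emeasurable_funM; first exact: measurable_cst.
    apply/measurable_EFinP; apply: measurable_funM; first exact: measurable_cst.
    exact: measurable_funX.
  rewrite ge0_integralZl//; last 3 first.
  - apply: measurable_funTS; apply/measurable_EFinP; apply: measurable_funM;
    first exact: measurable_cst.
    exact: measurable_funX.
  - by move=> t; rewrite /= in_itv/= => /andP[t0 _]; rewrite lee_fin mulr_ge0// exprn_ge0.
  - by rewrite lee_fin /c !mulr_ge0 ?invr_ge0 ?unit_volume_ge0.
  by rewrite integral_exprn ?(ltW r0)// expr0n/= subr0 -EFinM /c nk.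
move=> h; have := congr1 fine h.
have I0 : (mu n).-integrable (rball n r) (EFin \o (fun=> r ^+ 2 ^+ m)).
  apply: (@integrable_rball _ _ _ (r ^+ 2 ^+ m)) => //.
  by move=> x _; rewrite ger0_norm// exprn_ge0// sqr_ge0.
rewrite -[fine (\int[mu n]_(_ in _) _)%E]/(Rintegral _ _ _).
rewrite RintegralB//; [|exact: measurable_rball|exact: integrable_rball_rdotX].
rewrite Rintegral_cst; last exact: measurable_rball.
have /= -> := lebesgue_rball n r0.
move=> h'; have {h'} : \int[mu n]_(x in rball n r) (rdot x x ^+ m) =
   r ^+ 2 ^+ m * (r ^+ n * unit_volume n) - (2 * m)%:R / (n + 2 * m)%:R * unit_volume n * r
     ^+ (n + 2 * m).
  by rewrite -h' opprB addrC subrK.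
have w0 : (n + 2 * m)%:R != 0 :> R by rewrite pnatr_eq0 k1 addnS.
have wE : (n + 2 * m)%:R = n%:R + (2 * m)%:R :> R by rewrite natrD.
(* The 1 cancels the contribution of the constant r^(2m) over the ball, which leaves the factor n /
   (n + 2m). *)
have -> : (2 * m)%:R / (n + 2 * m)%:R = 1 - n%:R / (n + 2 * m)%:R :> R.
  by apply: (mulIf w0); rewrite mulrBl mul1r !divfK// wE (addrC n%:R) addrK.
move=> ->; rewrite -exprM exprD; clear.
by move: (r ^+ n) (r ^+ (2 * m)) (unit_volume n) (n%:R / _) => p q v w; ring.
Qed.

Definition flip n (i : 'I_n) (j : 'I_n) : R := if j == i then -1 else 1.

Lemma rdot_affine_rV n (c : 'I_n -> R) (s : 'S_n) (x : 'rV[R]_n) : (forall i, c i ^+ 2 = 1) ->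
  rdot (affine_rV c s (fun=> 0) x) (affine_rV c s (fun=> 0) x) = rdot x x.
Proof.
move=> c1; rewrite /rdot [RHS](reindex_inj (@perm_inj _ s))/=.
by apply: eq_bigr => i _; rewrite !mxE !addr0 mulrACA -expr2 c1 mul1r.
Qed.

Lemma Rintegral_rball_affine n r (c : 'I_n -> R) (s : 'S_n) (f : 'rV[R]_n -> R) :
  (forall i, `|c i| = 1) -> (mu n).-integrable (rball n r) (EFin \o f) ->
  \int[mu n]_(x in rball n r) f (affine_rV c s (fun=> 0) x) = \int[mu n]_(x in rball n r) f x.
Proof.
move=> c1 fi.
have fi' : (mu n).-integrable setT (EFin \o (f \_ (rball n r))).
  by rewrite -restrict_EFin; apply/(integrable_mkcond _ (measurable_rball r)).
rewrite [RHS]Rintegral_mkcond -(integral_affine_rV s (fun=> 0) c1 fi') [LHS]Rintegral_mkcond.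
apply: eq_Rintegral => x _; rewrite !patchE.
have c2 i : c i ^+ 2 = 1 by rewrite -real_normK ?num_real// c1 expr1n.
have -> // : (affine_rV c s (fun=> 0) x \in rball n r) = (x \in rball n r).
by apply/idP/idP => /set_mem xr; apply/mem_set; move: xr; rewrite /rball/= rdot_affine_rV.
Qed.

Lemma integrable_rball_coordM n r (i j : 'I_n) : 0 < r ->
  (mu n).-integrable (rball n r) (EFin \o (fun x : 'rV[R]_n => x ord0 i * x ord0 j)).
Proof.
move=> r0; apply: (@integrable_rball _ _ _ (r * r)) => //.
  by apply: measurable_funM; exact: measurable_coord_rV.
by move=> x xr; rewrite normrM ler_pM ?(rball_coord _ (ltW r0) xr).
Qed.

(** For i != j, reflecting the i-th coordinate changes the sign. The diagonal moments agree by
    exchange of coordinates, so each is 1 / n of the integral of |x|^2. *)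
Lemma Rintegral_rball_coordM n r (i j : 'I_n) : 0 < r ->
  \int[mu n]_(x in rball n r) (x ord0 i * x ord0 j) =
  if i == j then r ^+ (n + 2) * unit_volume n / (n + 2)%:R else 0.
Proof.
move=> r0; have Iij i' j' := @integrable_rball_coordM n r i' j' r0.
case: eqVneq => [<-|ij].
  have sw k : \int[mu n]_(x in rball n r) (x ord0 k * x ord0 k) =
      \int[mu n]_(x in rball n r) (x ord0 i * x ord0 i).
    rewrite -(@Rintegral_rball_affine n r (fun=> 1) (tperm i k) (fun x : 'rV[R]_n =>
      x ord0 i * x ord0 i) (fun=> normr1 _) (Iij _ _)).
    by apply: eq_Rintegral => x _; rewrite !mxE tpermL mul1r addr0.
  have := @Rintegral_rball_rdotX n r 1 isT r0.
  have -> : \int[mu n]_(x in rball n r) (rdot x x ^+ 1) =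
      \sum_(k < n) \int[mu n]_(x in rball n r) (x ord0 k * x ord0 k).
    have mb := @measurable_rball n r.
    rewrite -(Rintegral_sum mb); last by move=> k; exact: Iij.
    by apply: eq_Rintegral => x _; rewrite expr1.
  under eq_bigr do rewrite sw.
  rewrite sumr_const card_ord -[X in X = _]mulr_natl muln1 => h.
  have n0 : n%:R != 0 :> R by rewrite pnatr_eq0 -lt0n (leq_ltn_trans (leq0n i))// ltn_ord.
  by apply: (mulfI n0); rewrite h; ring.
have fl k : `|flip i k| = 1 by rewrite /flip; case: ifP; rewrite ?normrN normr1.
have := @Rintegral_rball_affine n r (flip i) 1%g (fun x : 'rV[R]_n =>
  x ord0 i * x ord0 j) fl (Iij _ _).
rewrite (_ : \int[mu n]_(x in rball n r) _ = - \int[mu n]_(x in rball n r) (x ord0 i * x ord0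
  j)).
  by move=> h; lra.
rewrite -mulN1r -RintegralZl//; last exact: measurable_rball.
apply: eq_Rintegral => x _; rewrite !mxE !perm1 /flip eqxx eq_sym (negbTE ij); ring.
Qed.

(** Meant for [grad_form], whose matrix has trace |grad u|^2. *)
Lemma Rintegral_rball_quadratic n r (A : 'I_n -> 'I_n -> R) : 0 < r ->
  \int[mu n]_(x in rball n r) (\sum_i \sum_j (x ord0 i * x ord0 j) * A i j) =
  r ^+ (n + 2) * unit_volume n / (n + 2)%:R * \sum_i A i i.
Proof.
move=> r0; have mb := @measurable_rball n r.
have I1 i j : (mu n).-integrable (rball n r) (EFin \o (fun x : 'rV[R]_n =>
  x ord0 i * x ord0 j * A i j)).
  rewrite (_ : _ \o _ = EFin \o (fun x : 'rV[R]_n => A i j * (x ord0 i * x ord0 j))).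
    by apply: integrable_EFinZl => //; exact: integrable_rball_coordM.
  by apply/funext => x /=; rewrite mulrC.
rewrite (Rintegral_sum mb); last by move=> i; apply: (integrable_EFin_sum mb).
rewrite mulr_sumr; apply: eq_bigr => i _; rewrite (Rintegral_sum mb)//.
rewrite (bigD1 i)//= big1 ?addr0; last first.
  move=> j ji; rewrite RintegralZr//; last exact: integrable_rball_coordM.
  by rewrite Rintegral_rball_coordM// eq_sym (negbTE ji) mul0r.
rewrite RintegralZr//; last exact: integrable_rball_coordM.
by rewrite Rintegral_rball_coordM// eqxx.
Qed.

Lemma integrable_rball_quadratic n r (A : 'I_n -> 'I_n -> R) : 0 < r ->
  (mu n).-integrable (rball n r) (EFin \o (fun x : 'rV[R]_n =>
    \sum_i \sum_j (x ord0 i * x ord0 j) * A i j)).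
Proof.
move=> r0; have mb := @measurable_rball n r.
apply: integrable_EFin_sum => // i; apply: integrable_EFin_sum => // j.
rewrite (_ : _ \o _ = EFin \o (fun x : 'rV[R]_n => A i j * (x ord0 i * x ord0 j))).
  by apply: integrable_EFinZl => //; exact: integrable_rball_coordM.
by apply/funext => x /=; rewrite mulrC.
Qed.

End ball.

Arguments sublevel {R} n a.
Arguments rball {R} n r.
Arguments unit_volume {R} n.

(** * Multiplication by an essentially bounded function *)

Section linf_multiplier.
Context {R : realType} {d : nat}.
Local Notation mu := (@lebesgue_rV R d).
Variable Omega : set 'rV[R]_d.
Hypothesis mO : measurable Omega.
Local Notation L2 u := (in_Lp 2%:E Omega u).
Local Notation dot := (dotL2 Omega).
Variable phi : 'rV[R]_d -> R.
Hypothesis Lphi : in_Lp +oo%E Omega phi.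
Local Notation M := (normLp +oo%E Omega phi).

(** The norm with exponent [+oo] is an essential supremum only on a space of positive measure; this
    selects that case. *)
Lemma lebesgue_rV_setT_gt0 : (0 < mu setT)%E.
Proof.
apply: (@lt_le_trans _ _ (mu (@open_box R d (fun=> 0) (fun=> 1)))).
  rewrite lebesgue_open_box lte_fin; apply: prodr_gt0 => i _.
  by rewrite subr0 max_l.
by apply: le_measure => //; apply/mem_set => //; exact: measurable_open_box.
Qed.

Lemma ae_le_normLy : {ae mu, forall x, Omega x -> `|phi x| <= M}.
Proof.
have [/set_mem/= _ /set_mem/=] := andP Lphi.
rewrite /finite_norm /normLp unlock/= lebesgue_rV_setT_gt0 => fin.
have := ess_sup_ge mu (abse \o (EFin \o phi \_ Omega)).
apply: filterS => x; set S := ess_sup _ _ in fin *.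
rewrite /= patchE => + Ox; rewrite mem_set// => h.
by rewrite -lee_fin fineK// ge0_fin_numE// (le_trans _ h).
Qed.

Lemma measurable_linf : measurable_fun Omega phi.
Proof. by have [/set_mem/= mphi _] := andP Lphi; apply/(measurable_restrictT _ mO). Qed.

Lemma linf_mul_L2 u : L2 u -> L2 (fun x => phi x * u x).
Proof.
move=> Lu; have [mu' /integrableP[mu2 Iu]] := (in_L2P mO _).1 Lu.
have mpu : measurable_fun Omega (fun x => phi x * u x).
  by apply: measurable_funM => //; exact: measurable_linf.
apply/(in_L2P mO); split => //.
have mpu2 : measurable_fun Omega (EFin \o (fun x => (phi x * u x) ^+ 2)).
  by apply/measurable_EFinP; exact: measurable_funX.
apply/integrableP; split => //.
apply: (@le_lt_trans _ _ (\int[mu]_(x in Omega) ((M ^+ 2)%:E * `|(u x ^+ 2)%:E|))%E).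
  apply: ae_ge0_le_integral => //.
  - exact: measurableT_comp.
  - by move=> x _; rewrite mule_ge0// lee_fin sqr_ge0.
  - by apply: measurable_funeM; exact: measurableT_comp.
  - apply: filterS ae_le_normLy => x h Ox; have {h} := h Ox => h.
    rewrite /= lee_fin !ger0_norm ?sqr_ge0//.
    rewrite exprMn ler_wpM2r ?sqr_ge0// -real_normK ?num_real// lerXn2r ?nnegrE//.
    exact: normLp_ge0.
rewrite ge0_integralZl//; last 2 first.
- exact: measurableT_comp.
- by rewrite lee_fin sqr_ge0.
rewrite lte_mul_pinfty ?lee_fin ?sqr_ge0//.
Qed.

Lemma dotL2_linf_mul_le u : L2 u ->
  dot (fun x => phi x * u x) (fun x => phi x * u x) <= M ^+ 2 * dot u u.
Proof.
move=> Lu; have Lpu := linf_mul_L2 Lu.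
rewrite /dotL2 -RintegralZl//; last exact: in_L2_integrable.
rewrite /Rintegral fine_le//.
- by apply: integrable_fin_num => //; exact: in_L2_integrable.
- by apply: integrable_fin_num => //; apply: integrable_EFinZl => //; exact: in_L2_integrable.
apply: ae_ge0_le_integral => //.
- by move=> x _; rewrite lee_fin -expr2 sqr_ge0.
- by apply: measurable_int; exact: (in_L2_integrable mO Lpu Lpu).
- by move=> x _; rewrite lee_fin mulr_ge0// ?sqr_ge0// -expr2 sqr_ge0.
- by apply: measurable_int; apply: (@integrable_EFinZl _ _ _ mu _ mO);
  exact: (in_L2_integrable mO Lu Lu).
- apply: filterS ae_le_normLy => x h Ox; have {h} := h Ox => h.
  rewrite lee_fin -!expr2 exprMn ler_wpM2r ?sqr_ge0// -real_normK ?num_real// lerXn2r ?nnegrE//.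
  exact: normLp_ge0.
Qed.

End linf_multiplier.

(** * The theorem *)

Lemma ball_average_identity (F : fieldType) (z N L G r V p n : F) :
  n + 2 != 0 -> n + 4 != 0 ->
  (z * N - L) * (p * V) -
  (2 * G * (n / (n + 2) * (p * r ^+ 2 * V)) +
   N * (n / (n + 4) * (p * r ^+ 4 * V)) +
   4 * (p * r ^+ 2 * V / (n + 2) * G)) =
  V * p * (N * (z - n / (n + 4) * r ^+ 4) - 2 * r ^+ 2 * G - L).
Proof. by move=> n2 n4; field; rewrite n2 n4. Qed.

(** * Averaging the spectral inequality over a ball of frequencies *)

Section phase_space_average.
Context {R : realType} {d : nat}.
Local Notation mu := (@lebesgue_rV R d).
Variable Omega : set 'rV[R]_d.
Hypothesis oO : open Omega.
Let mO : measurable Omega := open_measurable_rV oO.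
Local Notation L2 u := (in_Lp 2%:E Omega u).
Local Notation dot := (dotL2 Omega).
Local Notation lap := (weak_laplacian Omega).
Local Notation wp := (weak_partial Omega).
Variables (Lambda : nat -> R) (U : nat -> 'rV[R]_d -> R).
Hypothesis hspec : biharmonic_spectrum Omega Lambda U.
Variable phi : 'rV[R]_d -> R.
Hypotheses (Hphi : H20 Omega phi) (Lphi : in_Lp +oo%E Omega phi).

Let Lphi2 : L2 phi. Proof. exact: H2_L2 (H20_H2 Hphi). Qed.
Let LU j : L2 (U j). Proof. exact: eigenfunction_L2 hspec j. Qed.

(** Extended by 0 outside Omega, so that the coefficients of the waves become Fourier integrals over
    the whole space. *)
Let f j : 'rV[R]_d -> R := (fun x => phi x * U j x) \_ Omega.

Let If j : mu.-integrable setT (EFin \o f j).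
Proof.
rewrite /f -restrict_EFin; apply/(integrable_mkcond _ mO); exact: in_L2_integrable.
Qed.

Let fE j : EFin \o (fun x => f j x ^+ 2) =
  (EFin \o (fun x => (phi x * U j x) * (phi x * U j x))) \_ Omega.
Proof.
apply/funext => x; rewrite /f /= !patchE; case: ifP => // _.
by rewrite expr0n.
Qed.

Let If2 j : mu.-integrable setT (EFin \o (fun x => f j x ^+ 2)).
Proof.
have LpU : L2 (fun x => phi x * U j x) by apply: linf_mul_L2.
rewrite fE; apply/(integrable_mkcond _ mO); exact: in_L2_integrable.
Qed.

Let norm_f j : \int[mu]_x (f j x ^+ 2) =
  dot (fun x => phi x * U j x) (fun x => phi x * U j x).
Proof.
rewrite /dotL2 [RHS]/Rintegral integral_mkcond -fE //.
Qed.

Lemma spectral_power_coefE j xi :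
  dot (fun x => wave 0 xi x * phi x) (U j) ^+ 2 +
  dot (fun x => wave (- (pi / 2)) xi x * phi x) (U j) ^+ 2 = spectral_power (f j) xi.
Proof.
rewrite /spectral_power /dotL2; congr (_ ^+ 2 + _ ^+ 2).
  rewrite Rintegral_mkcond; apply: eq_Rintegral => x _.
  by rewrite /f !patchE wave0E; case: ifP => _; rewrite ?mul0r//; ring.
rewrite Rintegral_mkcond; apply: eq_Rintegral => x _.
by rewrite /f !patchE waveNE; case: ifP => _; rewrite ?mul0r//; ring.
Qed.

Lemma dotL2_wave_self xi :
  dot (fun x => wave 0 xi x * phi x) (fun x => wave 0 xi x * phi x) +
  dot (fun x => wave (- (pi / 2)) xi x * phi x) (fun x => wave (- (pi / 2)) xi x * phi x) =
  dot phi phi.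
Proof.
have Lw p : L2 (fun x => wave p xi x * phi x) by exact: wave_L2.
rewrite /dotL2 -RintegralD//; [|exact: in_L2_integrable..].
apply: eq_Rintegral => x _; rewrite wave0E waveNE.
have := cos2Dsin2 (rdot xi x); move: (cos _) (sin _) (phi x) => c s p h.
by rewrite (mulrACA c) (mulrACA s) -!expr2 -mulrDl h mul1r.
Qed.

Lemma spectral_inequality_waves z xi :
  ((z * dot phi phi - (dot (lap phi) (lap phi)
     + 2 * rdot xi xi * norm_grad Omega phi ^+ 2
     + rdot xi xi ^+ 2 * dot phi phi + 4 * grad_form Omega phi xi))%:E <=
   \sum_(0 <= j <oo) (Num.max (z - Lambda j) 0 * spectral_power (f j) xi)%:E)%E.
Proof.
have Hw p : H20 Omega (fun x => wave p xi x * phi x) by exact: wave_H20.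
have H1 := spectral_inequality oO hspec z (Hw 0).
have H2 := spectral_inequality oO hspec z (Hw (- (pi / 2))).
have m0 j : 0 <= Num.max (z - Lambda j) 0 by rewrite le_max lexx orbT.
rewrite -(laplacian_waves oO xi Hphi) -(dotL2_wave_self xi).
have -> : (\sum_(0 <= j <oo) (Num.max (z - Lambda j) 0 * spectral_power (f j) xi)%:E =
  \sum_(0 <= j <oo) (Num.max (z - Lambda j) 0 * dot (fun x =>
    wave 0%R xi x * phi x)%R (U j) ^+ 2)%:E +
  \sum_(0 <= j <oo) (Num.max (z - Lambda j) 0 * dot (fun x =>
    wave (- (pi / 2)) xi x * phi x)%R (U j) ^+ 2)%:E)%E.
  rewrite -nneseriesD; first by apply: eq_eseriesr => j _;
    rewrite -spectral_power_coefE mulrDr EFinD.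
  - by move=> j _ _; rewrite lee_fin mulr_ge0// sqr_ge0.
  - by move=> j _ _; rewrite lee_fin mulr_ge0// sqr_ge0.
apply: le_trans (leeD H1 H2); rewrite -EFinD lee_fin.
by rewrite mulrDr opprD addrACA.
Qed.

(* By symmetry of the ball the cross term 4 (xi.grad phi)^2 averages to
   4 |xi|^2 |grad phi|^2 / d, so the coefficient of r^2 |grad phi|^2 is
   2 d/(d+2) + 4/(d+2) = 2. *)
Lemma phase_space_average z r : 0 < r ->
  ((unit_volume d * r ^+ d * (dot phi phi * (z - d%:R / (d%:R + 4) * r ^+ 4)
      - 2 * r ^+ 2 * norm_grad Omega phi ^+ 2 - dot (lap phi) (lap phi)))%:E <=
   ((2 * pi) ^+ d)%:E * \sum_(0 <= j <oo)
      (Num.max (z - Lambda j) 0 * dot (fun x => phi x * U j x)%R (fun x =>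
        phi x * U j x)%R)%:E)%E.
Proof.
move=> r0; have mD := @measurable_rball R d r.
have m0 j : 0 <= Num.max (z - Lambda j) 0 by rewrite le_max lexx orbT.
pose N2 := dot phi phi; pose G2 := norm_grad Omega phi ^+ 2;
  pose L2' := dot (lap phi) (lap phi).
pose A i j := dot (wp [:: i] phi) (wp [:: j] phi).
(* Grouped by powers of |xi|^2, the exponent 1 included, to match the moment formula for m = 1 and m
   = 2. *)
pose h xi := (z * N2 - L2') - (2 * G2 * rdot xi xi ^+ 1 + N2 * rdot xi xi ^+ 2
   + 4 * (\sum_i \sum_j xi ord0 i * xi ord0 j * A i j)).
pose S xi := (\sum_(0 <= j <oo) (Num.max (z - Lambda j) 0 * spectral_power (f j) xi)%:E)%E.
have hS xi : ((h xi)%:E <= S xi)%E.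
  apply: le_trans (spectral_inequality_waves z xi);
    rewrite lee_fin /h /N2 /G2 /L2' /A /grad_form.
  by rewrite le_eqVlt; apply/orP; left; apply/eqP; ring.
have I0 : mu.-integrable (rball d r) (EFin \o (fun=> z * N2 - L2')).
  by apply: (@integrable_rball _ _ _ _ `|z * N2 - L2'|) => // x _.
have I1 := @integrable_rball_rdotX R d r 1 r0.
have I2 := @integrable_rball_rdotX R d r 2 r0.
have I3 := integrable_rball_quadratic A r0.
have I1' := integrable_EFinZl mD (2 * G2) I1.
have I2' := integrable_EFinZl mD N2 I2.
have I3' := integrable_EFinZl mD 4 I3.
have I12 := integrable_EFinD mD I1' I2'.
have I123 := integrable_EFinD mD I12 I3'.
have Ih : mu.-integrable (rball d r) (EFin \o h) by exact: integrable_EFinB.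
have EV : fine (mu (rball d r)) = r ^+ d * unit_volume d.
  by have /= -> := lebesgue_rball d r0.
have trA : \sum_i A i i = G2 by rewrite /G2 sqr_norm_grad.
have Eh : \int[mu]_(xi in rball d r) h xi =
  unit_volume d * r ^+ d * (N2 * (z - d%:R / (d%:R + 4) * r ^+ 4) - 2 * r ^+ 2 * G2 - L2').
  rewrite /h RintegralB// Rintegral_cst//= EV RintegralD// RintegralD// !RintegralZl//.
  rewrite Rintegral_rball_quadratic// !Rintegral_rball_rdotX// trA !natrD.
  have d2 : d%:R + 2 != 0 :> R by rewrite gt_eqF// ltr_wpDl.
  have d4 : d%:R + 4 != 0 :> R by rewrite gt_eqF// ltr_wpDl.
  rewrite -[(2 * 1)%N]/2%N -[(2 * 2)%N]/4%N !exprD.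
  exact: ball_average_identity.
have msp j : measurable_fun setT (fun xi =>
  (Num.max (z - Lambda j) 0 * spectral_power (f j) xi)%:E).
  apply/measurable_EFinP; apply: measurable_funM; first exact: measurable_cst.
  exact: measurable_spectral_power (If j).
have sp0 j xi : (0 <= (Num.max (z - Lambda j) 0 * spectral_power (f j) xi)%:E)%E.
  by rewrite lee_fin mulr_ge0// spectral_power_ge0.
(* Sum and integral are exchanged by nonnegativity, then Bessel's inequality is applied to each
   term. *)
have ES : (\int[mu]_(xi in rball d r) S xi <= ((2 * pi) ^+ d)%:E * \sum_(0 <= j <oo)
   (Num.max (z - Lambda j) 0 * dot (fun x => phi x * U j x)%R (fun x => phi x * U j x)%R)%:E)%E.
  rewrite /S integral_nneseries//; last by move=> j; exact: measurable_funTS.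
  rewrite -nneseriesZl; last first.
    by move=> j _; rewrite lee_fin mulr_ge0// dotL2_ge0.
  apply: lee_nneseries => [j _ _|j _]; first by apply: integral_ge0 => xi _.
  under eq_integral do rewrite EFinM.
  rewrite ge0_integralZl//; last 3 first.
  - apply: measurable_funTS; apply/measurable_EFinP; exact: measurable_spectral_power (If j).
  - by move=> xi _; rewrite lee_fin spectral_power_ge0.
  - by rewrite lee_fin.
  rewrite EFinM muleCA lee_wpmul2l ?lee_fin// -norm_f -EFinM.
  apply: bessel_box => // xi xir i; exact: rball_coord (ltW r0) xir.
apply: le_trans ES; rewrite -Eh.
have S0 xi : (0 <= S xi)%E by apply: nneseries_ge0 => j _ _.
have mS : measurable_fun (rball d r) S.
  by apply: ge0_emeasurable_sum => [j xi _ _|j _]; [exact: sp0|exact: measurable_funTS].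
(* If the integral of the series is infinite the bound is trivial; otherwise [S] is integrable and
   pointwise comparison can be integrated. *)
have [Sfin|] := ltP (\int[mu]_(xi in rball d r) S xi)%E +oo%E; last first.
  by rewrite leye_eq => /eqP ->; rewrite leey.
have IS : mu.-integrable (rball d r) S.
  by apply/integrableP; split => //; under eq_integral do rewrite gee0_abs//.
rewrite /Rintegral fineK; last exact: integrable_fin_num.
by apply: le_integral => // xi _; exact: hS.
Qed.

End phase_space_average.

Lemma powR_div (R : realType) (x y a : R) : 0 <= x -> 0 < y ->
  (x / y) `^ a = x `^ a * y `^ (- a).
Proof.
move=> x0 y0; rewrite powRM ?invr_ge0 ?(ltW y0)//; congr (_ * _).
by rewrite -[y^-1]powR_inv1 ?(ltW y0)// -powRrM mulN1r.
Qed.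

Lemma riesz_mean_algebra (F : fieldType) (c V p N w n r2 G : F) :
  n + 4 != 0 -> c != 0 ->
  4 / (n + 4) * c^-1 * V * N * (p * w) - 2 * c^-1 * V * G * (p * r2) =
  c^-1 * (V * p * (N * w - N * (n / (n + 4) * w) - 2 * r2 * G)).
Proof. by move=> n4 c0; field; rewrite n4 c0. Qed.

(** After substituting V p, both sides of the second inequality contain the term c M k z, which
    drops out; what remains is divided by c M k. *)
Lemma eigenvalue_sum_algebra (R : realFieldType) (V p N z D r4 r2 G L c M k S : R) :
  0 < c -> 0 < M -> 0 < k -> 0 < N -> V * p = c * (k * M / N) ->
  V * p * (N * (z - D * r4) - 2 * r2 * G - L) <= c * (M * (k * z - S)) ->
  k^-1 * S <= D * r4 + 2 * (G / N) * r2 + L / N.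
Proof.
move=> c0 M0 k0 N0 -> h.
have cMk : 0 < c * M * k by rewrite !mulr_gt0.
rewrite -(ler_pM2l cMk).
have -> : c * M * k * (k^-1 * S) = c * M * S by field; rewrite gt_eqF.
have E : c * (k * M / N) * (N * (z - D * r4) - 2 * r2 * G - L) =
   c * M * k * z - c * M * k * (D * r4 + 2 * (G / N) * r2 + L / N).
  by field; rewrite gt_eqF.
by move: h; rewrite E; lra.
Qed.

(** * The Riesz mean bound and the eigenvalue bound *)

Section biharmonic_bounds.
Context {R : realType} {d : nat}.
Local Notation mu := (@lebesgue_rV R d).
Variable Omega : set 'rV[R]_d.
Hypothesis oO : open Omega.
Let mO : measurable Omega := open_measurable_rV oO.
Local Notation L2 u := (in_Lp 2%:E Omega u).
Local Notation dot := (dotL2 Omega).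
Local Notation lap := (weak_laplacian Omega).
Variables (Lambda : nat -> R) (U : nat -> 'rV[R]_d -> R).
Hypothesis d_gt0 : (0 < d)%N.
Hypothesis hspec : biharmonic_spectrum Omega Lambda U.
Variable phi : 'rV[R]_d -> R.
Hypotheses (Hphi : H20 Omega phi) (Lphi : in_Lp +oo%E Omega phi).
Hypothesis phi0 : ~ ae_zero Omega phi.
Local Notation N := (normLp 2%:E Omega phi).
Local Notation G := (norm_grad Omega phi).
Local Notation L := (normLp 2%:E Omega (lap phi)).
Local Notation B := (ball_volume R d).
Local Notation C := (weyl_constant R d).

Let d0 : 0 < d%:R :> R. Proof. by rewrite ltr0n. Qed.
Let c0 : 0 < (2 * pi) ^+ d :> R. Proof. by rewrite exprn_gt0// mulr_gt0// pi_gt0. Qed.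
Let B0 : 0 < B. Proof. by rewrite -unit_volumeE unit_volume_gt0. Qed.

Let N0 : 0 < N ^+ 2.
Proof.
rewrite lt_neqAle sqr_ge0 andbT eq_sym sqr_normL2; apply/eqP => h.
by apply: phi0; apply: dotL2_eq0_ae h; exact: H2_L2 (H20_H2 Hphi).
Qed.

Lemma riesz_mean_lower_bound z :
  ((4 / (d%:R + 4) * (2 * pi) ^- d * B * N ^+ 2
        * Num.max (z - L ^+ 2 / N ^+ 2) 0 `^ (d%:R / 4 + 1)
      - 2 * (2 * pi) ^- d * B * G ^+ 2
        * Num.max (z - L ^+ 2 / N ^+ 2) 0 `^ (d%:R / 4 + 1 / 2))%:E
     <= \sum_(0 <= j <oo)
          (Num.max (z - Lambda j) 0
             * normLp 2%:E Omega (fun x => phi x * U j x)%R ^+ 2)%:E)%E.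
Proof.
have m0 j : 0 <= Num.max (z - Lambda j) 0 by rewrite le_max lexx orbT.
have d4 : 0 < d%:R / 4 :> R by rewrite divr_gt0.
(* In the nonpositive case both powers of 0 have positive exponents, so the left-hand side is 0. *)
case: (leP (z - L ^+ 2 / N ^+ 2) 0) => [_|w0].
  rewrite !powR0 ?gt_eqF ?ltr_wpDr ?divr_ge0// ?mulr0 ?subrr.
  by apply: nneseries_ge0 => j _ _; rewrite lee_fin mulr_ge0// sqr_ge0.
set w := z - L ^+ 2 / N ^+ 2 in w0 *.
pose r := w `^ (4^-1).
have r0 : 0 < r by rewrite powR_gt0.
have rX k : r ^+ k = w `^ (4^-1 * k%:R) by rewrite -powR_mulrn ?(ltW r0)// powRrM.
have r4 : r ^+ 4 = w by rewrite rX mulVf ?powRr1 ?(ltW w0)// pnatr_eq0.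
have wD a b : w `^ (a + b) = w `^ a * w `^ b by rewrite powRD// (gt_eqF w0) implybT.
have w1 : w `^ (d%:R / 4 + 1) = r ^+ d * w.
  by rewrite wD powRr1 ?(ltW w0)// rX (mulrC 4^-1).
have w2 : w `^ (d%:R / 4 + 1 / 2) = r ^+ d * r ^+ 2.
  rewrite wD !rX (mulrC 4^-1); congr (_ * w `^ _).
  by field.
(* The constant 4 / (d + 4) arises as 1 - d / (d + 4), the first term coming from z and the second
   from r^4 = w. *)
rewrite w1 w2 riesz_mean_algebra; [|by rewrite gt_eqF// ltr_wpDl//..|by rewrite gt_eqF].
have := phase_space_average oO hspec Hphi Lphi z r0.
rewrite unit_volumeE -!sqr_normL2 r4 => h.
have E : N ^+ 2 * (z - d%:R / (d%:R + 4) * w) - 2 * r ^+ 2 * G ^+ 2 - L ^+ 2 =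
   N ^+ 2 * w - N ^+ 2 * (d%:R / (d%:R + 4) * w) - 2 * r ^+ 2 * G ^+ 2.
  have Lw : N ^+ 2 * z - L ^+ 2 = N ^+ 2 * w.
    by rewrite /w mulrBr [in RHS]mulrCA divff ?mulr1// gt_eqF.
  by rewrite mulrBr -Lw; ring.
rewrite -E EFinM lee_pdivrMl//.
by apply: le_trans h _; rewrite lee_wpmul2l ?lee_fin ?(ltW c0)//;
   apply: lee_nneseries => [j _ _|j _]; rewrite -sqr_normL2 // lee_fin mulr_ge0// sqr_ge0.
Qed.

Lemma spectrum_nondecreasing j k : (j <= k)%N -> Lambda j <= Lambda k.
Proof.
have [mono _ _] := hspec; move=> /subnKC <-.
by elim: (k - j)%N => [|m IH]; rewrite ?addn0// addnS (le_trans IH).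
Qed.

(** For j >= k monotonicity makes the positive part vanish. For j < k the normalized U_j gives |phi
    U_j|^2 at most the square of the essential supremum. *)
Lemma riesz_mean_eigenvalue k :
  (\sum_(0 <= j <oo) (Num.max (Lambda k - Lambda j) 0 *
      dot (fun x => phi x * U j x)%R (fun x => phi x * U j x)%R)%:E <=
   (normLp +oo Omega phi ^+ 2 * (k%:R * Lambda k - \sum_(j < k) Lambda j))%:E)%E.
Proof.
have m0 j : 0 <= Num.max (Lambda k - Lambda j) 0 by rewrite le_max lexx orbT.
rewrite (@nneseries_split _ _ 0%N k); last first.
  by move=> j _; rewrite lee_fin mulr_ge0// dotL2_ge0.
rewrite add0n [X in (_ + X)%E]eseries0 ?adde0; last first.
  move=> j kj _; rewrite max_r ?mul0r// subr_le0; exact: spectrum_nondecreasing.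
rewrite big_mkord sumEFin lee_fin.
have -> : k%:R * Lambda k - \sum_(j < k) Lambda j = \sum_(j < k) (Lambda k - Lambda j).
  by rewrite sumrB sumr_const card_ord mulr_natl.
rewrite mulr_sumr; apply: ler_sum => j _.
rewrite max_l ?subr_ge0; last by apply: spectrum_nondecreasing; exact: ltnW.
rewrite mulrC ler_wpM2r ?subr_ge0//; first by apply: spectrum_nondecreasing; exact: ltnW.
have LU := eigenfunction_L2 hspec j; have [_ _ [_ orth _]] := hspec.
by have := dotL2_linf_mul_le mO Lphi LU; rewrite orth eqxx mulr1.
Qed.

(* At z = Lambda k only the first k terms survive; the radius r, chosen so that
   B r^d = (2 pi)^d k M^2 / N^2, makes the contributions of z cancel. *)
Lemma eigenvalue_mean_upper_bound k : (mu Omega < +oo)%E -> (0 < k)%N ->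
    k%:R^-1 * \sum_(j < k) Lambda j
    <= d%:R / (d%:R + 4) * C ^+ 2 * (k%:R / volume Omega) `^ (4 / d%:R)
         * rho Omega phi `^ (- (4 / d%:R))
       + 2 * (G ^+ 2 / N ^+ 2) * C * (k%:R / volume Omega) `^ (2 / d%:R)
         * rho Omega phi `^ (- (2 / d%:R))
       + L ^+ 2 / N ^+ 2.
Proof.
move=> Ofin k0; set M := normLp +oo%E Omega phi.
(* If the essential supremum were 0, phi would vanish almost everywhere. *)
have M0 : 0 < M ^+ 2.
  rewrite lt_neqAle sqr_ge0 andbT eq_sym sqrf_eq0; apply/eqP => M0; apply: phi0.
  apply: filterS (ae_le_normLy Lphi) => x h Ox; apply/eqP.
  by rewrite -normr_le0 -M0; exact: h.
(* If |Omega| = 0, then Omega is itself a negligible set off which there is nothing to check, so phi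
   is zero almost everywhere. *)
have v0 : 0 < volume Omega.
  rewrite lt_neqAle fine_ge0// andbT eq_sym; apply/eqP => v0; apply: phi0.
  exists Omega; split => //; first by rewrite -[LHS]fineK ?[fine _]v0// ge0_fin_numE.
  by move=> x /= /not_implyP[].
have K0 : 0 < k%:R :> R by rewrite ltr0n.
have rho0 : 0 < rho Omega phi by rewrite /rho divr_gt0// mulr_gt0.
(* The factors (k / |Omega|)^a and rho^(-a) of the claim combine into s^a, and the volume cancels in
   s. *)
pose s := k%:R / volume Omega / rho Omega phi.
have s0 : 0 < s by rewrite /s divr_gt0// divr_gt0.
have sE : s = k%:R * M ^+ 2 / N ^+ 2.
  have E (n m v a : R) : 0 < n -> 0 < m -> 0 < v -> a / v / (n / (v * m)) = a * m / n.
    by move=> n0 m0 v'0; field; rewrite !gt_eqF.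
  exact: E.
pose q := (s / B) `^ (d%:R^-1).
have q0 : 0 < q by apply: powR_gt0; exact: divr_gt0.
pose r := 2 * pi * q.
have pi2 : 0 < 2 * pi :> R by rewrite mulr_gt0// pi_gt0.
have r0 : 0 < r by exact: mulr_gt0.
have qX n : q ^+ n = (s / B) `^ (n%:R / d%:R).
  by rewrite -powR_mulrn ?(ltW q0)// -powRrM (mulrC d%:R^-1).
have rd : B * r ^+ d = (2 * pi) ^+ d * (k%:R * M ^+ 2 / N ^+ 2).
  have sB : 0 <= s / B by rewrite ltW// divr_gt0.
  have dd : d%:R / d%:R = 1 :> R by rewrite divff// gt_eqF.
  rewrite -sE /r exprMn qX dd powRr1// mulrCA; congr (_ * _).
  by rewrite mulrC divfK// gt_eqF.
have Cs a : (k%:R / volume Omega) `^ a * rho Omega phi `^ (- a) = s `^ a.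
  by rewrite /s [RHS]powR_div// divr_ge0// ltW.
(* The Weyl constant is what the radius produces: r^2 = (2 pi)^2 (s / B)^(2 / d). *)
have r2 : r ^+ 2 = C * s `^ (2 / d%:R).
  rewrite /r exprMn qX powR_div ?(ltW s0)// /weyl_constant.
  by rewrite -mulrA; congr (_ * _); rewrite mulrC.
have r4 : r ^+ 4 = C ^+ 2 * s `^ (4 / d%:R).
  rewrite -[4%N]/(2 * 2)%N exprM r2 exprMn; congr (_ * _).
  by rewrite -powR_mulrn ?powR_ge0// -powRrM; congr (_ `^ _); field; rewrite gt_eqF.
have := phase_space_average oO hspec Hphi Lphi (Lambda k) r0.
move=> /le_trans /(_ (lee_wpmul2l _ (riesz_mean_eigenvalue k))).
rewrite lee_fin (ltW c0) => /(_ isT); rewrite -EFinM lee_fin unit_volumeE -!sqr_normL2 => h.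
have := eigenvalue_sum_algebra c0 M0 K0 N0 rd h.
by rewrite r4 r2 -!Cs !mulrA.
Qed.

End biharmonic_bounds.

Theorem theorem3 (R : realType) (d : nat) (Omega : set 'rV[R]_d)
    (Lambda : nat -> R) (U : nat -> 'rV[R]_d -> R) (phi : 'rV[R]_d -> R)
    (d_gt0 : (0 < d)%N)
    (Omega_neq0 : Omega !=set0) (Omega_open : open Omega)
    (Omega_connected : connected Omega)
    (Omega_fin : (lebesgue_rV d Omega < +oo)%E)
    (hspec : biharmonic_spectrum Omega Lambda U)
    (phi_H20 : H20 Omega phi) (phi_bounded : in_Lp +oo%E Omega phi)
    (phi_neq0 : ~ ae_zero Omega phi) :
  let N := normLp 2%:E Omega phi in
  let G := norm_grad Omega phi in
  let L := normLp 2%:E Omega (weak_laplacian Omega phi) in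
  let B := ball_volume R d in
  let C := weyl_constant R d in
  (forall z : R, 0 < z ->
    ((4 / (d%:R + 4) * (2 * pi) ^- d * B * N ^+ 2
        * Num.max (z - L ^+ 2 / N ^+ 2) 0 `^ (d%:R / 4 + 1)
      - 2 * (2 * pi) ^- d * B * G ^+ 2
        * Num.max (z - L ^+ 2 / N ^+ 2) 0 `^ (d%:R / 4 + 1 / 2))%:E
     <= \sum_(0 <= j <oo)
          (Num.max (z - Lambda j) 0
             * normLp 2%:E Omega (fun x => phi x * U j x)%R ^+ 2)%:E)%E)
  /\
  (rho Omega phi < 1 -> forall k : nat, (0 < k)%N ->
    k%:R^-1 * \sum_(j < k) Lambda j
    <= d%:R / (d%:R + 4) * C ^+ 2 * (k%:R / volume Omega) `^ (4 / d%:R)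
         * rho Omega phi `^ (- (4 / d%:R))
       + 2 * (G ^+ 2 / N ^+ 2) * C * (k%:R / volume Omega) `^ (2 / d%:R)
         * rho Omega phi `^ (- (2 / d%:R))
       + L ^+ 2 / N ^+ 2).
Proof.
split=> [z _|_ k k0]; first exact: riesz_mean_lower_bound.
exact: (eigenvalue_mean_upper_bound Omega_open d_gt0 hspec).
Qed.
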